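(* Let $V$ be a $4$-dimensional $\mathbf{k}$-vector space and let $(E_i)_{i\in I}$ be a collection of normal elliptic curves in $\mathbb{P}^3=\mathbb{P}V$. Then the Feigin–Odesskii brackets $(\Pi_{E_i})_{i\in I}$ are compatible if and only if either all $E_i$ lie on one quadric surface (possibly singular), or there exists a $3$-dimensional subspace $W\subset S^2V^*$ such that every $E_i$ is the intersection of two quadrics in $W$ (i.e. of two quadric surfaces defined by elements of $W$).
   Context: Work over an algebraically closed field $\mathbf{k}$ of characteristic $0$. $\mathbb{P}V$ denotes the projective space of lines in $V$. A normal elliptic curve $E\subset\mathbb{P}^n$ is a smooth curve of genus $1$ embedded by the complete linear system of a line bundle $L=\mathcal{O}(1)|_E$ of degree $n+1$, so that $\mathbb{P}^n=\mathbb{P}H^0(E,L)^*$. Feigin–Odesskii (FO) bracket $\Pi_E$: fix a trivialization of $\omega_E$; Serre duality gives $H^0(E,L)^*\simeq H^1(E,L^{-1})=\operatorname{Ext}^1(L,\mathcal{O})$, so $\mathbb{P}^n=\mathbb{P}\operatorname{Ext}^1(L,\mathcal{O})$. For $x\in\operatorname{Ext}^1(L,\mathcal{O})\setminus\{0\}$, the class of $0\to\mathcal{O}\xrightarrow{i}\mathcal{V}\xrightarrow{p}L\to 0$, identify (using the representative $x$ of the line $\langle x\rangle$) the cotangent space of $\mathbb{P}^n$ at $\langle x\rangle$ with $\langle x\rangle^\perp\subset H^0(E,L)$. For $s_1,s_2\in\langle x\rangle^\perp$ choose $\tilde s_1:\mathcal{V}\to L$ with $\tilde s_1\circ i=s_1$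 and $\tilde s_2\in H^0(E,\mathcal{V})$ with $p(\tilde s_2)=s_2$. Then $\Pi_E$ is the Poisson bivector on $\mathbb{P}^n$ with $(\Pi_E)_x(s_1\wedge s_2)=\langle \tilde s_1(\tilde s_2),x\rangle$. It is defined up to rescaling (depending on the trivialization of $\omega_E$). A collection of Poisson bivectors is called compatible if every linear combination of them is a Poisson bivector; equivalently, $[\Pi,\Pi']=0$ (Schouten bracket) for any two members $\Pi,\Pi'$. *)

(* Defs.v *)
From mathcomp Require Import all_boot all_order all_algebra.
From mathcomp Require Import boolp classical_sets functions.
From mathcomp Require Import mpoly.

Set Implicit Arguments.
Unset Strict Implicit.
Unset Printing Implicit Defensive.

Import GRing.Theory.
Local Open Scope classical_set_scope.
Local Open Scope ring_scope.

(* V is k^(n+1), written as row vectors; its dual, the linear forms, is written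
   as column vectors, and S^d V^* is the space of d-homogeneous polynomials.
   A subset of PV is given by its punctured cone in V, and functions on subsets
   of the cone are total functions whose values matter only on that subset. *)

(* dim (Z / (Z `&` B)) = g, for subspaces Z and B of M. *)
Definition quotient_dim (k : fieldType) (M : lmodType k) (Z B : set M)
    (g : nat) : Prop :=
  exists c : 'I_g -> M,
    [/\ forall l, Z (c l),
        forall a : 'I_g -> k, B (\sum_l a l *: c l) -> forall l, a l = 0
      & forall z, Z z -> exists a : 'I_g -> k, B (z - \sum_l a l *: c l)].

Section Varieties.
Variables (k : closedFieldType) (n : nat).
Implicit Types (E U X : set 'rV[k]_n.+1) (F G H : {mpoly k[n.+1]}).

Definition zeros (S : set {mpoly k[n.+1]}) : set 'rV[k]_n.+1 :=
  [set x | x != 0 /\ forall F, S F -> F.@[x 0] = 0].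

Definition proj_closed X : Prop :=
  exists2 S : set {mpoly k[n.+1]},
    (forall F, S F -> exists d : nat, F \is d.-homog) & X = zeros S.

Definition irreducible_variety E : Prop :=
  [/\ proj_closed E, E !=set0 &
      forall X Y, proj_closed X -> proj_closed Y -> E `<=` X `|` Y ->
        E `<=` X \/ E `<=` Y].

Definition vanishing E : set {mpoly k[n.+1]} :=
  [set F | forall x, E x -> F.@[x 0] = 0].

(* The Hilbert polynomial of E has degree one and leading coefficient d. *)
Definition curve_of_degree E (d : nat) : Prop :=
  exists (c : int) (m0 : nat), forall m : nat, (m0 <= m)%N ->
    exists2 h : nat, h%:Z = d%:Z * m%:Z + c
      & quotient_dim [set F | F \is m.-homog] (vanishing E) h.

Definition grad F (x : 'rV[k]_n.+1) : 'cV[k]_n.+1 := \col_b (F^`M(b)).@[x 0].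

(* Zariski tangent space at x of the cone over E; it has one dimension more
   than the tangent space of E at <x>. *)
Definition cone_tangent E (x : 'rV[k]_n.+1) : set 'rV[k]_n.+1 :=
  [set v | forall F (d : nat), F \is d.-homog -> vanishing E F ->
     v *m grad F x = 0].

Definition smooth_curve E : Prop :=
  forall x, E x -> quotient_dim (cone_tangent E x) [set 0] 2.

(* Sections of O_E(d) on the open subset of E where U holds. *)
Definition section E (d : int) U (s : 'rV[k]_n.+1 -> k) : Prop :=
  forall x, E x -> U x -> exists (p q : nat) F G,
    [/\ F \is p.-homog, G \is q.-homog, p%:Z = q%:Z + d & G.@[x 0] != 0] /\
    forall y, E y -> U y -> G.@[y 0] != 0 -> s y = F.@[y 0] / G.@[y 0].

(* Cech cohomology of O_E(d) for the affine open cover by the x_i != 0. *)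
Definition chart (i : 'I_n.+1) : set 'rV[k]_n.+1 := [set x | x 0 i != 0].

Definition cochain := 'I_n.+1 -> 'I_n.+1 -> 'rV[k]_n.+1 -> k^o.

Definition cocycle E (d : int) : set cochain :=
  [set e | (forall i j, section E d (chart i `&` chart j) (e i j)) /\
     forall i j l x, E x -> chart i x -> chart j x -> chart l x ->
       e i l x = e i j x + e j l x].

Definition coboundary E (d : int) : set cochain :=
  [set e | exists b : 'I_n.+1 -> 'rV[k]_n.+1 -> k,
     (forall i, section E d (chart i) (b i)) /\
     forall i j x, E x -> chart i x -> chart j x -> e i j x = b j x - b i x].

Definition genus E (g : nat) : Prop :=
  quotient_dim (cocycle E 0) (coboundary E 0) g.

Definition linform (s : 'cV[k]_n.+1) (x : 'rV[k]_n.+1) : k := (x *m s) 0 0.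

(* Restriction V^* -> H^0(E, O_E(1)) is bijective. *)
Definition linearly_complete E : Prop :=
  (forall s, (forall x, E x -> linform s x = 0) -> s = 0) /\
  (forall u, section E 1 setT u ->
     exists s, forall x, E x -> u x = linform s x).

Definition normal_elliptic_curve E : Prop :=
  [/\ irreducible_variety E, curve_of_degree E n.+1, smooth_curve E,
      genus E 1 & linearly_complete E].

(* Linear isomorphisms H^1(E, O) -> k. Composing a trivialization O = omega_E
   with the trace map H^1(E, omega_E) -> k gives such an isomorphism, and every
   one arises so, since both form a torsor under the nonzero scalars. *)
Definition trivialization E (tr : cochain -> k) : Prop :=
  [/\ forall (a : k) c c', cocycle E 0 c -> cocycle E 0 c' ->
        tr (a *: c + c') = a * tr c + tr c',
      forall c, cocycle E 0 c -> (tr c = 0 <-> coboundary E 0 c)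
    & forall a : k, exists2 c, cocycle E 0 c & tr c = a].

(* Cup product H^0(E, L) x H^1(E, L^-1) -> H^1(E, O). *)
Definition cup (u : 'rV[k]_n.+1 -> k) (e : cochain) : cochain :=
  fun i j x => u x * e i j x.

(* The point of V = H^0(E, L)^* given by a class in H^1(E, L^-1) under Serre
   duality, in the coordinates of V. *)
Definition serre (tr : cochain -> k) (e : cochain) : 'rV[k]_n.+1 :=
  \row_b tr (cup (fun y => y 0 b) e).

(* The extension 0 -> O -i-> V_e -p-> L -> 0 of class e in H^1(E, L^-1) has on
   x_i != 0 a splitting sigma_i of p, with sigma_j - sigma_i = i \o e_ij.
   Global sections of V_e over the section s of L are then the families
   i(f_i) + sigma_i(s) that agree on overlaps, and morphisms V_e -> L
   restricting to s on O are given by functions a_i with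
   i(f) + sigma_i(t) |-> s f + a_i t. *)
Definition lift_to_section E (e : cochain) (s : 'rV[k]_n.+1 -> k)
    (f : 'I_n.+1 -> 'rV[k]_n.+1 -> k) : Prop :=
  (forall i, section E 0 (chart i) (f i)) /\
  forall i j x, E x -> chart i x -> chart j x ->
    f i x = f j x + e i j x * s x.

Definition extension_to_hom E (e : cochain) (s : 'rV[k]_n.+1 -> k)
    (a : 'I_n.+1 -> 'rV[k]_n.+1 -> k) : Prop :=
  (forall i, section E 0 (chart i) (a i)) /\
  forall i j x, E x -> chart i x -> chart j x ->
    a j x = a i x + s x * e i j x.

(* Pi x s1 s2 is the value of a bivector at <x> on two cotangent vectors, where
   the cotangent space at <x> is identified with the annihilator of x by means
   of the representative x. Values outside the annihilator are irrelevant. *)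
Definition bivector_values := 'rV[k]_n.+1 -> 'cV[k]_n.+1 -> 'cV[k]_n.+1 -> k.

Definition FO_bracket E (Pi : bivector_values) : Prop :=
  exists2 tr : cochain -> k, trivialization E tr &
    forall (x : 'rV[k]_n.+1) (s1 s2 : 'cV[k]_n.+1),
      x != 0 -> x *m s1 = 0 -> x *m s2 = 0 ->
    forall e, cocycle E (-1) e -> serre tr e = x ->
    forall a f u,
      extension_to_hom E e (linform s1) a ->
      lift_to_section E e (linform s2) f ->
      (* u is the image of the section f under the morphism a *)
      (forall i y, E y -> chart i y ->
         u y = linform s1 y * f i y + a i y * linform s2 y) ->
      Pi x s1 s2 = tr (cup u e).

(* A polynomial F gives the regular function x |-> F(x / x_a) on x_a != 0, and
   every regular function there is of this form. *)
Definition dehomog (a : 'I_n.+1) (x : 'rV[k]_n.+1) : 'rV[k]_n.+1 :=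
  (x 0 a)^-1 *: x.

(* Its differential in x, by the chain rule. *)
Definition dchart (a : 'I_n.+1) F (x : 'rV[k]_n.+1) : 'cV[k]_n.+1 :=
  let y := dehomog a x in
  (x 0 a)^-1 *: (grad F y - delta_mx a 0 *m (y *m grad F y)).

(* {F, G} = H on x_a != 0. *)
Definition chart_bracket (Pi : bivector_values) (a : 'I_n.+1) F G H : Prop :=
  forall x, chart a x ->
    Pi x (dchart a F x) (dchart a G x) = H.@[dehomog a x 0].

(* In the second clause: the differentials at x of functions on PV are
   homogeneous of degree -1 in x. *)
Definition bivector (Pi : bivector_values) : Prop :=
  [/\ forall (x : 'rV[k]_n.+1) (b : k) s t r, x != 0 ->
        x *m s = 0 -> x *m t = 0 -> x *m r = 0 ->
        Pi x (b *: s + t) r = b * Pi x s r + Pi x t r /\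
        Pi x s t = - Pi x t s,
      forall (x : 'rV[k]_n.+1) (b : k) s t, x != 0 -> b != 0 ->
        x *m s = 0 -> x *m t = 0 -> Pi (b *: x) s t = b ^+ 2 * Pi x s t
    & forall a F G, exists H, chart_bracket Pi a F G H].

Definition Poisson_bivector (Pi : bivector_values) : Prop :=
  bivector Pi /\
  forall a F1 F2 F3 H12 H23 H31,
    chart_bracket Pi a F1 F2 H12 -> chart_bracket Pi a F2 F3 H23 ->
    chart_bracket Pi a F3 F1 H31 ->
    forall x, chart a x ->
      Pi x (dchart a H12 x) (dchart a F3 x) +
      Pi x (dchart a H23 x) (dchart a F1 x) +
      Pi x (dchart a H31 x) (dchart a F2 x) = 0.

Definition compatible (I : Type) (Pi : I -> bivector_values) : Prop :=
  forall (m : nat) (c : 'I_m -> k) (i : 'I_m -> I),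
    Poisson_bivector (fun x s t => \sum_l c l * Pi (i l) x s t).

Definition quadric_surface (q : dhomog n.+1 k 2) : set 'rV[k]_n.+1 :=
  zeros [set (q : {mpoly k[n.+1]})].

End Varieties.

(* Main.v *)
(* The ideal of a normal elliptic curve E in P^3 is generated by a pencil of
   quadrics Q1, Q2. Splitting the cocycles X_b e_c up to a multiple of a generator
   of H^1(E, O), where e_0, ..., e_3 is the basis of H^1(E, L^-1) dual to the
   coordinates, extends the bracket to a bivector r(x, y) bilinear in x and y with
   r(x, y) /\ x /\ y = 0 for y in E. Hence
   r(x, y) /\ x /\ y = A(x) Q1(y) + B(x) Q2(y) with quadrics A and B, and y = x gives
   A Q1 + B Q2 = 0, so A = - c Q2 and B = c Q1. Differentiating at y = x, the bracket
   is given by the 1-form al = c (Q1 dQ2 - Q2 dQ1), and c is not 0.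

   A quadratic bivector with 1-form al is Poisson iff al /\ d al = 0 in the affine
   charts. Hence the brackets of the pencils Q and R commute iff
   (Q1 dQ2 - Q2 dQ1) /\ dR1 /\ dR2 + (R1 dR2 - R2 dR1) /\ dQ1 /\ dQ2 = 0. This holds
   if the pencils share a member. Conversely, on E the first summand vanishes, so
   R1 dR2 - R2 dR1 vanishes along E; then R1 - c R2, with c chosen so that it is 0 at
   a point p of E, vanishes at p with all its derivatives along E, hence on E.

   So the brackets are compatible iff the planes of quadrics through the curves
   meet pairwise outside 0, and pairwise meeting planes share a line or lie in a
   common 3-space. *)

Require Import Defs.
From mathcomp Require Import all_boot all_order all_algebra.
From mathcomp Require Import boolp classical_sets functions.
From mathcomp Require Import mpoly.
From mathcomp Require Import ring zify.
Set Implicit Arguments.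
Unset Strict Implicit.
Unset Printing Implicit Defensive.
Import GRing.Theory.
Local Open Scope classical_set_scope.
Local Open Scope ring_scope.

(** * Forms and vanishing ideals *)

(** Sections, cohomology and degree are taken in their elementary definitions, and counting with the
    Hilbert polynomial replaces Riemann-Roch and Bezout. For G of degree q not vanishing on E of
    degree d, the space S_m / (I + G S_(m-q)) has dimension at most d q for large m; this bounds
    zeros on E with multiplicity. For q = 1, together with linear completeness, it yields two
    independent quadrics. A line disjoint from Q1 = Q2 = 0 makes S / (Q1, Q2) a module over two
    variables with generators of degrees 0, 1, 1, 2, and degree 4 leaves no room for further
    relations on E. Cohomology needs global denominators, which a graded Nullstellensatz supplies.
    With them each class in H^1(E, O) is a linear form times a class in H^1(E, L^-1), so that every
    point of V comes from an extension class. The constant c is nonzero because otherwise, for x off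
    Q1, r(x, y) would be a /\ y modulo x with a constant vector a, and this would make the class of
    x a coboundary on E. *)

Lemma exists_left_kernel (K : fieldType) (N h : nat) (A : 'M[K]_(N, h)) :
  (h < N)%N -> exists2 u : 'rV[K]_N, u != 0 & u *m A = 0.
Proof.
move=> hN; have /rowV0Pn [u /sub_kermxP uA u0] : kermx A != 0.
  by rewrite -mxrank_eq0 mxrank_ker subn_eq0 -ltnNge (leq_ltn_trans (rank_leq_col A)).
by exists u.
Qed.

Lemma trig_row_eq0 (K : fieldType) (N : nat) (a : 'I_N -> K)
    (p : 'I_N -> 'I_N -> K) :
  (forall i j : 'I_N, (i < j)%N -> p i j = 0) -> (forall i, p i i != 0) ->
  (forall j, \sum_i a i * p i j = 0) -> forall i, a i = 0.
Proof.
move=> ptrig pdiag ap i; pose A := \matrix_(i, j) p i j.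
have uA : A \in unitmx.
  have /det_trig dA : is_trig_mx A.
    by apply/is_trig_mxP => i1 j1 ij; rewrite mxE ptrig.
  rewrite unitmxE dA unitfE; apply/prodf_neq0 => j _; by rewrite mxE.
have /(congr1 (fun u => (u *m invmx A) 0 i)) : (\row_j a j) *m A = 0.
  by apply/rowP => j; rewrite !mxE -[RHS](ap j); apply: eq_bigr => l _; rewrite !mxE.
by rewrite mulmxK // mul0mx !mxE.
Qed.

(** Subspaces are kept as sets because polynomials and cochains form infinite-dimensional modules;
    [lin_closed_vspace] passes to [vspace] where the ambient space is finite-dimensional. *)
Definition lin_closed (k : fieldType) (M : lmodType k) (B : set M) : Prop :=
  B 0 /\ forall a u v, B u -> B v -> B (a *: u + v).

Section LinClosed.
Variables (k : fieldType) (M : lmodType k) (B : set M).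
Hypothesis Bl : lin_closed B.

Lemma lin_closedD u v : B u -> B v -> B (u + v).
Proof. by move=> Bu Bv; rewrite -[u]scale1r; apply: (proj2 Bl). Qed.

Lemma lin_closedZ a u : B u -> B (a *: u).
Proof. by move=> Bu; rewrite -[_ *: _]addr0; apply: (proj2 Bl) => //; case: Bl. Qed.

Lemma lin_closedN u : B u -> B (- u).
Proof. by rewrite -scaleN1r; apply: lin_closedZ. Qed.

Lemma lin_closedB u v : B u -> B v -> B (u - v).
Proof. by move=> Bu /lin_closedN; apply: lin_closedD. Qed.

Lemma lin_closed_sum (J : Type) (r : seq J) (P : pred J) (F : J -> M) :
  (forall i, P i -> B (F i)) -> B (\sum_(i <- r | P i) F i).
Proof. by move=> BF; elim/big_ind: _ => //; [case: Bl|exact: lin_closedD]. Qed.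

(** Modulo [B] each [F i] has coordinates in the [h] vectors [c l], and more than [h] rows of
    coordinates are dependent. *)
Lemma quotient_dependence (Z : set M) (h N : nat) (F : 'I_N -> M) :
  quotient_dim Z B h -> (h < N)%N -> (forall i, Z (F i)) ->
  exists2 a : 'I_N -> k, (exists i, a i != 0) & B (\sum_i a i *: F i).
Proof.
move=> [c [Zc _ cgen]] hN ZF.
have /choice [m mP] : forall i, exists m : 'I_h -> k, B (F i - \sum_l m l *: c l).
  by move=> i; apply: cgen.
have [u u0 uA] := exists_left_kernel (\matrix_(i, l) m i l) hN.
exists (fun i => u 0 i).
  by move/rV0Pn: u0.
have -> : \sum_i u 0 i *: F i = \sum_i u 0 i *: (F i - \sum_l m i l *: c l).
  apply/esym; under eq_bigr do rewrite scalerBr.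
  rewrite sumrB [X in _ - X](_ : _ = 0) ?subr0 //.
  under eq_bigr do rewrite scaler_sumr.
  rewrite exchange_big big1 //= => l _.
  under eq_bigr do rewrite scalerA.
  rewrite -scaler_suml; move/rowP/(_ l): uA; rewrite !mxE => uA.
  rewrite (_ : \sum_(i < N) _ = 0) ?scale0r // -[RHS]uA.
  by apply: eq_bigr => i _; rewrite !mxE.
by apply: lin_closed_sum => i _; apply: lin_closedZ.
Qed.

End LinClosed.

(** Uniqueness of digits in base [N]; it separates the exponents after the Kronecker substitution in
    [exists_meval_neq0]. *)
Lemma kronecker_inj (n N : nat) (f g : 'I_n -> nat) :
  (forall i, f i < N)%N -> (forall i, g i < N)%N ->
  (\sum_i f i * N ^ i = \sum_i g i * N ^ i)%N -> f =1 g.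
Proof.
elim: n f g => [|n IH] f g fN gN; first by move=> _ [].
rewrite !big_ord_recl !expn0 !muln1.
have shift (u : 'I_n.+1 -> nat) :
    (\sum_(i < n) u (lift ord0 i) * N ^ (lift ord0 i) =
     N * \sum_(i < n) u (lift ord0 i) * N ^ i)%N.
  by rewrite big_distrr; apply: eq_bigr => i _; rewrite /= /bump add1n expnS mulnCA.
rewrite !shift => e.
have N0 : (0 < N)%N by apply: leq_ltn_trans (fN ord0).
have e0 : f ord0 = g ord0.
  move/(congr1 (modn^~ N)): e.
  by rewrite ![(_ + N * _)%N]addnC ![(N * _)%N]mulnC !modnMDl !modn_small.
move: e; rewrite e0 => /addnI/eqP; rewrite eqn_pmul2l // => /eqP e i.
have eS := IH (fun i => f (lift ord0 i)) (fun i => g (lift ord0 i))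
  (fun i => fN _) (fun i => gN _) e.
by case: (unliftP ord0 i) => [j|] ->.
Qed.

(** Kronecker substitution [X_i = t ^ (N ^ i)]: with [N] above the degree, distinct monomials go to
    distinct powers of [t], so [P] is a nonzero polynomial in one variable and has a nonroot. *)
Lemma exists_meval_neq0 (k : closedFieldType) n (p : {mpoly k[n]}) :
  p != 0 -> exists v : 'I_n -> k, p.@[v] != 0.
Proof.
move=> p0; pose N := msize p.
pose w (m : 'X_{1..n}) := (\sum_i m i * N ^ i)%N.
pose P := \sum_(m <- msupp p) p@_m *: 'X^(w m).
have evP t : p.@[fun i => t ^+ (N ^ i)] = P.[t].
  rewrite mevalE horner_sum; apply: eq_bigr => m _.
  rewrite hornerZ hornerXn; congr (_ * _).
  by rewrite -prodrXr; apply: eq_bigr => i _; rewrite -exprM mulnC.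
have : P != 0.
  apply/negP => /eqP/(congr1 (fun q : {poly k} => q`_(w (mlead p)))).
  rewrite coef_sum coef0 (bigD1_seq (mlead p)) ?mlead_supp ?msupp_uniq //=.
  rewrite coefZ coefXn eqxx mulr1 big_seq_cond big1 ?addr0.
    by move/eqP; rewrite mleadc_eq0 (negPf p0).
  move=> m /andP [mp mm]; rewrite coefZ coefXn; case: eqP => [e|]; last by rewrite mulr0.
  case/eqP: mm; apply/mnmP; apply: (@kronecker_inj n N) => //.
    move=> i; apply: leq_ltn_trans (msize_mdeg_lt mp).
    by rewrite mdegE (bigD1 i) //= leq_addr.
  move=> i; apply: leq_ltn_trans (msize_mdeg_lt (mlead_supp p0)).
  by rewrite mdegE (bigD1 i) //= leq_addr.
by move/closed_nonrootP => [t]; rewrite rootE -evP; exists (fun i => t ^+ (N ^ i)).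
Qed.

Lemma mpoly_eq0P (k : closedFieldType) n (p : {mpoly k[n.+1]}) :
  (forall x : 'rV[k]_n.+1, p.@[x 0] = 0) -> p = 0.
Proof.
move=> p0; apply/eqP/negP => /negP/exists_meval_neq0 [v].
rewrite -(p0 (\row_i v i)) => /negP; apply; apply/eqP.
by apply: meval_eq => i; rewrite mxE.
Qed.

Lemma meval_scale (k : closedFieldType) n d (F : {mpoly k[n.+1]}) c
    (x : 'rV[k]_n.+1) :
  F \is d.-homog -> F.@[(c *: x) 0] = c ^+ d * F.@[x 0].
Proof.
move=> /dhomogP hF; rewrite !mevalE big_distrr /=.
apply: eq_big_seq => m /hF <-; rewrite mulrCA; congr (_ * _).
under eq_bigr do rewrite mxE exprMn.
by rewrite big_split /= prodrXr mdegE.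
Qed.

(* [zeros] compares [x], coerced to a function, with the zero function. *)
Lemma zerosP (k : closedFieldType) n (T : set {mpoly k[n.+1]}) (x : 'rV[k]_n.+1) :
  zeros T x <-> x != 0 /\ forall F, T F -> F.@[x 0] = 0.
Proof.
suff -> : (x != 0) = (fun_of_matrix x != 0) by [].
apply/idP/idP; apply: contra => /eqP e; apply/eqP.
  by apply/matrixP => i j; rewrite e mxE.
by rewrite e; apply/funext => i; apply/funext => j; rewrite mxE.
Qed.

Section LinForms.
Variables (k : closedFieldType) (n : nat).
Implicit Types (s : 'cV[k]_n.+1) (x : 'rV[k]_n.+1).

Definition lpoly s : {mpoly k[n.+1]} := \sum_b s b 0 *: 'X_b.

Lemma meval_lpoly s x : (lpoly s).@[x 0] = linform s x.
Proof.
rewrite /lpoly raddf_sum /linform mxE; apply: eq_bigr => b _ /=.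
by rewrite mevalZ mevalXU mulrC.
Qed.

Lemma lpoly_homog s : lpoly s \is 1.-homog.
Proof. by apply: rpred_sum => b _; apply: rpredZ; rewrite dhomogX; apply/eqP; exact: mdeg1. Qed.

Lemma linform_is_linear_form s a x y :
  linform s (a *: x + y) = a * linform s x + linform s y.
Proof. by rewrite /linform mulmxDl -scalemxAl !mxE. Qed.

Lemma linformD s t x : linform (s + t) x = linform s x + linform t x.
Proof. by rewrite /linform mulmxDr mxE. Qed.

Lemma linformZ a s x : linform (a *: s) x = a * linform s x.
Proof. by rewrite /linform -scalemxAr mxE. Qed.

Lemma linform0 x : linform 0 x = 0.
Proof. by rewrite /linform mulmx0 mxE. Qed.

Lemma linform_delta b x : linform (delta_mx b 0) x = x 0 b.
Proof.
rewrite /linform mxE (bigD1 b) //= mxE !eqxx mulr1 big1 ?addr0 // => j /negPf jb.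
by rewrite mxE jb mulr0.
Qed.

Lemma linform_sum s x : linform s x = \sum_b s b 0 * x 0 b.
Proof. by rewrite /linform mxE; apply: eq_bigr => b _; rewrite mulrC. Qed.

Lemma lpolyD s t : lpoly (s + t) = lpoly s + lpoly t.
Proof.
by rewrite -big_split; apply: eq_bigr => b _; rewrite mxE scalerDl.
Qed.

Lemma lpolyZ a s : lpoly (a *: s) = a *: lpoly s.
Proof. by rewrite scaler_sumr; apply: eq_bigr => b _; rewrite mxE scalerA. Qed.

Lemma lpoly_delta b : lpoly (delta_mx b 0) = 'X_b.
Proof.
rewrite /lpoly (bigD1 b) //= mxE !eqxx scale1r big1 ?addr0 // => j /negPf jb.
by rewrite mxE jb scale0r.
Qed.

End LinForms.

Section Curve.
Variables (k : closedFieldType) (n : nat) (E : set 'rV[k]_n.+1).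
Local Notation S := {mpoly k[n.+1]}.
Local Notation I := (vanishing E).
Implicit Types F G H : S.

Lemma vanishing_closed : lin_closed I.
Proof.
split=> [x _|a F G IF IG x Ex]; first exact: meval0.
by rewrite mevalD mevalZ IF // IG // mulr0 addr0.
Qed.

Lemma vanishingM F G : I G -> I (F * G).
Proof. by move=> IG x Ex; rewrite mevalM IG // mulr0. Qed.

Hypothesis irr : irreducible_variety E.

Lemma variety_neq0 x : E x -> x != 0.
Proof. by case: irr => -[T _ eE] _ _; rewrite eE => /zerosP []. Qed.

Lemma proj_closed_hypersurface F d : F \is d.-homog ->
  proj_closed (fun x : 'rV[k]_n.+1 => x != 0 /\ F.@[x 0] = 0).
Proof.
move=> hF; exists [set F]; first by move=> _ ->; exists d.
apply/seteqP; split=> x; first by case=> x0 Fx; apply/zerosP; split=> // _ ->.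
by move=> /zerosP [x0 Fx]; split=> //; apply: Fx.
Qed.

Lemma vanishing_prime F G p q : F \is p.-homog -> G \is q.-homog ->
  I (F * G) -> I F \/ I G.
Proof.
move=> hF hG IFG; case: irr => _ _ irrE.
case: (irrE _ _ (proj_closed_hypersurface hF) (proj_closed_hypersurface hG))
    => [x Ex|sub|sub]; last 2 first.
- by left=> x /sub [].
- by right=> x /sub [].
have x0 := variety_neq0 Ex; have /eqP := IFG x Ex.
by rewrite mevalM mulf_eq0 => /orP [/eqP|/eqP]; [left|right].
Qed.

Lemma exists_nonzero_at F : ~ I F -> exists2 x, E x & F.@[x 0] != 0.
Proof.
move=> nI; apply: contrapT => h; apply: nI => x Ex; apply/eqP/negPn/negP => Fx.
by apply: h; exists x.
Qed.

Lemma hypersurface_codim d q G : curve_of_degree E d -> G \is q.-homog -> ~ I G ->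
  exists m1, forall m N (F : 'I_N -> S), (m1 <= m)%N -> (d * q < N)%N ->
    (forall i, F i \is m.-homog) ->
    exists (a : 'I_N -> k) H, [/\ exists i, a i != 0, H \is (m - q).-homog
      & I (\sum_i a i *: F i - G * H)].
Proof.
move=> [c [m0 hdeg]] hG nIG; exists (m0 + q)%N => m N F lem leN hF.
have [h eh hd] := hdeg m ltac:(lia).
have [h' eh' [c' [c'hom c'free c'gen]]] := hdeg (m - q)%N ltac:(lia).
have eq_h : h = (h' + d * q)%N.
  have e : m%:Z = (m - q)%N%:Z + q%:Z by lia.
  by move: eh eh'; rewrite e mulrDr; lia.
pose T (i : 'I_(h' + N)) := match fintype.split i with inl l => G * c' l | inr j => F j end.
have hT i : T i \is m.-homog.
  rewrite /T; case: fintype.split => // l.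
  by rewrite -[m](@subnKC q) ?dhomogM //; [exact: c'hom|lia].
have [a [i ai0] Ia] := quotient_dependence vanishing_closed hd
  (F := T) ltac:(lia) hT.
move: Ia; rewrite big_split_ord /=.
have Tl l : T (lshift N l) = G * c' l.
  by rewrite /T -[lshift N l]/(unsplit (inl l)) unsplitK.
have Tr j : T (rshift h' j) = F j.
  by rewrite /T -[rshift h' j]/(unsplit (inr j)) unsplitK.
under eq_bigr do rewrite Tl scalerAr.
under [X in _ + X]eq_bigr do rewrite Tr.
rewrite -mulr_sumr => Ia.
exists (fun j => a (rshift h' j)), (- \sum_l a (lshift N l) *: c' l); split.
(* If all coefficients on the [F j] were zero, [G] times a combination of the [c' l] would vanish on
   [E]; primality and the independence of the [c' l] exclude this. *)
- apply: contrapT => nex.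
  have ar j : a (rshift h' j) = 0.
    by apply/eqP/negPn/negP => aj; apply: nex; exists j.
  move: Ia; rewrite [X in _ + X]big1 ?addr0 => [|j _]; last by rewrite ar scale0r.
  move/(vanishing_prime hG (q := (m - q)%N)) => -[|//|/c'free al].
    by apply: rpred_sum => l _; apply: rpredZ; exact: c'hom.
  case/eqP: ai0; case: (split_ordP i) => j ->; [exact: al|exact: ar].
- by rewrite rpredN; apply: rpred_sum => l _; apply: rpredZ; exact: c'hom.
- by rewrite mulrN opprK addrC.
Qed.

(** Zero counting in dual form: a triangular array makes the forms independent modulo [G]. The
    functionals are values at points in [exists_disjoint_form] and derivatives at a single point in
    [jets_vanish]. *)
Lemma functional_bound d q G : curve_of_degree E d -> G \is q.-homog -> ~ I G ->
  exists m1, forall m N (F : 'I_N -> S) (phi : 'I_N -> S -> k),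
    (m1 <= m)%N -> (forall i, F i \is m.-homog) ->
    (forall j a u v, phi j (a *: u + v) = a * phi j u + phi j v) ->
    (forall j u, I u -> u \is m.-homog -> phi j u = 0) ->
    (forall j H, H \is (m - q).-homog -> phi j (G * H) = 0) ->
    (forall i j : 'I_N, (i < j)%N -> phi j (F i) = 0) ->
    (forall i, phi i (F i) != 0) -> (N <= d * q)%N.
Proof.
move=> cd hG nIG; have [m1 hm] := hypersurface_codim cd hG nIG.
exists (m1 + q)%N => m N F phi lem hF philin phiI phiG ptrig pdiag.
rewrite leqNgt; apply/negP => leN.
have [a [H [[i ai] hH IH]]] := hm m N F ltac:(lia) leN hF.
have phi0 j : phi j 0 = 0.
  by have := philin j (-1) 0 0; rewrite scaler0 add0r => ->; rewrite mulN1r addNr.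
have phiD j u v : phi j (u + v) = phi j u + phi j v.
  by have := philin j 1 u v; rewrite scale1r mul1r.
have phisum j : phi j (\sum_i a i *: F i) = \sum_i a i * phi j (F i).
  elim/big_ind2: _ => // [x1 x2 y1 y2 e1 e2|l _]; first by rewrite phiD e1 e2.
  by have := philin j (a l) (F l) 0; rewrite phi0 !addr0.
case/eqP: ai; apply: (trig_row_eq0 ptrig pdiag) => j.
rewrite -phisum -(subrK (G * H) (\sum_i a i *: F i)) phiD.
rewrite phiG // addr0 phiI //.
rewrite rpredB //; first by apply: rpred_sum => l _; apply: rpredZ.
have -> : m = (q + (m - q))%N by lia.
exact: dhomogM.
Qed.

End Curve.

Lemma dhomog_prod_ord (k : fieldType) n N (F : 'I_N -> {mpoly k[n]}) :
  (forall j, F j \is 1.-homog) -> \prod_j F j \is N.-homog.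
Proof.
elim: N F => [|N IH] F hF; first by rewrite big_ord0 dhomog1.
by rewrite big_ord_recl; apply: (@dhomogM _ _ _ 1) => //; apply: IH.
Qed.

Section DisjointForm.
Variables (k : closedFieldType) (n d : nat) (E : set 'rV[k]_n.+1).
Hypotheses (irr : irreducible_variety E) (degE : curve_of_degree E d).
Local Notation S := {mpoly k[n.+1]}.
Local Notation I := (vanishing E).

Definition moment_form (l : k) : 'cV[k]_n.+1 := \col_b l ^+ b.

(** At a fixed nonzero [x] the value of [moment_form l] is a nonzero polynomial in [l], so finitely
    many points exclude only finitely many [l]. *)
Lemma exists_moment_form (r : seq 'rV[k]_n.+1) : all (fun x => x != 0) r ->
  exists l, all (fun x => linform (moment_form l) x != 0) r.
Proof.
move=> r0; pose p (x : 'rV[k]_n.+1) : {poly k} := \sum_b x 0 b *: 'X^b.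
have ev x l : (p x).[l] = linform (moment_form l) x.
  rewrite horner_sum linform_sum; apply: eq_bigr => b _.
  by rewrite hornerZ hornerXn !mxE mulrC.
have p0 x : x != 0 -> p x != 0.
  move=> x0; apply/negP => /eqP px; case/eqP: x0; apply/rowP => b; rewrite mxE.
  move: px => /(congr1 (fun q : {poly k} => q`_b)).
  rewrite coef_sum coef0 (bigD1 b) //= coefZ coefXn eqxx mulr1 big1 ?addr0 //.
  move=> j jb; rewrite coefZ coefXn (_ : (b == j :> nat) = false) ?mulr0 //.
  by apply/negP => /eqP/val_inj e; rewrite e eqxx in jb.
have : \prod_(x <- r) p x != 0.
  by rewrite prodf_seq_neq0; apply: sub_all r0 => x /= /p0 ->.
move=> /closed_nonrootP [l]; rewrite rootE horner_prod => hl; exists l.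
by move: hl; rewrite prodf_seq_neq0; apply: sub_all => x /=; rewrite ev.
Qed.

(** Otherwise every moment form has a zero on [E] where [s] vanishes. Taking each new form nonzero
    at the earlier points yields arbitrarily many zeros of [s] on [E], against the bound [d * 1]. *)
Lemma exists_disjoint_form s : ~ I (lpoly s) ->
  exists t, forall x, E x -> linform s x = 0 -> linform t x != 0.
Proof.
move=> nIs; apply: contrapT => nt.
have bad l : exists x, [/\ E x, linform s x = 0 & linform (moment_form l) x = 0].
  apply: contrapT => nx; apply: nt; exists (moment_form l) => x Ex sx.
  by apply/negP => /eqP tx; apply: nx; exists x.
have seqs N : exists (l : nat -> k) (x : nat -> 'rV[k]_n.+1),
    forall i, (i < N)%N -> [/\ E (x i), linform s (x i) = 0,
      linform (moment_form (l i)) (x i) = 0 &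
      forall j, (i < j < N)%N -> linform (moment_form (l j)) (x i) != 0].
  elim: N => [|N [l [x lx]]]; first by exists (fun _ => 0), (fun _ => 0).
  have [|a /allP ha] := @exists_moment_form [seq x i | i <- iota 0 N].
    apply/allP => y /mapP [i]; rewrite mem_iota => /andP [_ iN] ->.
    by have [Ex _ _ _] := lx i iN; exact: (variety_neq0 irr Ex).
  have [y [Ey sy ay]] := bad a.
  exists (fun i => if (i == N)%N then a else l i),
    (fun i => if (i == N)%N then y else x i) => i.
  rewrite ltnS leq_eqVlt => /orP [/eqP -> |iN].
    by rewrite eqxx; split=> // j; lia.
  have [Ex sx lix lj] := lx i iN.
  rewrite (ltn_eqF iN); split=> // j /andP [ij].
  rewrite ltnS leq_eqVlt => /orP [/eqP -> |jN].
    by rewrite eqxx; apply: ha; apply: map_f; rewrite mem_iota.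
  by rewrite (ltn_eqF jN); apply: lj; rewrite ij.
have [m1 bound] := functional_bound irr degE (lpoly_homog s) nIs.
pose N := (d * 1).+1; have [l [x lx]] := seqs N.+1.
pose t i := lpoly (moment_form (l i)).
(* [F i] vanishes at [x j] for [i < j] through the factor [t j], and does not vanish at [x i]. The
   additional form [t N] has no zero among these points and pads all products to one degree. *)
pose F (i : 'I_N) : S :=
  (\prod_(j < N) (if (i < j)%N then t j else t N)) * t N ^+ m1.
have evt i j : (t i).@[x j 0] = linform (moment_form (l i)) (x j).
  exact: meval_lpoly.
have evtN (i : 'I_N) : (t N).@[x i 0] != 0.
  by rewrite evt; have [_ _ _] := lx i (leqW (ltn_ord i)); apply; rewrite ltn_ord ltnSn.
have Fhom i : F i \is (N + m1).-homog.
  apply: dhomogM; last first.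
    by have := dhomogMn m1 (lpoly_homog (moment_form (l N))); rewrite mul1n.
  by apply: dhomog_prod_ord => j; case: ifP => _; exact: lpoly_homog.
suff : (N <= d * 1)%N by rewrite ltnn.
apply: (bound (N + m1)%N N F (fun j u => u.@[x j 0])) => //; first exact: leq_addl.
- by move=> j a u v; rewrite mevalD mevalZ.
- by move=> j u Iu _; apply: Iu; case: (lx j) => //; rewrite ltnS ltnW.
- move=> j H _; rewrite mevalM meval_lpoly.
  by have [_ -> _ _] := lx j (leqW (ltn_ord j)); rewrite mul0r.
- move=> i j ij; rewrite /F mevalM rmorph_prod /=.
  rewrite (bigD1 j) //= ij evt.
  by have [_ _ -> _] := lx j (leqW (ltn_ord j)); rewrite !mul0r.
- move=> i; rewrite /F mevalM rmorph_prod rmorphXn /= mulf_neq0 ?expf_neq0 //.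
  apply/prodf_neq0 => j _; case: ifP => // ij; rewrite evt.
  have [_ _ _] := lx i (leqW (ltn_ord i)); apply.
  by rewrite ij (leqW (ltn_ord j)).
Qed.

End DisjointForm.

Section Homogeneous.
Variables (k : fieldType) (n : nat).
Local Notation S := {mpoly k[n]}.
Implicit Types F G H : S.

Lemma pihomogM_homog d m F H : F \is d.-homog ->
  pihomog mdeg (d + m) (F * H) = F * pihomog mdeg m H.
Proof.
move=> hF; rewrite {1}(pihomog_partitionE (leqnn (mmeasure mdeg H))).
rewrite mulr_sumr raddf_sum /=.
have hFi i : F * pihomog mdeg i H \is (d + i).-homog by rewrite dhomogM ?pihomogP.
have [mH|mH] := ltnP m (mmeasure mdeg H).
  rewrite (bigD1 (Ordinal mH)) //= pihomog_dE // big1 ?addr0 // => i im.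
  rewrite (pihomog_ne0 _ (hFi i)) //; apply: contra im.
  by rewrite eqn_add2l => /eqP e; apply/eqP/val_inj.
rewrite big1 => [|i _]; last first.
  rewrite (pihomog_ne0 _ (hFi i)) // eqn_add2l.
  by have := ltn_ord i; apply: contraL => /eqP ->; rewrite -leqNgt.
rewrite [X in pihomog _ _ X](pihomog_partitionE (leqnn (mmeasure mdeg H))).
rewrite raddf_sum /= big1 ?mulr0 // => i _.
rewrite (pihomog_ne0 _ (pihomogP mdeg i H)) //.
by have := ltn_ord i; apply: contraL => /eqP ->; rewrite -leqNgt.
Qed.

Lemma pihomogM_small d m F H : F \is d.-homog -> (m < d)%N ->
  pihomog mdeg m (F * H) = 0.
Proof.
move=> hF md; rewrite (pihomog_partitionE (leqnn (mmeasure mdeg H))).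
rewrite mulr_sumr raddf_sum /= big1 // => i _.
have hFi : F * pihomog mdeg i H \is (d + i).-homog by rewrite dhomogM ?pihomogP.
by rewrite (pihomog_ne0 _ hFi) //; lia.
Qed.

Lemma pihomog_large m H : (mmeasure mdeg H <= m)%N -> pihomog mdeg m H = 0.
Proof.
move=> Hm; rewrite [X in pihomog _ _ X](pihomog_partitionE (leqnn (mmeasure mdeg H))).
rewrite raddf_sum /= big1 // => i _; rewrite (pihomog_ne0 _ (pihomogP mdeg i H)) //.
by have := ltn_ord i; apply: contraL => /eqP ->; rewrite -leqNgt.
Qed.

Definition ideal (B : set S) : Prop :=
  [/\ B 0, forall u v, B u -> B v -> B (u + v) & forall u v, B v -> B (u * v)].

Definition adjoin (B : set S) (y : S) : set S :=
  fun F => exists2 b, B b & exists c, F = b + y * c.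

Lemma adjoin_ideal B y : ideal B -> ideal (adjoin B y).
Proof.
move=> [B0 BD BM]; split.
- by exists 0 => //; exists 0; rewrite mulr0 addr0.
- move=> _ _ [b Bb [c ->]] [b' Bb' [c' ->]]; exists (b + b'); first exact: BD.
  by exists (c + c'); ring.
- move=> u _ [b Bb [c ->]]; exists (u * b); first exact: BM.
  by exists (u * c); ring.
Qed.

(** An equation [1 = b + (y - z) c] removes the factor [y - z] from the product; if it were solvable
    for every [z], 1 itself would end up in [B]. *)
Lemma ideal_split B y (r : seq k) : ideal B -> ~ B 1 ->
  B (\prod_(z <- r) (y - z%:MP)) -> exists z, ~ adjoin B (y - z%:MP) 1.
Proof.
move=> [B0 BD BM] nB1 Br; apply: contrapT => nz; apply: nB1.
elim: r Br => [|z r IH]; first by rewrite big_nil.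
rewrite big_cons => Bzr; apply: IH.
have : adjoin B (y - z%:MP) 1 by apply: contrapT => h; apply: nz; exists z.
move=> [b Bb [c e]]; rewrite -[\prod_(_ <- _) _]mul1r {1}e mulrDl.
apply: BD; first by rewrite mulrC; apply: BM.
by rewrite [_ * c]mulrC -mulrA; apply: BM.
Qed.

Lemma ideal_eval B (v : 'I_n -> k) : ideal B ->
  (forall i, B ('X_i - (v i)%:MP)) -> forall F, B (F - (F.@[v])%:MP).
Proof.
move=> [B0 BD BM] Bv.
pose T (F : S) := B (F - (F.@[v])%:MP).
have TD F G : T F -> T G -> T (F + G).
  rewrite /T mevalD mpolyCD => TF TG.
  by rewrite opprD addrACA; apply: BD.
have TM F G : T F -> T G -> T (F * G).
  rewrite /T mevalM mpolyCM => TF TG.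
  have -> : F * G - (F.@[v])%:MP * (G.@[v])%:MP =
    G * (F - (F.@[v])%:MP) + (F.@[v])%:MP * (G - (G.@[v])%:MP) by ring.
  by apply: BD; apply: BM.
have TC c : T c%:MP by rewrite /T mevalC subrr.
have T1 : T 1 by rewrite -mpolyC1; exact: TC.
move=> F; change (T F); elim/mpolyind: F => [|c m p _ _ Tp].
  by rewrite -[0]/(mpolyC n 0); exact: TC.
apply: TD => //; rewrite -mul_mpolyC; apply: (TM); first exact: TC.
rewrite mpolyXE_id; apply: (big_ind T T1 TM) => i _.
elim: (m i) => [|j IH]; rewrite ?expr0 // exprS.
by apply: (TM) => //; rewrite /T mevalXU; exact: Bv.
Qed.

End Homogeneous.

(** * A graded Nullstellensatz on the curve *)

Section Nullstellensatz.
Variables (k : closedFieldType) (n d : nat) (E : set 'rV[k]_n.+1).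
Hypotheses (irr : irreducible_variety E) (degE : curve_of_degree E d).
Local Notation S := {mpoly k[n.+1]}.
Local Notation I := (vanishing E).
Implicit Types F G H : S.

Definition graded_ideal (A : nat -> set S) : Prop :=
  [/\ forall q F, A q F -> F \is q.-homog, forall q, lin_closed (A q),
      forall p q F G, F \is p.-homog -> A q G -> A (p + q)%N (F * G)
    & forall q F, F \is q.-homog -> I F -> A q F].

Variables (A : nat -> set S) (e : nat) (f : S).
Hypotheses (gA : graded_ideal A) (hf : f \is e.+1.-homog).

(* The ideal of the affine scheme cut out by [A] and [f = 1]. *)
Definition dehomog_ideal : set S :=
  fun F => exists2 a, (forall m, A m (pihomog mdeg m a)) &
    exists H, F = a + (f - 1) * H.

Lemma dehomog_ideal_ideal : ideal dehomog_ideal.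
Proof.
have [Ahom Alin AM _] := gA; split.
- exists 0; last by exists 0; rewrite mulr0 addr0.
  by move=> m; rewrite pihomog0; case: (Alin m).
- move=> _ _ [a Aa [H ->]] [a' Aa' [H' ->]]; exists (a + a').
    by move=> m; rewrite pihomogD; apply: lin_closedD.
  by exists (H + H'); ring.
- move=> u _ [a Aa [H ->]]; exists (u * a); last by exists (u * H); ring.
  move=> m; rewrite (pihomog_partitionE (leqnn (mmeasure mdeg u))).
  rewrite mulr_suml raddf_sum; apply: lin_closed_sum => // i _ /=.
  have [im|mi] := leqP i m; last first.
    by rewrite (pihomogM_small _ (pihomogP mdeg i u)) //; case: (Alin m).
  rewrite -[m](subnKC im) (pihomogM_homog _ _ (pihomogP mdeg i u)).
  by apply: AM => //; exact: pihomogP.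
Qed.

Lemma dehomog_ideal_homog q F : A q F -> dehomog_ideal F.
Proof.
have [Ahom Alin AM _] := gA; move=> AF; exists F; last first.
  by exists 0; rewrite mulr0 addr0.
move=> m; have [<-|mq] := eqVneq q m; first by rewrite pihomog_dE // (Ahom _ _ AF).
by rewrite (pihomog_ne0 mq (Ahom _ _ AF)); case: (Alin m).
Qed.

(** Comparing the components of degree [e.+1 * N] in [1 = a + (f - 1) H] shows by induction that
    this component of [H] is [- f ^ N] modulo [A]. Beyond the degree of [H] it is zero. *)
Lemma dehomog_ideal1 : dehomog_ideal 1 -> exists N, A (e.+1 * N)%N (f ^+ N).
Proof.
have [Ahom Alin AM _] := gA; move=> [a Aa [H e1]].
have rec N : A (e.+1 * N)%N (pihomog mdeg (e.+1 * N) H + f ^+ N).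
  elim: N => [|N IH].
    have := congr1 (pihomog mdeg 0%N) e1.
    rewrite (pihomog_dE (dhomog1 _ mdeg)) mulrBl mul1r pihomogD pihomogB.
    rewrite (pihomogM_small _ hf) // sub0r => e0.
    by rewrite muln0 expr0 e0 addrC subrK.
  have := congr1 (pihomog mdeg (e.+1 * N.+1)) e1.
  rewrite (pihomog_ne0 (d := 0%N) _ (dhomog1 _ mdeg)); last by rewrite mulnS.
  rewrite mulrBl mul1r pihomogD pihomogB.
  rewrite {2}mulnS (pihomogM_homog _ _ hf) => e0.
  have -> : pihomog mdeg (e.+1 * N.+1) H + f ^+ N.+1 =
      pihomog mdeg (e.+1 * N.+1) a + f * (pihomog mdeg (e.+1 * N) H + f ^+ N).
    rewrite mulrDr addrA -exprS; congr (_ + _); apply/esym/eqP.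
    by rewrite -subr_eq0 -addrA -e0.
  by apply: lin_closedD => //; rewrite mulnS; apply: AM.
exists (mmeasure mdeg H); have := rec (mmeasure mdeg H).
by rewrite pihomog_large ?add0r // leq_pmull.
Qed.

Hypothesis Af : forall x, E x -> f.@[x 0] != 0 ->
  exists q G, A q G /\ G.@[x 0] != 0.

(** The forms [F a] are powers of ['X_i] homogenized by [f]. There are more than [d * q] of them, so
    a combination is a multiple of [G] on [E] and lies in [A]; at [f = 1] it becomes the polynomial
    [p] in ['X_i]. Only exponents divisible by [e.+1] occur, since a power of [f] has to supply the
    missing degree. *)
Lemma dehomog_ideal_univariate q G (i : 'I_n.+1) : A q G -> ~ I G ->
  exists r : seq k, dehomog_ideal (\prod_(z <- r) ('X_i - z%:MP)).
Proof.
have [Ahom Alin AM AI] := gA; move=> AG nIG.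
have [m1 hm] := hypersurface_codim irr degE (Ahom _ _ AG) nIG.
pose N := (d * q).+1; pose M := (N + m1 + q)%N.
pose F (a : 'I_N) : S := 'X_i ^+ (e.+1 * a) * f ^+ (M - a).
have hX : ('X_i : S) \is 1.-homog by rewrite dhomogX; apply/eqP; exact: mdeg1.
have hF a : F a \is (e.+1 * M).-homog.
  have -> : (e.+1 * M = 1 * (e.+1 * a) + e.+1 * (M - a))%N.
    by rewrite mul1n -mulnDr subnKC // /M; have := ltn_ord a; lia.
  by apply: dhomogM; apply: dhomogMn.
have [c [H [[a0 ca0] hH IF]]] := hm (e.+1 * M)%N N F ltac:(nia) (leqnn _) hF.
have AF : A (e.+1 * M)%N (\sum_a c a *: F a).
  rewrite -(subrK (G * H) (\sum_a c a *: F a)); apply: lin_closedD => //.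
    apply: AI => //; rewrite rpredB //; first by apply: rpred_sum => a _; apply: rpredZ; exact: hF.
    have -> : (e.+1 * M = q + (e.+1 * M - q))%N by nia.
    by apply: dhomogM => //; exact: Ahom AG.
  have -> : (e.+1 * M = e.+1 * M - q + q)%N by nia.
  by rewrite mulrC; apply: AM.
pose p : {poly k} := \sum_(a < N) c a *: 'X^(e.+1 * a).
have p0 : p != 0.
  apply/negP => /eqP/(congr1 (fun r : {poly k} => r`_(e.+1 * a0))).
  rewrite coef_sum coef0 (bigD1 a0) //= coefZ coefXn eqxx mulr1 big1 ?addr0.
    by move/eqP; rewrite (negPf ca0).
  move=> a aa; rewrite coefZ coefXn eqn_pmul2l // (_ : (_ == _) = false) ?mulr0 //.
  by apply/negP => /eqP/val_inj ee; rewrite ee eqxx in aa.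
have [r pr] := closed_field_poly_normal p; exists r.
have [D0 DD DM] := dehomog_ideal_ideal.
have evp : (map_poly (@mpolyC n.+1 k) p).['X_i] =
    (lead_coef p)%:MP * \prod_(z <- r) ('X_i - z%:MP).
  rewrite pr lead_coefZ (monicP (monic_prod_XsubC _ _ _)) mulr1.
  rewrite map_polyZ hornerZ rmorph_prod horner_prod; congr (_ * _).
  by apply: eq_bigr => z _; rewrite /= map_polyXsubC hornerXsubC.
suff Dp : dehomog_ideal (map_poly (@mpolyC n.+1 k) p).['X_i].
  have -> : \prod_(z <- r) ('X_i - z%:MP) = ((lead_coef p)^-1)%:MP *
      (map_poly (@mpolyC n.+1 k) p).['X_i] :> S.
    by rewrite evp mulrA -mpolyCM mulVf ?lead_coef_eq0 // mpolyC1 mul1r.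
  exact: DM.
(* Modulo [f - 1] each [f ^+ (M - a)] is 1, with the geometric sum as quotient. *)
have -> : (map_poly (@mpolyC n.+1 k) p).['X_i] = \sum_a c a *: F a +
    (f - 1) * (- \sum_(a < N) c a *: ('X_i ^+ (e.+1 * a) *
       \sum_(j < M - a) f ^+ j)).
  rewrite rmorph_sum horner_sum mulrN mulr_sumr -sumrB; apply: eq_bigr => a _.
  rewrite /= map_polyZ map_polyXn hornerZ hornerXn mul_mpolyC.
  rewrite -scalerAr mulrCA -subrX1 -scalerBr; congr (_ *: _).
  by rewrite /F; ring.
by have [a' Aa' [H' ->]] := dehomog_ideal_homog AF; exists a' => //;
  eexists; rewrite -addrA -mulrDr.
Qed.

(** If no such power lies in [A], the ideal of [A] and [f = 1] is proper. Each coordinate satisfies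
    a univariate equation modulo it, so its value can be fixed at some root without reaching 1, one
    coordinate after another. The resulting point lies on [E], has [f = 1], and all of [A] vanishes
    there, against [Af]. *)
Theorem graded_nullstellensatz : exists N, A (e.+1 * N)%N (f ^+ N).
Proof.
have [Ahom Alin AM AI] := gA.
apply: contrapT => nN.
have D1 : ~ dehomog_ideal 1 by move/dehomog_ideal1.
have nIf : ~ I f.
  move=> If; apply: nN; exists 1%N; rewrite muln1 expr1; exact: AI.
have [x0 Ex0 fx0] := exists_nonzero_at nIf.
have [q [G [AG Gx0]]] := Af Ex0 fx0.
have nIG : ~ I G by move=> IG; rewrite IG ?eqxx in Gx0.
have steps j : (j <= n.+1)%N -> exists B (v : 'I_n.+1 -> k),
    [/\ ideal B, ~ B 1, forall F, dehomog_ideal F -> B F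
      & forall i : 'I_n.+1, (i < j)%N -> B ('X_i - (v i)%:MP)].
  elim: j => [_|j IH jn].
    by exists dehomog_ideal, (fun _ => 0); split=> //; exact: dehomog_ideal_ideal.
  have [B [v [iB B1 DB Bv]]] := IH (ltnW jn).
  have [r /DB Br] := dehomog_ideal_univariate (Ordinal jn) AG nIG.
  have [z nz] := ideal_split iB B1 Br.
  exists (adjoin B ('X_(Ordinal jn) - z%:MP)).
  exists (fun i : 'I_n.+1 => if i == j :> nat then z else v i); split=> //.
  - exact: adjoin_ideal.
  - by move=> F /DB BF; exists F => //; exists 0; rewrite mulr0 addr0.
  - move=> i; rewrite ltnS leq_eqVlt => /orP [ij|ij].
      rewrite ij; exists 0; first by case: iB.
      exists 1; rewrite add0r mulr1; congr ('X_ _ - _).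
      by apply/val_inj/eqP.
    rewrite (ltn_eqF ij); eexists; first exact: Bv ij.
    by exists 0; rewrite mulr0 addr0.
have [B [v [iB B1 DB Bv]]] := steps n.+1 (leqnn _).
have Bev := ideal_eval iB (fun i => Bv i (ltn_ord i)).
have [B0 BD BM] := iB.
pose x : 'rV[k]_n.+1 := \row_i v i.
have evx F : F.@[x 0] = F.@[v] by apply: meval_eq => i; rewrite mxE.
have Bx F : B F -> F.@[x 0] = 0.
  move=> BF; apply/eqP/negPn/negP => Fx; apply: B1.
  rewrite evx in Fx.
  have -> : 1 = ((F.@[v])^-1)%:MP * F +
    (- ((F.@[v])^-1)%:MP) * (F - (F.@[v])%:MP) :> S.
    transitivity (((F.@[v])^-1)%:MP * (F.@[v])%:MP : S); last by ring.
    by rewrite -mpolyCM mulVf // mpolyC1.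
  by apply: BD; apply: BM => //; exact: Bev.
have fx : f.@[x 0] = 1.
  have : B (f - 1).
    apply: DB; exists 0; first by move=> m; rewrite pihomog0; case: (Alin m).
    by exists 1; rewrite add0r mulr1.
  by move/Bx/eqP; rewrite mevalB meval1 subr_eq0 => /eqP.
have Ex : E x.
  case: irr => -[T Thom eE] _ _; rewrite eE; apply/zerosP; split.
    apply/negP => /eqP xz; have := meval_scale 0 x hf.
    by rewrite scale0r -xz fx expr0n /= mul0r => /eqP; rewrite oner_eq0.
  move=> F TF; have [q' hF] := Thom F TF.
  apply/Bx/DB/(@dehomog_ideal_homog q')/AI => // y.
  by rewrite eE => /zerosP [_]; apply.
have [q' [G' [AG' /negP]]] : exists q G, A q G /\ G.@[x 0] != 0.
  by apply: Af; rewrite ?fx ?oner_eq0.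
by apply; rewrite (Bx G') //; apply/DB/dehomog_ideal_homog/AG'.
Qed.

End Nullstellensatz.

(** The witness is a subspace of largest dimension inside [B]; a vector of [B] outside it would
    enlarge it. *)
Lemma lin_closed_vspace (K : fieldType) (vT : vectType K) (B : set vT) :
  lin_closed B -> exists U : {vspace vT}, forall v, (v \in U) <-> B v.
Proof.
move=> Bl; pose P d := `[< exists U : {vspace vT}, \dim U = d /\ forall v, v \in U -> B v >].
have exP : exists d, P d.
  exists 0%N; apply/asboolP; exists 0%VS; split; first exact: dimv0.
  by move=> v; rewrite memv0 => /eqP ->; case: Bl.
have ubP d : P d -> (d <= dim vT)%N.
  by move=> /asboolP [U [<- _]]; exact: rank_leq_col.
case: (ex_maxnP exP ubP) => d /asboolP [U [dU UB]] maxd; exists U => v; split; first exact: UB.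
move=> Bv; apply: contrapT => /negP vU.
suff : (\dim (U + <[v]>) <= d)%N.
  rewrite dimv_disjoint_sum; last first.
    apply/eqP; rewrite -subv0; apply/subvP => w /memv_capP [wU /vlineP [a wa]].
    have [a0|a0] := eqVneq a 0; first by rewrite wa a0 scale0r mem0v.
    have : a^-1 *: w \in U by apply: memvZ.
    by rewrite wa scalerA mulVf // scale1r (negPf vU).
  have v0 : v != 0 by apply: contraNneq vU => ->; exact: mem0v.
  by rewrite dim_vline v0 dU addn1 ltnn.
apply: maxd; apply/asboolP; exists (U + <[v]>)%VS; split=> // w.
by move=> /memv_addP [u uU [_ /vlineP [a ->] ->]]; apply: lin_closedD;
  [|exact: UB|apply: lin_closedZ].
Qed.

Section Quadrics.
Variables (k : closedFieldType) (E : set 'rV[k]_4).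
Local Notation S := {mpoly k[4]}.
Local Notation I := (vanishing E).

Lemma exists_quadric_space : exists K : {vspace dhomog 4 k 2},
  forall q : dhomog 4 k 2, (q \in K) <-> I (mpoly_of_dhomog q).
Proof.
apply: lin_closed_vspace; split=> [|a u v Iu Iv].
  by rewrite raddf0; case: (vanishing_closed E).
by rewrite linearP; apply: (proj2 (vanishing_closed E)).
Qed.

Hypotheses (irr : irreducible_variety E) (degE : curve_of_degree E 4)
  (lc : linearly_complete E).

Lemma nondegenerate s : s != 0 -> ~ I (lpoly s).
Proof.
move=> s0 Is; case/eqP: s0; apply: (proj1 lc) => x Ex.
by rewrite -meval_lpoly; exact: Is.
Qed.

(* If [t] has no zero on [E] where [s] vanishes and [t ^ N * F] is a multiple of
   [s] on [E], then [F / s] is a global section of O(1). *)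
Lemma divide_by_linform N (F G : S) s t :
  (forall x, E x -> linform s x = 0 -> linform t x != 0) ->
  F \is 2.-homog -> G \is N.+1.-homog ->
  I (lpoly t ^+ N * F - lpoly s * G) ->
  exists r, I (F - lpoly s * lpoly r).
Proof.
move=> st hF hG IFG.
have eFG x : E x -> linform t x ^+ N * F.@[x 0] = linform s x * G.@[x 0].
  move=> /IFG/eqP; rewrite mevalB !mevalM rmorphXn /= !meval_lpoly subr_eq0.
  by move=> /eqP.
pose u x : k := if linform s x != 0 then F.@[x 0] / linform s x
  else G.@[x 0] / linform t x ^+ N.
have [|r ur] := proj2 lc u; last first.
  exists r => x Ex; rewrite mevalB mevalM !meval_lpoly -ur // /u.
  case: ifPn => [sx|/negPn/eqP sx]; first by rewrite mulrCA divff ?mulr1 ?subrr.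
  have /eqP := eFG x Ex; rewrite sx !mul0r subr0 mulf_eq0 expf_eq0.
  by rewrite (negPf (st x Ex sx)) andbF => /eqP.
move=> x Ex _; have [sx|sx] := eqVneq (linform s x) 0; last first.
  exists 2%N, 1%N, F, (lpoly s); split.
    by split=> //; [exact: lpoly_homog|rewrite meval_lpoly].
  by move=> y Ey _; rewrite meval_lpoly /u => ->.
have tx := st x Ex sx.
exists N.+1, N, G, (lpoly t ^+ N); split.
  split=> //; [|lia|by rewrite rmorphXn /= meval_lpoly expf_neq0].
  by have := dhomogMn N (lpoly_homog t); rewrite mul1n.
move=> y Ey _; rewrite rmorphXn /= meval_lpoly /u => ty; case: ifP => // sy.
by apply/eqP; rewrite eqr_div // mulrC eFG // mulrC.
Qed.

(** A count that stands in for h^0(O_E(2)) = 8. The quadrics [U] that become multiples of [s] on [E]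
    after multiplication by a power of [t] have codimension at most 4 in the 10-dimensional space of
    quadrics. By [divide_by_linform] they lie in [K + L], where [L], the products of [s] with linear
    forms, has dimension at most 4. *)
Lemma dim_quadric_space (K : {vspace dhomog 4 k 2}) :
  (forall q : dhomog 4 k 2, (q \in K) <-> I (mpoly_of_dhomog q)) ->
  (2 <= \dim K)%N.
Proof.
move=> KI; pose s : 'cV[k]_4 := delta_mx 0 0.
have s0 : s != 0 by apply/eqP => /matrixP/(_ 0 0); rewrite !mxE => /eqP; rewrite oner_eq0.
have nIs := nondegenerate s0.
have [t st] := exists_disjoint_form irr degE nIs.
have [N hN] := hypersurface_codim irr degE (lpoly_homog s) nIs.
(* The factor [lpoly t ^+ N] lifts the degree to where the Hilbert polynomial is valid. Nothing is
   lost, as [t] has no zero on [E] where [s] vanishes. *)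
pose B (F : dhomog 4 k 2) := exists2 G : S, G \is N.+1.-homog &
  I (lpoly t ^+ N * (mpoly_of_dhomog F) - lpoly s * G).
have Il := vanishing_closed E.
have [|U UB] := @lin_closed_vspace _ _ (B : set _).
  split; first by exists 0; rewrite ?rpred0 // raddf0 !mulr0 subr0; case: Il.
  move=> a u v [G hG IG] [G' hG' IG']; exists (a *: G + G').
    by rewrite rpredD ?rpredZ.
  rewrite linearP /= !mulrDr -!scalerAr opprD addrACA -scalerBr.
  exact: (proj2 Il).
have codimU : (\dim U^C <= 4)%N.
  rewrite leqNgt; apply/negP => dU.
  have hT : lpoly t ^+ N \is N.-homog.
    by have := dhomogMn N (lpoly_homog t); rewrite mul1n.
  have hF (i : 'I_(\dim U^C)) :
      lpoly t ^+ N * (mpoly_of_dhomog (vbasis U^C)`_i) \is (N + 2).-homog.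
    by apply: dhomogM => //; exact: dhomog_is_dhomog.
  have [a [H [[i ai] hH IH]]] := hN _ _ _ (leq_addr _ _) dU hF.
  pose w := \sum_i a i *: (vbasis U^C)`_i.
  have wU : w \in U.
    apply/UB; exists H; first by rewrite addn2 subn1 in hH.
    rewrite raddf_sum /= mulr_sumr.
    by under eq_bigr do rewrite -scalerAr.
  have wUC : w \in U^C%VS.
    apply: memv_suml => j _; apply: memvZ; apply: vbasis_mem.
    by apply: mem_nth; rewrite size_tuple.
  have w0 : w = 0.
    by apply/eqP; rewrite -memv0 -(capv_compl U); apply/memv_capP.
  have /freeP fr := basis_free (vbasisP U^C%VS).
  by rewrite (fr a) ?eqxx in ai.
have dimT : dim (dhomog 4 k 2) = 10%N by [].
have dimU : (6 <= \dim U)%N.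
  by move: codimU; rewrite dimv_compl dimvf dimT; lia.
have hX (b : 'I_4) : lpoly s * 'X_b \is 2.-homog.
  apply: (@dhomogM _ _ _ 1); first exact: lpoly_homog.
  by rewrite -lpoly_delta; exact: lpoly_homog.
pose L := <<[tuple DHomog (hX b) | b < 4]>>%VS.
have dimL : (\dim L <= 4)%N.
  by apply: leq_trans (dim_span _) _; rewrite size_tuple.
suff /dimvS : (U <= K + L)%VS.
  move=> le; rewrite -(leq_add2r 4); apply: leq_trans (leq_trans dimU le) _.
  by apply: leq_trans (dimv_add_leqif K L) _; rewrite leq_add2l.
apply/subvP => F /UB [G hG IG].
have [r Ir] := divide_by_linform st (dhomog_is_dhomog F) hG IG.
pose R : dhomog 4 k 2 := \sum_b r b 0 *: DHomog (hX b).
have eR : mpoly_of_dhomog R = lpoly s * lpoly r.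
  rewrite raddf_sum /= /lpoly mulr_sumr; apply: eq_bigr => b _.
  by rewrite -scalerAr.
apply/memv_addP; exists (F - R); first by apply/KI; rewrite raddfB /= eR.
exists R; last by rewrite subrK.
apply: memv_suml => b _; apply: memvZ; apply: memv_span.
by apply/tnthP; exists b; rewrite tnth_mktuple.
Qed.

End Quadrics.

(** * Quadratic forms *)

Section QuadraticForms.
Variables (k : closedFieldType) (n : nat).
Local Notation S := {mpoly k[n.+1]}.
Implicit Types (F G Q : S) (x y z : 'rV[k]_n.+1) (s t : 'cV[k]_n.+1).

Lemma linformDr s x y : linform s (x + y) = linform s x + linform s y.
Proof. by rewrite /linform mulmxDl mxE. Qed.

Lemma linformZr s a x : linform s (a *: x) = a * linform s x.
Proof. by rewrite /linform -scalemxAl mxE. Qed.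

Lemma grad_lin x : linear (fun F => grad F x).
Proof.
by move=> a F G; apply/colP => b; rewrite !mxE linearP /= mevalD mevalZ.
Qed.

Lemma grad0 x : grad (0 : S) x = 0.
Proof. by apply/colP => b; rewrite !mxE mderiv0 meval0. Qed.

Lemma gradM F G x : grad (F * G) x = G.@[x 0] *: grad F x + F.@[x 0] *: grad G x.
Proof.
by apply/colP => b; rewrite !mxE mderivM mevalD !mevalM mulrC.
Qed.

Lemma mderiv_lpoly s b : (lpoly s)^`M(b) = (s b 0)%:MP.
Proof.
rewrite /lpoly raddf_sum /= (bigD1 b) //= big1 ?addr0 => [|j jb].
  rewrite mderivZ mderivX mnmE eqxx -{1}[U_(b)%MM]add0m addmK mpolyX0 scale1r.
  exact: alg_mpolyC.
by rewrite mderivZ mderivX mnmE (negPf jb) scale0r scaler0.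
Qed.

Lemma grad_lpoly s x : grad (lpoly s) x = s.
Proof. by apply/colP => b; rewrite mxE mderiv_lpoly mevalC. Qed.

Lemma quadratic_ind (P : S -> Prop) :
  P 0 -> (forall a F G, P F -> P G -> P (a *: F + G)) ->
  (forall s t, P (lpoly s * lpoly t)) -> forall F, F \is 2.-homog -> P F.
Proof.
move=> P0 Plin Pprod F /dhomogP hF; rewrite (mpolyE F) big_seq.
apply: big_rec => // m p mF Pp; apply: (Plin) => //.
have m2 : mdeg m = 2%N := hF m mF.
have [i mi] : exists i, m i != 0%N.
  apply: contrapT => h; move: m2; rewrite mdegE big1 // => i _.
  by apply/eqP; apply: contraT => mi; case: h; exists i.
have le_im : (U_(i) <= m)%MM by rewrite lep1mP.
have /eqP/mdeg1P [j /eqP ej] : mdeg (m - U_(i))%MM = 1%N.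
  by apply/eqP; rewrite -eqSS -m2 -{2}(submK le_im) mdegD mdeg1 addn1.
rewrite -(submK le_im) ej.
by rewrite mpolyXD -!lpoly_delta.
Qed.

Definition polar F x y : k := linform (grad F x) y.

Lemma polarP a F G x y : polar (a *: F + G) x y = a * polar F x y + polar G x y.
Proof. by rewrite /polar grad_lin linformD linformZ. Qed.

Lemma polar_prod s t x y : polar (lpoly s * lpoly t) x y =
  linform t x * linform s y + linform s x * linform t y.
Proof. by rewrite /polar gradM !grad_lpoly linformD !linformZ !meval_lpoly. Qed.

Lemma polar_sym F x y : F \is 2.-homog -> polar F x y = polar F y x.
Proof.
move: F; apply: quadratic_ind => [|a F G eF eG|s t].
- by rewrite /polar !grad0 !linform0.
- by rewrite !polarP eF eG.
- by rewrite !polar_prod; ring.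
Qed.

Lemma polar_linr F x a y z : polar F x (a *: y + z) = a * polar F x y + polar F x z.
Proof. exact: linform_is_linear_form. Qed.

Lemma meval_quadD F x y : F \is 2.-homog ->
  F.@[(x + y) 0] = F.@[x 0] + polar F x y + F.@[y 0].
Proof.
move: F; apply: quadratic_ind => [|a F G eF eG|s t].
- by rewrite !meval0 /polar grad0 linform0 !addr0.
- by rewrite !mevalD !mevalZ eF eG polarP; ring.
- rewrite !mevalM !meval_lpoly polar_prod !linformDr; ring.
Qed.

Lemma polar_diag F x : F \is 2.-homog -> polar F x x = F.@[x 0] *+ 2.
Proof.
move=> hF; have := meval_quadD x x hF.
rewrite -mulr2n -scaler_nat (meval_scale _ _ hF) => e.
have -> : polar F x x = 2%:R ^+ 2 * F.@[x 0] - F.@[x 0] *+ 2 by rewrite e; ring.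
by ring.
Qed.

Lemma meval_quad_comb F a x b y : F \is 2.-homog -> F.@[(a *: x + b *: y) 0] =
  a ^+ 2 * F.@[x 0] + a * b * polar F x y + b ^+ 2 * F.@[y 0].
Proof.
move=> hF; rewrite meval_quadD // !(meval_scale _ _ hF).
rewrite polar_sym // /polar linformZr -/(polar F _ _) polar_sym // /polar linformZr.
by rewrite -/(polar F _ _); ring.
Qed.

Definition irreducible_quadric Q : Prop :=
  Q \is 2.-homog /\ forall s t, Q <> lpoly s * lpoly t.

Lemma linform_normalize s : s != 0 -> exists w, linform s w = 1.
Proof.
move=> s0; have [b sb] : exists b, s b 0 != 0.
  apply: contrapT => h; case/eqP: s0; apply/colP => b; rewrite mxE; apply/eqP.
  by apply: contraT => sb; case: h; exists b.
by exists ((s b 0)^-1 *: delta_mx 0 b); rewrite linformZr /linform -rowE mxE mulVf.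
Qed.

Section Stereographic.
Variables (Q : S) (o : 'rV[k]_n.+1).
Hypotheses (irrQ : irreducible_quadric Q) (Qo : Q.@[o 0] = 0)
  (dQo : grad Q o != 0).

Let hQ : Q \is 2.-homog. Proof. by case: irrQ. Qed.

(** The second point where the line through [o] and [z] meets the quadric, with denominators
    cleared: the inverse of projection from [o]. *)
Definition stereo z := Q.@[z 0] *: o + (- polar Q o z) *: z.

Lemma meval_stereo z : Q.@[stereo z 0] = 0.
Proof. by rewrite meval_quad_comb // Qo; ring. Qed.

Lemma polar_stereo z : polar Q o (stereo z) = - polar Q o z ^+ 2.
Proof.
rewrite /stereo polar_linr polar_diag // Qo mul0rn mulr0 add0r /polar linformZr.
by rewrite expr2 mulNr.
Qed.

(** The pullback of [G] is [G(o) Q^2 - Q l lG + l^2 G]. On the hyperplane [l = 0] only [G(o) Q^2]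
    remains, and [Q] is nonzero there since it has no linear factor; hence [G(o) = 0]. Cancelling
    [l] leaves [l G = Q lG], so [lG] vanishes on [l = 0] and is a multiple of [l]. *)
Lemma quadric_of_stereo_eq0 G : G \is 2.-homog ->
  (forall z, G.@[stereo z 0] = 0) -> exists c, G = c *: Q.
Proof.
move=> hG Gst; pose l := lpoly (grad Q o); pose lG := lpoly (grad G o).
have [w lw] := linform_normalize dQo.
have le x : l.@[x 0] = polar Q o x by exact: meval_lpoly.
have lGe x : lG.@[x 0] = polar G o x by exact: meval_lpoly.
have id1 z : G.@[o 0] * Q.@[z 0] ^+ 2 - Q.@[z 0] * l.@[z 0] * lG.@[z 0] +
    l.@[z 0] ^+ 2 * G.@[z 0] = 0.
  by rewrite -(Gst z) meval_quad_comb // le lGe; ring.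
pose pr z := z - polar Q o z *: w.
have lpr z : polar Q o (pr z) = 0.
  by rewrite /pr addrC -scaleNr polar_linr /polar lw; ring.
(* [Qp] is the restriction of [Q] to [l = 0], pulled back along the projection [pr] with centre [w].
   If it were zero, [Q] would be [l] times a linear form. *)
pose Qp := Q - l * lpoly (grad Q w) + Q.@[w 0] *: (l * l).
have Qpe z : Qp.@[z 0] = Q.@[pr z 0].
  have -> : pr z = 1 *: z + (- polar Q o z) *: w by rewrite scale1r scaleNr.
  rewrite meval_quad_comb // (polar_sym z w) //.
  by rewrite !(mevalD, mevalN, mevalM, mevalZ) !meval_lpoly -/(polar Q o z)
    -/(polar Q w z); ring.
have Qp0 : Qp != 0.
  apply/eqP => Qp0; apply: (proj2 irrQ (grad Q o) (grad Q w - Q.@[w 0] *: grad Q o)).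
  apply/eqP; rewrite -subr_eq0 -[X in _ == X]Qp0; apply/eqP.
  rewrite -scaleNr lpolyD lpolyZ /Qp -/l; rewrite -!mul_mpolyC rmorphN; ring.
have Go : G.@[o 0] = 0.
  have /eqP : G.@[o 0] *: Qp ^+ 2 = 0.
    apply: mpoly_eq0P => z; rewrite mevalZ rmorphXn /= Qpe.
    by have := id1 (pr z); rewrite le lpr => <-; ring.
  by rewrite scaler_eq0 expf_eq0 (negPf Qp0) orbF => /eqP.
have l0 : l != 0.
  apply/eqP => e; have := le w; rewrite e meval0 /polar lw => /eqP.
  by rewrite eq_sym oner_eq0.
have lGQ : l * G = Q * lG.
  apply/eqP; rewrite -subr_eq0 -[_ == 0]orFb -(negPf l0) -mulf_eq0.
  apply/eqP/mpoly_eq0P => z; rewrite mevalM mevalB !mevalM.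
  by have := id1 z; rewrite Go => <-; ring.
pose c := polar G o w.
have lGp : lG - c *: l = 0.
  apply/eqP; rewrite -[_ == 0]orFb -(negPf Qp0) -mulf_eq0.
  apply/eqP/mpoly_eq0P => z; rewrite mevalM mevalB mevalZ le lGe Qpe.
  have := congr1 (fun F : S => F.@[pr z 0]) lGQ; rewrite /= !mevalM le lpr lGe mul0r.
  by move=> e; rewrite [RHS]e /pr addrC -scaleNr polar_linr -/c; ring.
exists c; apply/(mulfI l0); rewrite lGQ -scalerAr [RHS]scalerAl mulrC.
by congr (_ * _); apply/eqP; rewrite -subr_eq0; apply/eqP.
Qed.

(** The pullback along [stereo] as a polynomial of degree 4, so that cancellation in an integral
    domain applies. *)
Definition stereo_pull G : S :=
  G.@[o 0] *: Q ^+ 2 - Q * lpoly (grad Q o) * lpoly (grad G o) +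
  lpoly (grad Q o) ^+ 2 * G.

Lemma meval_stereo_pull G z : G \is 2.-homog ->
  (stereo_pull G).@[z 0] = G.@[stereo z 0].
Proof.
move=> hG; rewrite meval_quad_comb // /stereo_pull.
rewrite !(mevalD, mevalN, mevalM, mevalZ, rmorphXn) /= !meval_lpoly.
by rewrite -/(polar Q o z) -/(polar G o z); ring.
Qed.

Lemma stereo_pull_eq0 G : G \is 2.-homog -> stereo_pull G = 0 -> exists c, G = c *: Q.
Proof.
move=> hG G0; apply: quadric_of_stereo_eq0 => // z.
by rewrite -meval_stereo_pull // G0 meval0.
Qed.

(** Since [Q] pulls back to zero, the product of the pullbacks of [A] and [G] is zero while that of
    [G] is not. This is the primality of [Q], for quadrics only. *)
Lemma quadric_mul_stereo A B G : A \is 2.-homog -> B \is 2.-homog ->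
  G \is 2.-homog -> (forall c, G <> c *: Q) -> A * G = B * Q -> exists c, A = c *: Q.
Proof.
move=> hA hB hG nG e; apply: stereo_pull_eq0 => //.
apply/eqP; rewrite -[_ == 0]orbF.
have <- : (stereo_pull G == 0) = false.
  by apply/negP => /eqP /(stereo_pull_eq0 hG) [c]; exact: nG.
rewrite -mulf_eq0; apply/eqP/mpoly_eq0P => z.
have := congr1 (fun F : S => F.@[stereo z 0]) e.
by rewrite !mevalM !meval_stereo_pull // meval_stereo mulr0.
Qed.

(** Both inequalities are conditions on the parameter [z] of [stereo z], given by two nonzero
    polynomials, whose product has a nonzero value. *)
Lemma exists_quadric_point G : G \is 2.-homog -> (forall c, G <> c *: Q) ->
  exists p : 'rV[k]_n.+1, [/\ Q.@[p 0] = 0, G.@[p 0] != 0 & polar Q o p != 0].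
Proof.
move=> hG nG; pose l := lpoly (grad Q o).
have P0 : stereo_pull G != 0 by apply/eqP => /(stereo_pull_eq0 hG) [c]; exact: nG.
have l0 : l != 0.
  have [w lw] := linform_normalize dQo.
  apply/eqP => e; have := meval_lpoly (grad Q o) w; rewrite -/l e meval0 lw => /eqP.
  by rewrite eq_sym oner_eq0.
have : stereo_pull G * l != 0 by rewrite mulf_neq0.
move=> Pl; have [z Plz] : exists z : 'rV[k]_n.+1, (stereo_pull G * l).@[z 0] != 0.
  apply: contrapT => nz; case/eqP: Pl; apply: mpoly_eq0P => z.
  by apply/eqP; apply: contraT => h; case: nz; exists z.
move: Plz; rewrite mevalM mulf_eq0 negb_or meval_stereo_pull // meval_lpoly => /andP [Gz lz].
exists (stereo z); split=> //; first exact: meval_stereo.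
by rewrite polar_stereo oppr_eq0 expf_neq0.
Qed.

End Stereographic.
End QuadraticForms.

(** * The ideal of a quartic curve on a pencil of quadrics *)

Lemma lpolyM_homog (k : closedFieldType) n (s t : 'cV[k]_n.+1) :
  lpoly s * lpoly t \is 2.-homog.
Proof. exact: (dhomogM (lpoly_homog s) (lpoly_homog t)). Qed.

Section ShiftedForms.
Variables (k : closedFieldType) (n : nat).
Implicit Types P : {mpoly k[n]}.

(* Forms of degree [m - j], where only [0] has negative degree. *)
Definition homsh (j m : nat) P : Prop := P = 0 \/ ((j <= m)%N /\ P \is (m - j).-homog).

Lemma homsh_lin j m : lin_closed (homsh j m).
Proof.
split; first by left.
move=> a P P' [->|[jm hP]] [->|[jm' hP']].
- by left; rewrite scaler0 addr0.
- by right; rewrite scaler0 add0r.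
- by right; rewrite addr0; split=> //; apply: rpredZ.
- by right; split=> //; rewrite rpredD ?rpredZ.
Qed.

Lemma homshM j m j' m' P P' : homsh j m P -> homsh j' m' P' ->
  homsh (j + j') (m + m') (P * P').
Proof.
move=> [->|[jm hP]] [->|[jm' hP']]; rewrite ?mul0r ?mulr0; try by left.
right; split; first exact: leq_add.
by rewrite (_ : (_ - _)%N = (m - j) + (m' - j'))%N ?dhomogM //; lia.
Qed.

End ShiftedForms.

Section BinaryForms.
Variables (k : closedFieldType).
Implicit Types P : {mpoly k[2]}.

Definition bimonom (e i : nat) : 'X_{1..2} := [multinom [tuple i; (e - i)%N]].

Lemma bimonomP (m : 'X_{1..2}) : m = bimonom (mdeg m) (m ord0).
Proof.
have dm : mdeg m = (m ord0 + m (lift ord0 ord0))%N by rewrite mdegE big_ord_recl big_ord1.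
apply/mnmP => i; rewrite /bimonom multinomE.
case: (unliftP ord0 i) => [j|] -> //; rewrite [j]ord1 dm addKn.
by rewrite /tnth.
Qed.

Lemma binary_form_eq0 e P : P \is e.-homog ->
  (forall i : 'I_e.+1, P@_(bimonom e i) = 0) -> P = 0.
Proof.
move=> hP P0; apply/mpolyP => m; rewrite mcoeff0.
have [me|me] := eqVneq (mdeg m) e; last exact: dhomog_nemf_coeff hP me.
have le : (m ord0 < e.+1)%N by rewrite ltnS -me mdegE (bigD1 ord0) //= leq_addr.
by rewrite [m]bimonomP me; apply: (P0 (Ordinal le)).
Qed.

Lemma meval_binary_form e P (u v : k) : P \is e.-homog ->
  P.@[tnth [tuple u; v]] = \sum_(i < e.+1) P@_(bimonom e i) * (u ^+ i * v ^+ (e - i)).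
Proof.
move=> hP; have eP : P = \sum_(i < e.+1) P@_(bimonom e i) *: 'X_[bimonom e i].
  apply/mpolyP => m; rewrite raddf_sum /=.
  under eq_bigr do rewrite mcoeffZ mcoeffX.
  have [me|me] := eqVneq (mdeg m) e; last first.
    rewrite (dhomog_nemf_coeff hP me) big1 // => i _; case: eqP => [em|]; last by rewrite mulr0.
    case/eqP: me; rewrite -em mdegE big_ord_recl big_ord1 /bimonom !multinomE /=.
    by rewrite /tnth /= subnKC // -ltnS ltn_ord.
  have le : (m ord0 < e.+1)%N by rewrite ltnS -me mdegE (bigD1 ord0) //= leq_addr.
  have em : bimonom e (m ord0) = m by rewrite -me -bimonomP.
  rewrite (bigD1 (Ordinal le)) //= em eqxx mulr1 big1 ?addr0 // => i im.
  case: eqP => [ei|]; last by rewrite mulr0.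
  by case/eqP: im; apply: val_inj; rewrite /= -ei /bimonom multinomE.
rewrite [in LHS]eP raddf_sum /=; apply: eq_bigr => i _; rewrite mevalZ mevalX.
by rewrite big_ord_recl big_ord1 /bimonom !multinomE.
Qed.

Lemma homsh_coeff_eq0 j m P : homsh j m P ->
  (forall i : 'I_m.+1, P@_(bimonom (m - j) i) = 0) -> P = 0.
Proof.
move=> [->//|[jm hP]] P0; apply: (binary_form_eq0 hP) => i.
have im : (i < m.+1)%N by have := ltn_ord i; lia.
exact: (P0 (Ordinal im)).
Qed.

End BinaryForms.

(** * Two quadrics and finite generation over two variables *)

Section AdaptedCoordinates.
Variables (k : closedFieldType) (y0 y1 y2 y3 : 'cV[k]_4).
Local Notation S := {mpoly k[4]}.
Implicit Types (F G H : S) (P : {mpoly k[2]}).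

Local Notation Y0 := (lpoly y0).
Local Notation Y1 := (lpoly y1).
Local Notation Y2 := (lpoly y2).
Local Notation Y3 := (lpoly y3).

Hypothesis gen : forall s, exists c0 c1 c2 c3,
  s = c0 *: y0 + c1 *: y1 + c2 *: y2 + c3 *: y3.

Lemma quadric_decomposition F : F \is 2.-homog -> exists u v w l l',
  F = u *: (Y2 * Y2) + v *: (Y2 * Y3) + w *: (Y3 * Y3) + Y0 * lpoly l + Y1 * lpoly l'.
Proof.
move: F; apply: quadratic_ind.
- exists 0, 0, 0, 0, 0; rewrite !scale0r (_ : lpoly 0 = 0) ?mulr0 ?addr0 //.
  by rewrite -[0](scale0r 0) lpolyZ scale0r.
- move=> a F G [u [v [w [l [l' ->]]]]] [u' [v' [w' [m [m' ->]]]]].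
  exists (a * u + u'), (a * v + v'), (a * w + w'), (a *: l + m), (a *: l' + m').
  by rewrite !lpolyD !lpolyZ -!mul_mpolyC; ring.
- move=> s t; have [c0 [c1 [c2 [c3 ->]]]] := gen s.
  have [d0 [d1 [d2 [d3 ->]]]] := gen t.
  exists (c2 * d2), (c2 * d3 + c3 * d2), (c3 * d3).
  exists (c0 *: (d0 *: y0 + d1 *: y1 + d2 *: y2 + d3 *: y3) + (c2 * d0) *: y2 + (c3 * d0) *: y3).
  exists (c1 *: (d0 *: y0 + d1 *: y1 + d2 *: y2 + d3 *: y3) + (c2 * d1) *: y2 + (c3 * d1) *: y3).
  by rewrite !(lpolyD, lpolyZ) -!mul_mpolyC; ring.
Qed.

Variables (Q1 Q2 : S) (d al be ga : k) (l0 l1 m0 m1 : 'cV[k]_4).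
Hypotheses (d0 : d != 0) (al0 : al != 0) (be0 : be != 0)
  (Q1E : Q1 = d *: (Y2 * Y3) + Y0 * lpoly l0 + Y1 * lpoly l1)
  (Q2E : Q2 = al *: (Y2 * Y2) + ga *: (Y2 * Y3) + be *: (Y3 * Y3) +
     Y0 * lpoly m0 + Y1 * lpoly m1).

Definition coords P : S := P \mPo [tuple Y0; Y1].

(** Coefficients in [k[Y0, Y1]]: the index [j] is the degree of the generator that they multiply,
    and [m] is the total degree. *)
Definition Rsh j m F := exists2 P, homsh j m P & F = coords P.

Lemma Rsh_lin j m : lin_closed (Rsh j m).
Proof.
split; first by exists 0; [left|rewrite /coords raddf0].
move=> a F G [P hP ->] [P' hP' ->]; exists (a *: P + P').
  by apply: (proj2 (homsh_lin _ _ _ _)).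
by rewrite /coords linearP.
Qed.

Lemma RshM j m j' m' F G : Rsh j m F -> Rsh j' m' G -> Rsh (j + j') (m + m') (F * G).
Proof.
move=> [P hP ->] [P' hP' ->]; exists (P * P'); first exact: homshM.
by rewrite /coords rmorphM.
Qed.

Lemma RshS j m F : Rsh j.+1 m.+1 F <-> Rsh j m F.
Proof. by split. Qed.

Lemma Rsh_Y0 : Rsh 0 1 Y0.
Proof.
exists 'X_ord0; last by rewrite /coords comp_mpolyXU.
by right; split=> //; rewrite dhomogX; apply/eqP; exact: mdeg1.
Qed.

Lemma Rsh_Y1 : Rsh 0 1 Y1.
Proof.
exists 'X_(lift ord0 ord0); last by rewrite /coords comp_mpolyXU.
by right; split=> //; rewrite dhomogX; apply/eqP; exact: mdeg1.
Qed.

Lemma Rsh_mulY0 j m F : Rsh j.+1 m F -> Rsh j m (F * Y0).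
Proof. by move=> /RshM /(_ Rsh_Y0); rewrite addn0 addn1. Qed.

Lemma Rsh_mulY1 j m F : Rsh j.+1 m F -> Rsh j m (F * Y1).
Proof. by move=> /RshM /(_ Rsh_Y1); rewrite addn0 addn1. Qed.

(** Modulo [Y0] and [Y1] the two quadrics become [d Y2 Y3] and [al Y2^2 + ga Y2 Y3 + be Y3^2], and
    the quotient of [k[Y2, Y3]] by them has basis 1, [Y2], [Y3], [Y2^2]. Hence these four generate S
    / (Q1, Q2) over [k[Y0, Y1]]. *)
Definition module_span m F := exists f0 f1 f2 f3 H1 H2,
  [/\ Rsh 0 m f0, Rsh 1 m f1, Rsh 1 m f2, Rsh 2 m f3
    & F = f0 + f1 * Y2 + f2 * Y3 + f3 * (Y2 * Y2) + (H1 * Q1 + H2 * Q2)].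

Lemma module_span_lin m : lin_closed (module_span m).
Proof.
split.
  exists 0, 0, 0, 0, 0, 0; rewrite !mul0r !addr0.
  by split=> //; apply: (proj1 (Rsh_lin _ _)).
move=> a F G [f0 [f1 [f2 [f3 [H1 [H2 [r0 r1 r2 r3 ->]]]]]]]
  [g0 [g1 [g2 [g3 [K1 [K2 [s0 s1 s2 s3 ->]]]]]]].
exists (a *: f0 + g0), (a *: f1 + g1), (a *: f2 + g2), (a *: f3 + g3),
  (a *: H1 + K1), (a *: H2 + K2); split; try by apply: (proj2 (Rsh_lin _ _)).
by rewrite -!mul_mpolyC; ring.
Qed.

Lemma module_spanQ m H1 H2 : module_span m (H1 * Q1 + H2 * Q2).
Proof.
exists 0, 0, 0, 0, H1, H2; rewrite !mul0r !addr0 add0r.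
by split=> //; apply: (proj1 (Rsh_lin _ _)).
Qed.

Lemma module_span0 m f : Rsh 0 m f -> module_span m f.
Proof.
exists f, 0, 0, 0, 0, 0; rewrite !mul0r !addr0.
by split=> //; apply: (proj1 (Rsh_lin _ _)).
Qed.

Lemma module_span1 m f : Rsh 1 m f -> module_span m (f * Y2).
Proof.
exists 0, f, 0, 0, 0, 0; rewrite !mul0r !addr0 add0r.
by split=> //; apply: (proj1 (Rsh_lin _ _)).
Qed.

Lemma module_span2 m f : Rsh 1 m f -> module_span m (f * Y3).
Proof.
exists 0, 0, f, 0, 0, 0; rewrite !mul0r !addr0 !add0r.
by split=> //; apply: (proj1 (Rsh_lin _ _)).
Qed.

Lemma module_span3 m f : Rsh 2 m f -> module_span m (f * (Y2 * Y2)).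
Proof.
exists 0, 0, 0, f, 0, 0; rewrite !mul0r !addr0 !add0r.
by split=> //; apply: (proj1 (Rsh_lin _ _)).
Qed.

Local Notation TD := (lin_closedD (module_span_lin _)).
Local Notation TZ := (lin_closedZ (module_span_lin _)).

Lemma module_span_lpoly m f s : Rsh 1 m f -> module_span m (f * lpoly s).
Proof.
move=> Rf; have [c0 [c1 [c2 [c3 ->]]]] := gen s.
rewrite !(lpolyD, lpolyZ) !mulrDr -!scalerAr.
by do !apply: TD; apply: TZ; [apply/module_span0/Rsh_mulY0|apply/module_span0/Rsh_mulY1
  |apply: module_span1|apply: module_span2].
Qed.

(** [Y2 Y3] is eliminated with [Q1] and [Y3^2] with [Q2], at the cost of terms divisible by [Y0] or
    [Y1], which are covered by [module_span_lpoly]. *)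
Lemma module_span_quadric m f F : Rsh 2 m f -> F \is 2.-homog -> module_span m (f * F).
Proof.
move=> Rf /quadric_decomposition [u [v [w [l [l' ->]]]]].
have spY l2 l3 : module_span m (f * Y0 * lpoly l2 + f * Y1 * lpoly l3).
  by apply: TD; apply: module_span_lpoly; [apply: Rsh_mulY0|apply: Rsh_mulY1].
have sp23 : module_span m (f * (Y2 * Y3)).
  have -> : f * (Y2 * Y3) = ((d^-1 *: f) * Q1 + 0 * Q2) +
      (- d^-1) *: (f * Y0 * lpoly l0 + f * Y1 * lpoly l1).
    rewrite -[in LHS](scale1r f) -(mulVf d0) Q1E -!mul_mpolyC !rmorphM rmorphN /=; ring.
  by apply: TD; [exact: module_spanQ|apply: TZ].
have sp33 : module_span m (f * (Y3 * Y3)).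
  have -> : f * (Y3 * Y3) = (0 * Q1 + (be^-1 *: f) * Q2) +
      ((- be^-1 * al) *: (f * (Y2 * Y2)) + (- be^-1 * ga) *: (f * (Y2 * Y3)) +
       (- be^-1) *: (f * Y0 * lpoly m0 + f * Y1 * lpoly m1)).
    rewrite -[in LHS](scale1r f) -(mulVf be0) Q2E -!mul_mpolyC !rmorphM rmorphN /=; ring.
  apply: TD; first exact: module_spanQ.
  by do !apply: TD; apply: TZ => //; exact: module_span3.
have -> : f * (u *: (Y2 * Y2) + v *: (Y2 * Y3) + w *: (Y3 * Y3) + Y0 * lpoly l +
    Y1 * lpoly l') = u *: (f * (Y2 * Y2)) + v *: (f * (Y2 * Y3)) +
    w *: (f * (Y3 * Y3)) + (f * Y0 * lpoly l + f * Y1 * lpoly l').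
  by rewrite -!mul_mpolyC; ring.
by do !apply: TD => //; apply: TZ => //; exact: module_span3.
Qed.

(** [Y2^3] is eliminated with [Y2 Q2], as [al] is nonzero; [Y2^2 Y3] and [Y2 Y3^2] contain [Y2 Y3]
    and are eliminated with [Q1]. So products of degree 3 need no new generator. *)
Lemma module_span_Y2quadric m f F : Rsh 3 m f -> F \is 2.-homog ->
  module_span m (f * (Y2 * F)).
Proof.
move=> Rf /quadric_decomposition [u [v [w [l [l' ->]]]]].
have spY G G' : G \is 2.-homog -> G' \is 2.-homog ->
    module_span m (f * Y0 * G + f * Y1 * G').
  move=> hG hG'.
  by apply: TD; apply: module_span_quadric; rewrite //; [apply: Rsh_mulY0|apply: Rsh_mulY1].
have sp23 s : module_span m (f * (lpoly s * (Y2 * Y3))).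
  have -> : f * (lpoly s * (Y2 * Y3)) = ((d^-1 *: (f * lpoly s)) * Q1 + 0 * Q2) +
      (- d^-1) *: (f * Y0 * (lpoly s * lpoly l0) + f * Y1 * (lpoly s * lpoly l1)).
    rewrite -[in LHS](scale1r f) -(mulVf d0) Q1E -!mul_mpolyC !rmorphM rmorphN /=; ring.
  apply: TD; [exact: module_spanQ|apply: TZ; apply: spY; exact: lpolyM_homog].
have sp33 : module_span m (f * (Y2 * (Y3 * Y3))).
  by rewrite [Y2 * (Y3 * _)]mulrCA; exact: sp23.
have sp22 : module_span m (f * (Y2 * (Y2 * Y2))).
  have -> : f * (Y2 * (Y2 * Y2)) = (0 * Q1 + (al^-1 *: (f * Y2)) * Q2) +
      ((- al^-1 * be) *: (f * (Y2 * (Y3 * Y3))) + (- al^-1 * ga) *: (f * (Y2 * (Y2 * Y3))) +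
       (- al^-1) *: (f * Y0 * (Y2 * lpoly m0) + f * Y1 * (Y2 * lpoly m1))).
    rewrite -[in LHS](scale1r f) -(mulVf al0) Q2E -!mul_mpolyC !rmorphM rmorphN /=; ring.
  apply: TD; first exact: module_spanQ.
  by do !apply: TD; apply: TZ => //; apply: spY; exact: lpolyM_homog.
have -> : f * (Y2 * (u *: (Y2 * Y2) + v *: (Y2 * Y3) + w *: (Y3 * Y3) + Y0 * lpoly l +
    Y1 * lpoly l')) = u *: (f * (Y2 * (Y2 * Y2))) + v *: (f * (Y2 * (Y2 * Y3))) +
    w *: (f * (Y2 * (Y3 * Y3))) + (f * Y0 * (Y2 * lpoly l) + f * Y1 * (Y2 * lpoly l')).
  by rewrite -!mul_mpolyC; ring.
apply: TD; last by apply: spY; exact: lpolyM_homog.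
by do !apply: TD; apply: TZ.
Qed.

Lemma module_spanS m s F : module_span m F -> module_span m.+1 (lpoly s * F).
Proof.
move=> [f0 [f1 [f2 [f3 [H1 [H2 [r0 r1 r2 r3 ->]]]]]]].
have [c0 [c1 [c2 [c3 es]]]] := gen s.
have sY2 : module_span m.+1 (Y2 * (f3 * (Y2 * Y2))).
  by rewrite mulrCA; apply: module_span_Y2quadric; [apply/RshS|exact: lpolyM_homog].
have sY3 : module_span m.+1 (Y3 * (f3 * (Y2 * Y2))).
  rewrite mulrCA [Y3 * _]mulrCA; apply: module_span_Y2quadric; first exact/RshS.
  exact: lpolyM_homog.
have sYY j m' (f g : S) : Rsh j m' f -> Rsh 0 1 g -> Rsh j m'.+1 (f * g).
  by move=> Rf Rg; have := RshM Rf Rg; rewrite addn0 addn1.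
have sY g : Rsh 0 1 g -> module_span m.+1 (g * (f0 + f1 * Y2 + f2 * Y3 + f3 * (Y2 * Y2))).
  move=> Rg.
  have -> : g * (f0 + f1 * Y2 + f2 * Y3 + f3 * (Y2 * Y2)) =
    f0 * g + f1 * g * Y2 + f2 * g * Y3 + f3 * g * (Y2 * Y2) by ring.
  by do !apply: TD; [apply: module_span0|apply: module_span1|apply: module_span2
    |apply: module_span3]; apply: sYY.
have -> : lpoly s * (f0 + f1 * Y2 + f2 * Y3 + f3 * (Y2 * Y2) + (H1 * Q1 + H2 * Q2)) =
  c0 *: (Y0 * (f0 + f1 * Y2 + f2 * Y3 + f3 * (Y2 * Y2))) +
  c1 *: (Y1 * (f0 + f1 * Y2 + f2 * Y3 + f3 * (Y2 * Y2))) +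
  (f0 * lpoly (c2 *: y2 + c3 *: y3) + f1 * (lpoly (c2 *: y2 + c3 *: y3) * Y2) +
   f2 * (lpoly (c2 *: y2 + c3 *: y3) * Y3) +
   (c2 *: (Y2 * (f3 * (Y2 * Y2))) + c3 *: (Y3 * (f3 * (Y2 * Y2))))) +
  ((lpoly s * H1) * Q1 + (lpoly s * H2) * Q2).
  by rewrite es !(lpolyD, lpolyZ) -!mul_mpolyC; ring.
apply: TD; last exact: module_spanQ.
apply: TD.
  by apply: TD; apply: TZ; apply: sY; [exact: Rsh_Y0|exact: Rsh_Y1].
do ![apply: TD]; do ?[by apply: TZ].
- by apply: module_span_lpoly; apply/RshS.
- by apply: module_span_quadric; [apply/RshS|exact: lpolyM_homog].
- by apply: module_span_quadric; [apply/RshS|exact: lpolyM_homog].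
Qed.

Lemma module_span_all m F : F \is m.-homog -> module_span m F.
Proof.
move=> /dhomogP hF; rewrite (mpolyE F) big_seq; apply: lin_closed_sum => [|mm mF].
  exact: module_span_lin.
apply: lin_closedZ; first exact: module_span_lin.
have {mF hF F} : mdeg mm = m := hF mm mF.
elim: m mm => [|m IH] mm dm.
  have /eqP := dm; rewrite mdeg_eq0 => /eqP ->; rewrite mpolyX0.
  apply: module_span0; exists 1; last by rewrite /coords rmorph1.
  by right; split=> //; exact: dhomog1.
have [i mi] : exists i, mm i != 0%N.
  apply: contrapT => h; move: dm; rewrite mdegE big1 // => i _.
  by apply/eqP; apply: contraT => mi; case: h; exists i.
have le_im : (U_(i) <= mm)%MM by rewrite lep1mP.
rewrite -(submK le_im) mpolyXD mulrC -lpoly_delta; apply/module_spanS/IH.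
by apply/eqP; rewrite -eqSS -dm -{2}(submK le_im) mdegD mdeg1 addn1.
Qed.

End AdaptedCoordinates.

Lemma exists_dependence (K : fieldType) (T : finType) (h : nat) (psi : 'I_h -> T -> K) :
  (#|T| < h)%N -> exists2 u : 'I_h -> K, (exists l, u l != 0) &
    forall t, \sum_l u l * psi l t = 0.
Proof.
move=> Th.
have [u u0 uA] := exists_left_kernel (\matrix_(l < h, t < #|T|) psi l (enum_val t)) Th.
exists (fun l => u 0 l); first by move/rV0Pn: u0.
move=> t; move/rowP/(_ (enum_rank t)): uA; rewrite !mxE => e; rewrite -[RHS]e.
by apply: eq_bigr => l _; rewrite mxE enum_rankK.
Qed.

Section PencilIdeal.
Variables (k : closedFieldType) (E : set 'rV[k]_4).
Local Notation S := {mpoly k[4]}.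
Local Notation I := (vanishing E).
Implicit Types (F G H : S) (P : {mpoly k[2]}).
Hypotheses (irr : irreducible_variety E) (degE : curve_of_degree E 4)
  (nondeg : forall s, s != 0 -> ~ I (lpoly s)).

Variables (y0 y1 y2 y3 : 'cV[k]_4).
Local Notation Y0 := (lpoly y0).
Local Notation Y1 := (lpoly y1).
Local Notation Y2 := (lpoly y2).
Local Notation Y3 := (lpoly y3).
Local Notation coordsY := (coords y0 y1).

Hypotheses (gen : forall s, exists c0 c1 c2 c3,
    s = c0 *: y0 + c1 *: y1 + c2 *: y2 + c3 *: y3)
  (free01 : forall c, y0 - c *: y1 != 0) (y1_neq0 : y1 != 0).

Lemma vanishing_prod_lpoly (r : seq 'cV[k]_4) :
  I (\prod_(s <- r) lpoly s) -> exists2 s, s \in r & I (lpoly s).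
Proof.
have hr (r' : seq 'cV[k]_4) : \prod_(s <- r') lpoly s \is (size r').-homog.
  elim: r' => [|s r' IH]; first by rewrite big_nil dhomog1.
  by rewrite big_cons; apply: (@dhomogM _ _ _ 1) => //; exact: lpoly_homog.
elim: r => [|s r IH].
  rewrite big_nil => I1; case: irr => _ [x Ex] _.
  by have /eqP := I1 x Ex; rewrite meval1 oner_eq0.
rewrite big_cons => /(vanishing_prime irr (lpoly_homog s) (hr r)) [Is|/IH [t tr It]].
  by exists s; rewrite ?mem_head.
by exists t; rewrite ?in_cons ?tr ?orbT.
Qed.

(** A nonzero binary form splits into linear factors. By primality one of the forms [y0 - z y1] or
    [y1] would vanish on [E], which lies in no hyperplane. *)
Lemma coords_vanishing P e : P \is e.-homog -> I (coordsY P) -> P = 0.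
Proof.
move=> hP IP; apply/eqP; apply: contraT => P0.
pose p := \poly_(i < e.+1) P@_(bimonom e i).
have p0 : p != 0.
  apply/eqP => p0; case/eqP: P0; apply: (binary_form_eq0 hP) => i.
  by have := congr1 (fun q : {poly k} => q`_i) p0; rewrite coef_poly ltn_ord coef0.
have [r pr] := closed_field_poly_normal p.
(* The univariate [p] arises on dividing by [y1]; the additional factor [y1] covers the points where
   this is impossible. *)
have : I (\prod_(s <- y1 :: [seq y0 - z *: y1 | z <- r]) lpoly s).
  move=> x Ex; rewrite big_cons big_map mevalM meval_lpoly.
  have [->|v0] := eqVneq (linform y1 x) 0; first by rewrite mul0r.
  have := IP x Ex; rewrite /coords comp_mpoly_meval.
  rewrite (_ : P.@[_] = P.@[tnth [tuple linform y0 x; linform y1 x]]); last first.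
    apply: meval_eq => i; case: (unliftP ord0 i) => [j|] ->; rewrite ?[j]ord1;
      exact: meval_lpoly.
  rewrite (meval_binary_form _ _ hP) => e0.
  have : root p (linform y0 x / linform y1 x).
    apply/eqP; rewrite horner_poly; apply: (mulfI (expf_neq0 e v0)).
    rewrite mulr0 -[RHS]e0 mulr_sumr; apply: eq_bigr => i _.
    have ie : (i <= e)%N by rewrite -ltnS ltn_ord.
    rewrite exprMn exprVn -{1}(subnKC ie) exprD.
    by field; rewrite expf_neq0.
  rewrite pr rootZ ?lead_coef_eq0 // root_prod_XsubC => zr.
  rewrite (big_rem _ zr) /= mevalM meval_lpoly linformD -scaleNr linformZ.
  by rewrite mulNr divfK // subrr mul0r mulr0.
move=> /vanishing_prod_lpoly [s]; rewrite in_cons => /orP [/eqP -> /nondeg []//|].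
by move=> /mapP [z _ ->] /nondeg [].
Qed.

Lemma coords_homog P e : P \is e.-homog -> coordsY P \is e.-homog.
Proof.
move=> /dhomogP hP; rewrite /coords comp_mpolyEX big_seq; apply: rpred_sum => m mP.
apply: rpredZ; have <- : mdeg m = e := hP m mP.
rewrite comp_mpolyX mdegE !big_ord_recl !big_ord0 mulr1 addn0 /=.
apply: dhomogM.
  by have := dhomogMn (m ord0) (lpoly_homog y0); rewrite mul1n.
by have := dhomogMn (m (lift ord0 ord0)) (lpoly_homog y1); rewrite mul1n.
Qed.

Definition shift (j : 'I_4) : nat := nth 0%N [:: 0; 1; 1; 2]%N j.
Definition generator (j : 'I_4) : S := nth 0 [:: 1; Y2; Y3; Y2 * Y2] j.

Variables (Q1 Q2 : S) (d al be ga : k) (l0 l1 m0 m1 : 'cV[k]_4).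
Hypotheses (d0 : d != 0) (al0 : al != 0) (be0 : be != 0)
  (Q1E : Q1 = d *: (Y2 * Y3) + Y0 * lpoly l0 + Y1 * lpoly l1)
  (Q2E : Q2 = al *: (Y2 * Y2) + ga *: (Y2 * Y3) + be *: (Y3 * Y3) +
     Y0 * lpoly m0 + Y1 * lpoly m1)
  (IQ1 : I Q1) (IQ2 : I Q2).

Lemma generators_span m F : F \is m.-homog -> exists g : 'I_4 -> {mpoly k[2]},
  (forall j, homsh (shift j) m (g j)) /\
  exists H1 H2, F = \sum_j coordsY (g j) * generator j + (H1 * Q1 + H2 * Q2).
Proof.
move=> /(module_span_all gen d0 al0 be0 Q1E Q2E).
move=> [_ [_ [_ [_ [H1 [H2 [[g0 h0 ->] [g1 h1 ->] [g2 h2 ->] [g3 h3 ->] ->]]]]]]].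
exists (fun j => nth 0 [:: g0; g1; g2; g3] j); split.
  by case=> [[|[|[|[|]]]]].
by exists H1, H2; rewrite !big_ord_recr big_ord0 /= add0r mulr1.
Qed.

Lemma coordsM P P' : coordsY (P * P') = coordsY P * coordsY P'.
Proof. exact: rmorphM. Qed.

Lemma vanishing_Q H1 H2 : I (H1 * Q1 + H2 * Q2).
Proof.
by apply: (lin_closedD (vanishing_closed E)); apply: vanishingM.
Qed.

(** A relation with [p i] nonzero would lower the rank from 4 to 3. Multiplied by [p i], an element
    with coefficients [g j] has on [E] the coefficients [p i g j - g i p j], which vanish for
    [j = i]. Three binary forms have about [3 M] coefficients, too few for the [4 M + c] independent
    elements of degree [M]. *)
Lemma generators_free m (p : 'I_4 -> {mpoly k[2]}) :
  (forall j, homsh (shift j) m (p j)) -> I (\sum_j coordsY (p j) * generator j) ->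
  forall j, p j = 0.
Proof.
move=> hp Ip i; apply/eqP; apply: contraT => pi0.
have Icl := vanishing_closed E.
have [e hpi] : exists e, p i \is e.-homog.
  by case: (hp i) => [->|[_ h]]; [exists 0%N; exact: dhomog0|exists (m - shift i)%N].
have nI : ~ I (coordsY (p i)) by move=> /(coords_vanishing hpi) pi; rewrite pi eqxx in pi0.
have [c [M0 hdeg]] := degE.
(* Large enough for [3 (m + M + 1) < 4 M + c]. *)
pose M := (M0 + 3 * m + 4 + `|c|)%N.
have [h eh [cc [cchom ccfree _]]] := hdeg M ltac:(rewrite /M; lia).
have /choice [g hg] : forall l, exists g : 'I_4 -> {mpoly k[2]},
    (forall j, homsh (shift j) M (g j)) /\
    exists H1 H2, cc l = \sum_j coordsY (g j) * generator j + (H1 * Q1 + H2 * Q2).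
  by move=> l; apply: generators_span; exact: cchom.
have ghom l j : homsh (shift j) M (g l j) by have [] := hg l.
pose D l j := p i * g l j - g l i * p j.
(* The coefficients of [D l j] for the three indices [j] other than [i]; a dependence among them
   makes [p i] times a combination of the [cc l] vanish on [E]. *)
pose psi l (t : 'I_3 * 'I_(m + M).+1) :=
  (D l (lift i t.1))@_(bimonom (m + M - (shift i + shift (lift i t.1))) t.2).
have card : (#|{: 'I_3 * 'I_(m + M).+1}| < h)%N.
  by rewrite card_prod !card_ord /M; move: eh; rewrite /M; lia.
have [u [l1' ul] u0] := exists_dependence psi card.
pose G j := \sum_l u l *: g l j.
have Dhom l j : homsh (shift i + shift j) (m + M) (D l j).
  apply: (lin_closedB (homsh_lin _ _ _ _)); first exact: homshM.
  by rewrite (addnC m M); apply: homshM.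
have pG j : p i * G j = G i * p j.
  apply/eqP; rewrite -subr_eq0 mulr_sumr mulr_suml -sumrB.
  under eq_bigr do rewrite -scalerAr -scalerAl -scalerBr -/(D _ _).
  apply/eqP; case: (unliftP i j) => [t|] ->; last first.
    by rewrite big1 // => l _; rewrite /D mulrC subrr scaler0.
  apply: (@homsh_coeff_eq0 _ (shift i + shift (lift i t)) (m + M)).
    by apply: (lin_closed_sum (homsh_lin _ _ _ _)) => l _; apply: (lin_closedZ (homsh_lin _ _ _ _)).
  move=> a; rewrite raddf_sum /= -[RHS](u0 (t, a)).
  by apply: eq_bigr => l _; rewrite mcoeffZ.
have : I (coordsY (p i) * \sum_l u l *: cc l).
  have [K1 [K2 ->]] : exists K1 K2, \sum_l u l *: cc l =
      \sum_j coordsY (G j) * generator j + (K1 * Q1 + K2 * Q2).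
    have /choice [H1 /choice [H2 eH]] : forall l, exists H1, exists H2, cc l =
        \sum_j coordsY (g l j) * generator j + (H1 * Q1 + H2 * Q2).
      by move=> l; have [_] := hg l.
    exists (\sum_l u l *: H1 l), (\sum_l u l *: H2 l).
    under eq_bigr do rewrite eH scalerDr scalerDr !scalerAl.
    rewrite !big_split /= !mulr_suml; congr (_ + _).
    under eq_bigr do rewrite scaler_sumr.
    rewrite exchange_big; apply: eq_bigr => j _ /=.
    rewrite /G /coords raddf_sum mulr_suml; apply: eq_bigr => l _.
    by rewrite /= comp_mpolyZ scalerAl.
  rewrite mulrDr; apply: (lin_closedD Icl); last by apply: vanishingM; exact: vanishing_Q.
  have -> : coordsY (p i) * (\sum_j coordsY (G j) * generator j) =
      coordsY (G i) * (\sum_j coordsY (p j) * generator j).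
    rewrite !mulr_sumr; apply: eq_bigr => j _.
    by rewrite !mulrA -!coordsM pG.
  exact: vanishingM.
move/(vanishing_prime irr (coords_homog hpi) (q := M)) => -[||/ccfree ua].
- by apply: rpred_sum => l _; apply: rpredZ; exact: cchom.
- by move/nI.
- by rewrite ua eqxx in ul.
Qed.

Lemma vanishing_pencil m F : F \is m.-homog -> I F ->
  exists H1 H2, F = H1 * Q1 + H2 * Q2.
Proof.
move=> hF IF; have [g [hg [H1 [H2 eF]]]] := generators_span hF.
exists H1, H2; rewrite eF (_ : \sum_j _ = 0) ?add0r //; apply: big1 => j _.
rewrite (generators_free hg) /coords ?raddf0 ?mul0r // => x Ex.
have := IF x Ex; rewrite eF mevalD (vanishing_Q H1 H2 Ex) addr0; exact.
Qed.

End PencilIdeal.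

(** [y0] and [y1] are a basis of the linear forms that vanish on the line through [a] and [b], on
    which [y2] and [y3] are coordinates. *)
Lemma complete_dual_basis (K : closedFieldType) (a b : 'rV[K]_4) (y2 y3 : 'cV[K]_4) :
  linform y2 a = 1 -> linform y2 b = 0 -> linform y3 a = 0 -> linform y3 b = 1 ->
  exists y0 y1, [/\ linform y0 a = 0 /\ linform y0 b = 0,
    linform y1 a = 0 /\ linform y1 b = 0,
    forall s, exists c0 c1 c2 c3, s = c0 *: y0 + c1 *: y1 + c2 *: y2 + c3 *: y3,
    forall c, y0 - c *: y1 != 0 & y1 != 0].
Proof.
move=> y2a y2b y3a y3b; pose A : 'M_(4, 1 + 1) := row_mx a^T b^T.
have lfT (s : 'cV[K]_4) (x : 'rV[K]_4) : s^T *m x^T = (linform s x)%:M.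
  by rewrite -trmx_mul [_ *m _]mx11_scalar tr_scalar_mx.
have uA (u : 'rV_4) : (u *m A == 0) = (linform u^T a == 0) && (linform u^T b == 0).
  rewrite mul_mx_row -{1 2}[u]trmxK !lfT -row_mx0.
  apply/eqP/andP => [/eq_row_mx [ea eb]|[/eqP -> /eqP ->]]; last by rewrite !raddf0.
  by split; apply/eqP; [move/(congr1 (fun M : 'M_1 => M 0 0)): ea
    |move/(congr1 (fun M : 'M_1 => M 0 0)): eb]; rewrite !mxE eqxx mulr1n.
have rkA : \rank A = 2%N.
  apply/eqP; rewrite eqn_leq rank_leq_col /=.
  have e : col_mx y2^T y3^T *m A = 1%:M.
    by rewrite mul_col_row !lfT y2a y2b y3a y3b !raddf0 -scalar_mx_block.
  by have := mxrankM_maxr (col_mx y2^T y3^T) A; rewrite e mxrank1.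
have rkK : \rank (kermx A) = 2%N by rewrite mxrank_ker rkA.
move: (row_base (kermx A)) (eq_row_base (kermx A)) (row_base_free (kermx A)).
rewrite rkK => B eqB freeB.
have Brow i : row i B *m A = 0.
  by apply/sub_kermxP; rewrite -eqB row_sub.
have Bsum (D : 'rV[K]_2) : D *m B = D 0 0 *: row 0 B + D 0 1 *: row 1 B.
  by rewrite mulmx_sum_row !big_ord_recl big_ord0 addr0; congr (_ + _ *: row _ B);
    do ?congr (D _ _); apply/val_inj.
have Bfree (D : 'rV[K]_2) : D 0 0 *: row 0 B + D 0 1 *: row 1 B = 0 -> D = 0.
  by rewrite -Bsum => DB; apply: (row_free_inj freeB); rewrite DB mul0mx.
have zB i : linform (row i B)^T a = 0 /\ linform (row i B)^T b = 0.
  by have /eqP := Brow i; rewrite uA => /andP [/eqP -> /eqP ->].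
exists (row 0 B)^T, (row 1 B)^T; split=> //.
- move=> s; pose r := s - linform s a *: y2 - linform s b *: y3.
  have : (r^T <= B)%MS.
    rewrite eqB; apply/sub_kermxP/eqP; rewrite uA trmxK.
    rewrite /r -!scaleNr !linformD !linformZ y2a y2b y3a y3b.
    by apply/andP; split; apply/eqP; ring.
  move=> /submxP [D]; rewrite Bsum => /(congr1 trmx); rewrite trmxK linearD !linearZ /=.
  move=> er; exists (D 0 0), (D 0 1), (linform s a), (linform s b).
  by rewrite -er /r addrAC !subrK.
- move=> c; apply/eqP => e.
  have /rowP/(_ 0)/eqP : (\row_j (if j == 0 then 1 else - c) : 'rV[K]_2) = 0.
    apply: Bfree; rewrite !mxE /= scale1r scaleNr.
    by apply: trmx_inj; rewrite linearB linearZ trmx0.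
  by rewrite !mxE eqxx oner_eq0.
- apply/eqP => e.
  have /rowP/(_ 1)/eqP : (\row_j (if j == 0 then 0 else 1) : 'rV[K]_2) = 0.
    apply: Bfree; rewrite !mxE /= scale0r scale1r add0r.
    by apply: trmx_inj; rewrite trmx0.
  by rewrite !mxE /= oner_eq0.
Qed.

Definition is_pencil (k : closedFieldType) (E : set 'rV[k]_4) (Q1 Q2 : {mpoly k[4]}) :=
  [/\ Q1 \is 2.-homog /\ Q2 \is 2.-homog,
      forall a b, a *: Q1 + b *: Q2 = 0 -> a = 0 /\ b = 0,
      vanishing E Q1 /\ vanishing E Q2
    & forall m F, F \is m.-homog -> vanishing E F ->
        exists H1 H2, F = H1 * Q1 + H2 * Q2].

Section EllipticPencil.
Variables (k : closedFieldType) (E : set 'rV[k]_4).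
Hypothesis char0 : [pchar k] =i pred0.
Local Notation S := {mpoly k[4]}.
Local Notation I := (vanishing E).
Hypotheses (irr : irreducible_variety E) (degE : curve_of_degree E 4)
  (lc : linearly_complete E).

Lemma two_neq0 : (2%:R : k) != 0.
Proof. by move/pcharf0P: char0 => ->. Qed.

Lemma vanishing_irreducible_quadric Q : Q \is 2.-homog -> Q != 0 -> I Q ->
  irreducible_quadric Q.
Proof.
move=> hQ Q0 IQ; split=> // s t eQ.
have lp0 : lpoly (0 : 'cV[k]_4) = 0 by rewrite -[0](scale0r 0) lpolyZ scale0r.
have [s0|s0] := eqVneq s 0; first by rewrite eQ s0 lp0 mul0r eqxx in Q0.
have [t0|t0] := eqVneq t 0; first by rewrite eQ t0 lp0 mulr0 eqxx in Q0.
rewrite eQ in IQ.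
by have [/(nondegenerate lc s0)|/(nondegenerate lc t0)] :=
  vanishing_prime irr (lpoly_homog s) (lpoly_homog t) IQ.
Qed.

(** If the gradient were zero on all of [E], each linear form [polar Q y] would vanish on [E] by
    symmetry, hence identically; in characteristic 0 this gives [Q = 0]. *)
Lemma exists_grad_neq0 Q : Q \is 2.-homog -> Q != 0 ->
  exists2 o, E o & grad Q o != 0.
Proof.
move=> hQ Q0; apply: contrapT => no; case/eqP: Q0; apply: mpoly_eq0P => y.
have dQ o : E o -> grad Q o = 0.
  by move=> Eo; apply/eqP; apply: contraT => do0; case: no; exists o.
have dy0 : grad Q y = 0.
  apply: (proj1 lc) => x Ex; rewrite -/(polar Q y x) polar_sym // /polar dQ //.
  exact: linform0.
have /eqP := polar_diag y hQ; rewrite /polar dy0 linform0 eq_sym -mulr_natr mulf_eq0.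
by rewrite (negPf two_neq0) orbF => /eqP.
Qed.

(** The points [a] and [b] are chosen on [Q1], off [Q2], and with the line through them not
    contained in [Q1]. This line meets [Q1] only at [a] and [b], hence misses [Q1 = Q2 = 0]. In the
    coordinates dual to [a] and [b], [Q1] restricts to [D Y2 Y3] and [Q2] has nonzero coefficients
    at both squares, as [vanishing_pencil] requires. *)
Lemma pencil_of_quadrics Q1 Q2 : Q1 \is 2.-homog -> Q2 \is 2.-homog ->
  (forall a b, a *: Q1 + b *: Q2 = 0 -> a = 0 /\ b = 0) -> I Q1 -> I Q2 ->
  is_pencil E Q1 Q2.
Proof.
move=> hQ1 hQ2 Qfree IQ1 IQ2.
have Q10 : Q1 != 0.
  apply/eqP => Q10; have /Qfree [/eqP] : 1 *: Q1 + 0 *: Q2 = 0.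
    by rewrite Q10 scaler0 scale0r addr0.
  by rewrite oner_eq0.
have nQ c : Q2 <> c *: Q1.
  move=> eQ; have /Qfree [_ /eqP] : - c *: Q1 + 1 *: Q2 = 0.
    by rewrite eQ scale1r -scalerDl addNr scale0r.
  by rewrite oner_eq0.
have irrQ := vanishing_irreducible_quadric hQ1 Q10 IQ1.
have [o Eo do0] := exists_grad_neq0 hQ1 Q10.
have [a [Q1a Q2a oa]] := exists_quadric_point irrQ (IQ1 o Eo) do0 hQ2 nQ.
have da0 : grad Q1 a != 0.
  by apply: contraNneq oa => da; rewrite polar_sym // /polar da linform0.
have [b [Q1b Q2b ab]] := exists_quadric_point irrQ Q1a da0 hQ2 nQ.
pose D := polar Q1 a b.
pose y2 := D^-1 *: grad Q1 b; pose y3 := D^-1 *: grad Q1 a.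
have y2a : linform y2 a = 1 by rewrite linformZ -/(polar _ _ _) polar_sym // mulVf.
have y2b : linform y2 b = 0.
  by rewrite linformZ -/(polar _ _ _) polar_diag // Q1b mul0rn mulr0.
have y3a : linform y3 a = 0.
  by rewrite linformZ -/(polar _ _ _) polar_diag // Q1a mul0rn mulr0.
have y3b : linform y3 b = 1 by rewrite linformZ -/(polar _ _ _) mulVf.
have [y0 [y1 [[y0a y0b] [y1a y1b] gen free01 y10]]] := complete_dual_basis y2a y2b y3a y3b.
have coef F u v w l l' : F \is 2.-homog ->
    F = u *: (lpoly y2 * lpoly y2) + v *: (lpoly y2 * lpoly y3) +
      w *: (lpoly y3 * lpoly y3) + lpoly y0 * lpoly l + lpoly y1 * lpoly l' ->
    [/\ F.@[a 0] = u, F.@[b 0] = w & polar F a b = v].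
  move=> hF eF.
  have evF (x : 'rV[k]_4) : F.@[x 0] = u * (linform y2 x) ^+ 2 + v * (linform y2 x * linform y3 x) +
      w * (linform y3 x) ^+ 2 + linform y0 x * linform l x + linform y1 x * linform l' x.
    by rewrite eF !(mevalD, mevalM, mevalZ) !meval_lpoly; ring.
  have Fa : F.@[a 0] = u by rewrite evF y0a y1a y2a y3a; ring.
  have Fb : F.@[b 0] = w by rewrite evF y0b y1b y2b y3b; ring.
  split=> //; have -> : polar F a b = F.@[(a + b) 0] - F.@[a 0] - F.@[b 0].
    by rewrite meval_quadD //; ring.
  by rewrite Fa Fb evF !linformDr y0a y0b y1a y1b y2a y2b y3a y3b; ring.
have [u [v [w [l [l' eQ1]]]]] := quadric_decomposition gen hQ1.
have [u' [v' [w' [m [m' eQ2]]]]] := quadric_decomposition gen hQ2.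
have [eu ew ev] := coef _ _ _ _ _ _ hQ1 eQ1.
have [eu' ew' ev'] := coef _ _ _ _ _ _ hQ2 eQ2.
split=> // d F hF IF.
apply: (vanishing_pencil irr degE (nondegenerate lc) gen free01 y10
  (d := v) (al := u') (be := w') (ga := v') (l0 := l) (l1 := l') (m0 := m) (m1 := m')
  _ _ _ _ _ IQ1 IQ2 hF IF).
- by rewrite -ev.
- by rewrite -eu'.
- by rewrite -ew'.
- by rewrite [LHS]eQ1 -eu -ew Q1a Q1b !scale0r addr0 add0r.
- by rewrite [LHS]eQ2 -!addrA.
Qed.

Theorem exists_pencil : exists Q1 Q2, is_pencil E Q1 Q2.
Proof.
have [K KI] := exists_quadric_space E.
have dK := dim_quadric_space irr degE lc KI.
have /freeP fr := basis_free (vbasisP K).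
have [i [j ij]] : exists i j : 'I_(\dim K), i != j.
  by exists (Ordinal (leq_trans (ltnW (ltnSn 1)) dK)), (Ordinal dK).
pose q (l : 'I_(\dim K)) := (vbasis K)`_l.
have qK l : I (mpoly_of_dhomog (q l)).
  by apply/KI/vbasis_mem/mem_nth; rewrite size_tuple.
exists (mpoly_of_dhomog (q i)), (mpoly_of_dhomog (q j)).
apply: pencil_of_quadrics; rewrite ?dhomog_is_dhomog // => a b e.
have e' : a *: q i + b *: q j = 0 by apply: val_inj.
have := fr (fun l => if l == i then a else if l == j then b else 0).
rewrite (bigD1 i) // (bigD1 j) /=; last by rewrite eq_sym.
rewrite !eqxx eq_sym (negPf ij) big1 ?addr0 => [/(_ e') h|l /andP [/negPf -> /negPf ->]].
  by have := h i; have := h j; rewrite !eqxx eq_sym (negPf ij).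
by rewrite scale0r.
Qed.

End EllipticPencil.

Lemma homog0_const (k : fieldType) n (P : {mpoly k[n]}) :
  P \is 0.-homog -> exists c, P = c%:MP.
Proof.
move=> hP; exists P@_0%MM; apply/mpolyP => m; rewrite mcoeffC.
have [->|m0] := eqVneq m 0%MM; first by rewrite mulr1.
by rewrite mulr0 (dhomog_nemf_coeff hP) // mdeg_eq0.
Qed.

Section PencilConsequences.
Variables (k : closedFieldType) (E : set 'rV[k]_4) (Q1 Q2 : {mpoly k[4]}).
Hypothesis char0 : [pchar k] =i pred0.
Local Notation S := {mpoly k[4]}.
Local Notation I := (vanishing E).
Implicit Types x y v o : 'rV[k]_4.
Hypotheses (irr : irreducible_variety E) (smE : smooth_curve E)
  (lc : linearly_complete E) (penc : is_pencil E Q1 Q2).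

Lemma pencil_neq c : Q1 <> c *: Q2.
Proof.
have [_ Qfree _ _] := penc; move=> e; have /Qfree [/eqP] : 1 *: Q1 + (- c) *: Q2 = 0.
  by rewrite e scale1r -scalerDl subrr scale0r.
by rewrite oner_eq0.
Qed.

Lemma pencil_span F : F \is 2.-homog -> I F -> exists a b, F = a *: Q1 + b *: Q2.
Proof.
have [[hQ1 hQ2] _ _ Igen] := penc; move=> hF IF; have [H1 [H2 eF]] := Igen _ _ hF IF.
have [a ea] := homog0_const (pihomogP mdeg 0%N H1).
have [b eb] := homog0_const (pihomogP mdeg 0%N H2).
exists a, b; rewrite -(pihomog_dE hF) eF raddfD /= ![_ * Q1]mulrC ![_ * Q2]mulrC.
have p1 : pihomog mdeg 2 (Q1 * H1) = Q1 * pihomog mdeg 0 H1 := pihomogM_homog 0 H1 hQ1.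
have p2 : pihomog mdeg 2 (Q2 * H2) = Q2 * pihomog mdeg 0 H2 := pihomogM_homog 0 H2 hQ2.
rewrite p1 p2 ea eb.
by rewrite ![_ * _%:MP]mulrC !mul_mpolyC.
Qed.

Lemma pencil_zeros x : x != 0 -> Q1.@[x 0] = 0 -> Q2.@[x 0] = 0 -> E x.
Proof.
have [_ _ _ Igen] := penc; move=> x0 Q1x Q2x.
case: irr => -[T Thom eE] _ _; rewrite eE; apply/zerosP; split=> // F TF.
have [q hF] := Thom F TF.
have [|H1 [H2 ->]] := Igen q F hF; last by rewrite mevalD !mevalM Q1x Q2x !mulr0 addr0.
by move=> y; rewrite eE => /zerosP [_]; apply.
Qed.

(** If the two gradients were dependent, a single linear condition would cut out vectors tangent to
    the cone. They would form a space of dimension at least 3, while smoothness allows 2. *)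
Lemma pencil_grad_free x c1 c2 : E x -> c1 *: grad Q1 x + c2 *: grad Q2 x = 0 ->
  c1 = 0 /\ c2 = 0.
Proof.
have [_ _ [IQ1 IQ2] Igen] := penc; move=> Ex e.
have tangent v : v *m grad Q1 x = 0 -> v *m grad Q2 x = 0 -> cone_tangent E x v.
  move=> v1 v2 F d hF /(Igen d F hF) [H1 [H2 ->]].
  rewrite -[H1 * Q1]scale1r grad_lin scale1r !gradM IQ1 // IQ2 // !scale0r !add0r.
  by rewrite mulmxDr -!scalemxAr v1 v2 !scaler0 addr0.
have single (g : 'cV[k]_4) : (forall v, v *m g = 0 -> cone_tangent E x v) -> False.
  move=> gt; pose K := row_base (kermx g).
  have rk : (2 < \rank (kermx g))%N by rewrite mxrank_ker; have := rank_leq_col g; lia.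
  have Kt i : cone_tangent E x (row i K).
    by apply: gt; apply/sub_kermxP; rewrite (submx_trans (row_sub _ _)) ?eq_row_base.
  have [|a [i ai] Ka] := quotient_dependence _ (smE Ex) rk Kt.
    by split=> // a u v -> ->; rewrite scaler0 addr0.
  move: Ka; rewrite /= => Ka.
  have : (\row_i a i) *m K = 0.
    by rewrite mulmx_sum_row -[RHS]Ka; apply: eq_bigr => l _; rewrite mxE.
  rewrite -(mul0mx _ K) => /(row_free_inj (row_base_free _)) /rowP /(_ i).
  by rewrite !mxE => /eqP; rewrite (negPf ai).
have [c10|c10] := eqVneq c1 0.
  split=> //; apply/eqP; apply: contraT => c20; exfalso; apply: (single (grad Q1 x)) => v v1.
  apply: tangent => //; move: e; rewrite c10 scale0r add0r => /eqP.
  by rewrite scaler_eq0 (negPf c20) => /eqP ->; rewrite mulmx0.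
exfalso; apply: (single (grad Q2 x)) => v v2; apply: tangent => //.
have := congr1 (fun g => c1^-1 *: (v *m g)) e.
rewrite /= mulmxDr -!scalemxAr v2 scaler0 addr0 scalerA mulVf // scale1r => ->.
by rewrite mulmx0 scaler0.
Qed.

Lemma pencil_syzygy A B : A \is 2.-homog -> B \is 2.-homog -> A * Q1 + B * Q2 = 0 ->
  exists c, A = - c *: Q2 /\ B = c *: Q1.
Proof.
have [[hQ1 hQ2] _ [IQ1 IQ2] _] := penc; move=> hA hB e.
have Q20 : Q2 != 0.
  apply/eqP => Q20; have [_ Qfree _ _] := penc.
  have /Qfree [_ /eqP] : 0 *: Q1 + 1 *: Q2 = 0 by rewrite Q20 scaler0 scale0r addr0.
  by rewrite oner_eq0.
have irrQ := vanishing_irreducible_quadric irr lc hQ2 Q20 IQ2.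
have [o Eo do0] := exists_grad_neq0 char0 lc hQ2 Q20.
have e' : A * Q1 = (- B) * Q2 by apply/eqP; rewrite -subr_eq0 mulNr opprK e.
have hB' : - B \is 2.-homog by rewrite rpredN.
have [c eA] := quadric_mul_stereo irrQ (IQ2 o Eo) do0 hA hB' hQ1 pencil_neq e'.
exists (- c); rewrite opprK; split=> //; apply/eqP; rewrite -subr_eq0 scaleNr opprK.
rewrite -[_ == 0]orbF -(negPf Q20) -mulf_eq0 mulrDl addrC -scalerAl [Q1 * Q2]mulrC.
by rewrite scalerAl -eA e.
Qed.

(** A second quadric of the pencil is not a multiple of [q], so it is nonzero at some point of
    [q = 0]. This rules out proportional equations in [intersection_spans]. *)
Lemma curve_neq_quadric q : q \is 2.-homog -> q != 0 -> I q ->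
  exists p : 'rV[k]_4, [/\ p != 0, q.@[p 0] = 0 & ~ E p].
Proof.
have [[hQ1 hQ2] _ [IQ1 IQ2] _] := penc; move=> hq q0 Iq.
have irrq := vanishing_irreducible_quadric irr lc hq q0 Iq.
have [o Eo do0] := exists_grad_neq0 char0 lc hq q0.
have [G [hG IG nG]] : exists G, [/\ G \is 2.-homog, I G & forall c, G <> c *: q].
  apply: contrapT => nG.
  have [c1 e1] : exists c, Q1 = c *: q.
    by apply: contrapT => h; apply: nG; exists Q1; split=> // c e; apply: h; exists c.
  have [c2 e2] : exists c, Q2 = c *: q.
    by apply: contrapT => h; apply: nG; exists Q2; split=> // c e; apply: h; exists c.
  have [c20|c20] := eqVneq c2 0; last first.
    by apply: (@pencil_neq (c1 / c2)); rewrite e1 e2 scalerA divfK.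
  have [_ Qfree _ _] := penc.
  have /Qfree [_ /eqP] : 0 *: Q1 + 1 *: Q2 = 0 by rewrite e2 c20 !scale0r scaler0 addr0.
  by rewrite oner_eq0.
have [p [qp Gp _]] := exists_quadric_point irrq (Iq o Eo) do0 hG nG.
exists p; split=> //; last by move=> Ep; rewrite IG ?eqxx in Gp.
by apply: contraNneq Gp => ->; rewrite -[0](scale0r 0) (meval_scale _ _ hG) expr0n mul0r.
Qed.

End PencilConsequences.

(** * Sections, cocycles and the Feigin-Odesskii tensor *)

Section Sections.
Variables (k : closedFieldType) (n : nat) (E : set 'rV[k]_n.+1).
Local Notation S := {mpoly k[n.+1]}.
Implicit Types (U : set 'rV[k]_n.+1) (s t : 'rV[k]_n.+1 -> k) (F G : S) (x y : 'rV[k]_n.+1).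

Definition nonzero_locus G : set 'rV[k]_n.+1 := fun x => G.@[x 0] != 0.

Lemma section_quot U d p q F G : F \is p.-homog -> G \is q.-homog -> p%:Z = q%:Z + d ->
  (forall x, E x -> U x -> G.@[x 0] != 0) ->
  section E d U (fun x => F.@[x 0] / G.@[x 0]).
Proof. by move=> hF hG e G0 x Ex Ux; exists p, q, F, G; split=> //; split=> //; exact: G0. Qed.

Lemma section_form U p F : F \is p.-homog -> section E p U (fun x => F.@[x 0]).
Proof.
move=> hF x Ex Ux; exists p, 0%N, F, 1; rewrite meval1; split.
  by split; rewrite ?oner_eq0 ?dhomog1 ?add0r.
by move=> y Ey Uy _; rewrite meval1 divr1.
Qed.

Lemma section_linform U (s : 'cV[k]_n.+1) : section E 1 U (linform s).
Proof.
have := section_form (U := U) (lpoly_homog s).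
by rewrite (_ : (fun x => _) = linform s) //; apply/funext => x; exact: meval_lpoly.
Qed.

Lemma section_ext U d s t : (forall x, E x -> U x -> s x = t x) ->
  section E d U s -> section E d U t.
Proof.
move=> st hs x Ex Ux; have [p [q [F [G [h e]]]]] := hs x Ex Ux.
by exists p, q, F, G; split=> // y Ey Uy Gy; rewrite -st //; exact: e.
Qed.

Lemma section_sub U U' d s : U' `<=` U -> section E d U s -> section E d U' s.
Proof.
move=> sub hs x Ex /[dup] Ux' /sub Ux; have [p [q [F [G [h e]]]]] := hs x Ex Ux.
by exists p, q, F, G; split=> // y Ey /sub Uy; exact: e.
Qed.

Lemma sectionM U d d' s t : section E d U s -> section E d' U t ->
  section E (d + d') U (fun x => s x * t x).
Proof.
move=> hs ht x Ex Ux.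
have [p [q [F [G [[hF hG epq Gx] e]]]]] := hs x Ex Ux.
have [p' [q' [F' [G' [[hF' hG' epq' Gx'] e']]]]] := ht x Ex Ux.
exists (p + p')%N, (q + q')%N, (F * F'), (G * G'); split.
  by split; rewrite ?mevalM ?mulf_neq0 ?dhomogM //; lia.
move=> y Ey Uy; rewrite !mevalM mulf_eq0 negb_or => /andP [Gy Gy'].
by rewrite (e y) // (e' y) // mulf_div.
Qed.

Lemma sectionD U d s t : section E d U s -> section E d U t ->
  section E d U (fun x => s x + t x).
Proof.
move=> hs ht x Ex Ux.
have [p [q [F [G [[hF hG epq Gx] e]]]]] := hs x Ex Ux.
have [p' [q' [F' [G' [[hF' hG' epq' Gx'] e']]]]] := ht x Ex Ux.
exists (p + q')%N, (q + q')%N, (F * G' + F' * G), (G * G'); split.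
  split; rewrite ?mevalM ?mulf_neq0 ?dhomogM //; last by lia.
  apply: rpredD; first exact: dhomogM.
  have -> : (p + q' = p' + q)%N by lia.
  exact: dhomogM.
move=> y Ey Uy; rewrite mevalD !mevalM mulf_eq0 negb_or => /andP [Gy Gy'].
by rewrite (e y) // (e' y) // addf_div.
Qed.

Lemma sectionZ U d a s : section E d U s -> section E d U (fun x => a * s x).
Proof.
move=> hs x Ex Ux; have [p [q [F [G [[hF hG epq Gx] e]]]]] := hs x Ex Ux.
exists p, q, (a *: F), G; split; first by split=> //; exact: rpredZ.
by move=> y Ey Uy Gy; rewrite (e y) // mevalZ mulrA.
Qed.

Lemma sectionB U d s t : section E d U s -> section E d U t ->
  section E d U (fun x => s x - t x).
Proof.
move=> hs ht; apply: section_ext (sectionD hs (sectionZ (-1) ht)) => x _ _.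
by rewrite mulN1r.
Qed.

Lemma section_sum U d (N : nat) (s : 'I_N.+1 -> 'rV[k]_n.+1 -> k) :
  (forall i, section E d U (s i)) -> section E d U (fun x => \sum_i s i x).
Proof.
elim: N s => [|N IH] s hs.
  by apply: section_ext (hs ord0) => x _ _; rewrite big_ord1.
apply: section_ext (sectionD (hs ord0) (IH (fun i => s (lift ord0 i)) _)) => [x _ _|i //].
by rewrite [RHS]big_ord_recl.
Qed.

Lemma section_div U d r s G : G \is r.-homog -> (forall x, E x -> U x -> G.@[x 0] != 0) ->
  section E d U s -> section E (d - r%:Z) U (fun x => s x / G.@[x 0]).
Proof.
move=> hG G0 hs x Ex Ux; have [p [q [F [H [[hF hH epq Hx] e]]]]] := hs x Ex Ux.
exists p, (q + r)%N, F, (H * G); split.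
  by split; rewrite ?mevalM ?mulf_neq0 ?G0 ?dhomogM //; lia.
move=> y Ey Uy; rewrite mevalM mulf_eq0 negb_or => /andP [Hy Gy].
by rewrite (e y) // invfM mulrA.
Qed.

(** A fraction has to represent the section wherever its denominator is nonzero on [U]; multiplying
    numerator and denominator by [G] confines this to the smaller set. *)
Lemma section_local U d s : (forall x, E x -> U x -> exists r G,
    [/\ G \is r.-homog, G.@[x 0] != 0 & section E d (U `&` nonzero_locus G) s]) ->
  section E d U s.
Proof.
move=> loc x Ex Ux; have [r [G [hG Gx hs]]] := loc x Ex Ux.
have [p [q [F [H [[hF hH epq Hx] e]]]]] := hs x Ex (conj Ux Gx).
exists (p + r)%N, (q + r)%N, (F * G), (H * G); split.
  by split; rewrite ?mevalM ?mulf_neq0 ?dhomogM //; lia.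
move=> y Ey Uy; rewrite !mevalM mulf_eq0 negb_or => /andP [Hy Gy].
by rewrite (e y) // -mulf_div divff // mulr1.
Qed.

End Sections.

Section GlobalForms.
Variables (k : closedFieldType) (n d : nat) (E : set 'rV[k]_n.+1).
Hypotheses (irr : irreducible_variety E) (degE : curve_of_degree E d).
Local Notation S := {mpoly k[n.+1]}.
Local Notation I := (vanishing E).
Implicit Types (F G : S) (x y : 'rV[k]_n.+1).

(** The forms [G] for which [s G] is a form where [f] is nonzero make up a graded ideal. Locally it
    contains a form that does not vanish, so the graded Nullstellensatz puts a power of [f] into
    it. *)
Lemma section_denominator e (f : S) s : f \is e.+1.-homog ->
  section E 0 (nonzero_locus f) s ->
  exists N F, F \is (e.+1 * N).-homog /\
    forall y, E y -> f.@[y 0] != 0 -> s y * f.@[y 0] ^+ N = F.@[y 0].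
Proof.
move=> hf hs.
pose A q (G : S) := G \is q.-homog /\ exists F, F \is q.-homog /\
  forall y, E y -> f.@[y 0] != 0 -> s y * G.@[y 0] = F.@[y 0].
have gA : graded_ideal E A.
  split.
  - by move=> q F [].
  - move=> q; split.
      by split; rewrite ?dhomog0 //; exists 0; rewrite ?dhomog0 //; split=> // y _ _;
        rewrite !meval0 mulr0.
    move=> a u v [hu [F [hF eF]]] [hv [F' [hF' eF']]]; split.
      by rewrite rpredD ?rpredZ.
    exists (a *: F + F'); rewrite rpredD ?rpredZ //; split=> // y Ey fy.
    by rewrite !mevalD !mevalZ mulrDr mulrCA eF // eF'.
  - move=> p q F G hF [hG [F' [hF' eF']]]; split; first exact: dhomogM.
    exists (F * F'); rewrite dhomogM //; split=> // y Ey fy.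
    by rewrite !mevalM mulrCA eF'.
  - move=> q F hF IF; split=> //; exists 0; rewrite dhomog0; split=> // y Ey _.
    by rewrite IF // meval0 mulr0.
have [N [_ [F [hF eF]]]] : exists N, A (e.+1 * N)%N (f ^+ N).
  apply: (graded_nullstellensatz irr degE gA hf) => x Ex fx.
  have [p [q [F [G [[hF hG epq Gx] eG]]]]] := hs x Ex fx.
  have epq' : p = q by lia.
  rewrite epq' in hF.
  exists (q + q)%N, (G * G); rewrite mevalM mulf_neq0 //; split=> //; split.
    exact: dhomogM.
  (* Multiplying by [G] twice makes the equation hold also where [G] vanishes. *)
  exists (F * G); rewrite dhomogM //; split=> // y Ey fy; rewrite !mevalM.
  have [->|Gy] := eqVneq G.@[y 0] 0; first by rewrite !mulr0.
  by rewrite (eG y) // mulrA divfK.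
by exists N, F; split=> // y Ey fy; rewrite -eF // rmorphXn.
Qed.

(** The graded Nullstellensatz for the ideal of the [G l] and [E]. Divided by [f ^ M], the
    conclusion is a partition of unity where [f] is nonzero. *)
Lemma power_in_ideal N (r : 'I_N -> nat) (G : 'I_N -> S) e (f : S) :
  f \is e.+1.-homog -> (forall l, G l \is (r l).-homog) ->
  (forall x, E x -> f.@[x 0] != 0 -> exists l, (G l).@[x 0] != 0) ->
  exists M (h : 'I_N -> S), (forall l, homsh (r l) (e.+1 * M) (h l)) /\
    forall x, E x -> f.@[x 0] ^+ M = \sum_l (h l).@[x 0] * (G l).@[x 0].
Proof.
move=> hf hG cov.
pose A q (F : S) := F \is q.-homog /\ exists h : 'I_N -> S,
  (forall l, homsh (r l) q (h l)) /\ I (F - \sum_l h l * G l).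
have Icl := vanishing_closed E.
have gA : graded_ideal E A.
  split.
  - by move=> q F [].
  - move=> q; split.
      split; first exact: dhomog0.
      exists (fun _ => 0); split; first by move=> l; left.
      by rewrite big1 ?subr0 => [|l _]; [case: Icl|rewrite mul0r].
    move=> a u v [hu [h [hh Ih]]] [hv [h' [hh' Ih']]]; split.
      by rewrite rpredD ?rpredZ.
    exists (fun l => a *: h l + h' l); split.
      by move=> l; apply: (proj2 (homsh_lin _ _ _ _)).
    under eq_bigr do rewrite mulrDl -scalerAl.
    rewrite big_split /= -scaler_sumr opprD addrACA -scalerBr.
    exact: (proj2 Icl).
  - move=> p q F F' hF [hF' [h [hh Ih]]]; split; first exact: dhomogM.
    exists (fun l => F * h l); split.
      move=> l; case: (hh l) => [->|[rq hhl]]; first by left; rewrite mulr0.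
      by right; split; [lia|rewrite -addnBA //; exact: dhomogM].
    under eq_bigr do rewrite -mulrA.
    by rewrite -mulr_sumr -mulrBr; exact: vanishingM.
  - move=> q F hF IF; split=> //; exists (fun _ => 0); split; first by move=> l; left.
    by rewrite big1 ?subr0 // => l _; rewrite mul0r.
have [M [_ [h [hh Ih]]]] : exists M, A (e.+1 * M)%N (f ^+ M).
  apply: (graded_nullstellensatz irr degE gA hf) => x Ex fx.
  have [l Gx] := cov x Ex fx; exists (r l), (G l); split=> //; split=> //.
  exists (fun j => (j == l)%:R); split.
    move=> j; have [->|_] := eqVneq j l; last by left.
    by right; rewrite subnn; split=> //; exact: dhomog1.
  rewrite (bigD1 l) //= eqxx mul1r big1 ?addr0 ?subrr => [|j /negPf ->].
    by case: Icl.
  by rewrite mul0r.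
exists M, h; split=> // x Ex; apply/eqP; rewrite -subr_eq0; apply/eqP.
rewrite -[RHS](Ih x Ex) mevalB rmorphXn /=; congr (_ - _).
by rewrite raddf_sum; apply: eq_bigr => l _; rewrite /= mevalM.
Qed.

Lemma homogX (i : 'I_n.+1) : ('X_i : S) \is 1.-homog.
Proof. by rewrite -lpoly_delta; exact: lpoly_homog. Qed.

Lemma homogXn (F : S) N : F \is 1.-homog -> F ^+ N \is N.-homog.
Proof. by move=> hF; have := dhomogMn N hF; rewrite mul1n. Qed.

(* If [t] does not vanish on the zeros of [s], the cocycle splits on [t != 0] as
   [b' j - b' i]; [b i] extends [b' i] modulo [s] over the whole chart. *)
Lemma cocycle_divisible (s : 'cV[k]_n.+1) T : ~ I (lpoly s) -> cocycle E 0 T ->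
  exists e b, [/\ cocycle E (-1) e, forall i, section E 0 (chart i) (b i)
    & forall i j x, E x -> chart i x -> chart j x ->
        T i j x - (b j x - b i x) = linform s x * e i j x].
Proof.
move=> nIs [Tsec Tco].
have [t st] := exists_disjoint_form irr degE nIs.
have locus i j : nonzero_locus ('X_i * 'X_j : S) `<=` chart i `&` chart j.
  by move=> x; rewrite /nonzero_locus mevalM !mevalXU mulf_eq0 negb_or => /andP [].
have /choice [N0 /choice [H0 hH0]] : forall ij : 'I_n.+1 * 'I_n.+1,
    exists N F, F \is (2 * N).-homog /\ forall y, E y -> y 0 ij.1 != 0 ->
      y 0 ij.2 != 0 -> T ij.1 ij.2 y * (y 0 ij.1 * y 0 ij.2) ^+ N = F.@[y 0].
  move=> [i j] /=.
  have hXX : ('X_i * 'X_j : S) \is 2.-homog by exact: (dhomogM (homogX i) (homogX j)).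
  have [N [F [hF eF]]] :=
    section_denominator hXX (section_sub (@locus i j) (Tsec i j)).
  exists N, F; split=> // y Ey yi yj; rewrite -eF ?mevalM ?mevalXU //.
  by rewrite mulf_neq0.
have [N N_gt0 leN] : exists2 N, (0 < N)%N & forall ij, (N0 ij <= N)%N.
  by exists (\sum_ij N0 ij).+1 => // ij; rewrite leqW // (bigD1 ij) //= leq_addr.
have [H [hH HE]] : exists H : 'I_n.+1 -> 'I_n.+1 -> S,
    (forall i j, H i j \is (N + N).-homog) /\
    forall i j y, E y -> y 0 i != 0 -> y 0 j != 0 ->
      T i j y * (y 0 i * y 0 j) ^+ N = (H i j).@[y 0].
  exists (fun i j => H0 (i, j) * ('X_i * 'X_j) ^+ (N - N0 (i, j))); split=> i j.
    have [h _] := hH0 (i, j).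
    have -> : (N + N = 2 * N0 (i, j) + 2 * (N - N0 (i, j)))%N.
      by rewrite -mulnDr subnKC // mul2n addnn.
    by apply: dhomogM => //; apply: dhomogMn; exact: (dhomogM (homogX i) (homogX j)).
  move=> y Ey yi yj; have [_ /= eF] := hH0 (i, j).
  by rewrite mevalM -eF // rmorphXn /= mevalM !mevalXU -mulrA -exprD subnKC // leN.
have [|M [g [hg gE]]] := power_in_ideal (r := fun _ : 'I_n.+1 => N.+1)
    (G := fun l => 'X_l ^+ N.+1) (lpoly_homog t) (fun l => homogXn _ (homogX l)).
  move=> x Ex _; have /rV0Pn [l xl] := variety_neq0 irr Ex.
  by exists l; rewrite rmorphXn /= mevalXU expf_neq0.
(* With [t ^ M] written as the sum of [g l X_l^(N+1)], the usual splitting of a cocycle is the sum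
   of the [g l X_l^(N+1) T_li], divided by [t ^ M]. The exponent [N.+1] rather than [N] leaves a
   factor ['X_l], which kills the term where [x_l = 0] and [H l i] is not tied to [T l i]. *)
pose G i : S := \sum_l g l * 'X_l * H l i.
have hG i : G i \is (M + N).-homog.
  apply: rpred_sum => l _; have := hg l; rewrite mul1n => -[->|[le hgl]].
    by rewrite !mul0r dhomog0.
  have -> : (M + N = M - N.+1 + 1 + (N + N))%N by lia.
  by apply: dhomogM => //; apply: dhomogM => //; exact: homogX.
pose b' i (x : 'rV[k]_n.+1) := (G i).@[x 0] / (x 0 i ^+ N * linform t x ^+ M).
have GE i x : E x -> x 0 i != 0 -> (G i).@[x 0] / x 0 i ^+ N =
    \sum_l (g l).@[x 0] * x 0 l ^+ N.+1 * T l i x.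
  move=> Ex xi; rewrite /G raddf_sum mulr_suml; apply: eq_bigr => l _ /=.
  rewrite !mevalM mevalXU; have [->|xl] := eqVneq (x 0 l) 0.
    by rewrite expr0n !mulr0 !mul0r.
  by rewrite -HE // exprMn exprS; field; rewrite expf_neq0.
have b'E i j x : E x -> x 0 i != 0 -> x 0 j != 0 -> linform t x != 0 ->
    b' j x - b' i x = T i j x.
  move=> Ex xi xj tx; rewrite /b' !invfM !mulrA !GE // -mulrBl -sumrB.
  have -> : \sum_l ((g l).@[x 0] * x 0 l ^+ N.+1 * T l j x -
      (g l).@[x 0] * x 0 l ^+ N.+1 * T l i x) = linform t x ^+ M * T i j x.
    rewrite -meval_lpoly gE // mulr_suml; apply: eq_bigr => l _.
    rewrite rmorphXn /= mevalXU; have [->|xl] := eqVneq (x 0 l) 0.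
      by rewrite expr0n !mulr0 !mul0r subrr.
    by rewrite (Tco l i j x) //; ring.
  by rewrite mulrAC divff ?mul1r // expf_neq0.
(* As [s] and [t] have no common zero on [E], a power of each [x_i] is [h 0 s + h 1 t ^ M]. The part
   with [h 1] cancels the denominator [t ^ M] of [b' i] and gives [b i]; the part with [h 0] is the
   multiple [s w i]. *)
have /choice [K /choice [h hh]] : forall i : 'I_n.+1, exists K (h : 'I_2 -> S),
    (forall l, homsh (if l == 0 then 1%N else M) K (h l)) /\
    forall x, E x -> x 0 i ^+ K =
      (h 0).@[x 0] * linform s x + (h 1).@[x 0] * linform t x ^+ M.
  move=> i.
  have [||K [h [hh eh]]] := power_in_ideal
     (r := fun l : 'I_2 => if l == 0 then 1%N else M)
     (G := fun l : 'I_2 => if l == 0 then lpoly s else lpoly t ^+ M) (homogX i).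
  - by move=> l; case: ifP => _; [exact: lpoly_homog|exact/homogXn/lpoly_homog].
  - move=> x Ex _; have [sx|sx] := eqVneq (linform s x) 0.
      by exists 1; rewrite /= rmorphXn /= meval_lpoly expf_neq0 // st.
    by exists 0; rewrite /= meval_lpoly.
  exists K, h; split=> [l|x Ex]; first by have := hh l; rewrite mul1n.
  have := eh x Ex; rewrite mevalXU => ->.
  rewrite !big_ord_recl big_ord0 addr0 (_ : lift ord0 ord0 = 1 :> 'I_2); last exact: val_inj.
  by rewrite /= rmorphXn /= !meval_lpoly.
pose b i (x : 'rV[k]_n.+1) := (G i * h i 1).@[x 0] / ('X_i ^+ (N + K i) : S).@[x 0].
pose w i (x : 'rV[k]_n.+1) := (G i * h i 0).@[x 0] / ('X_i ^+ (N + K i) * lpoly t ^+ M).@[x 0].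
have XE i m (x : 'rV[k]_n.+1) : ('X_i ^+ m : S).@[x 0] = x 0 i ^+ m.
  by rewrite rmorphXn /= mevalXU.
have bsec i : section E 0 (chart i) (b i).
  have hXi : ('X_i ^+ (N + K i) : S) \is (N + K i).-homog by exact/homogXn/homogX.
  have hGh : G i * h i 1 \is (N + K i).-homog.
    have [hom _] := hh i; case: (hom 1) => [->|[/= le hh1]]; first by rewrite mulr0 dhomog0.
    have -> : (N + K i = M + N + (K i - M))%N by lia.
    exact: dhomogM.
  apply: (section_quot hGh hXi); first by rewrite addr0.
  by move=> x _ xi; rewrite XE expf_neq0.
have wsec i : section E (-1) (chart i `&` nonzero_locus (lpoly t)) (w i).
  have hD : 'X_i ^+ (N + K i) * lpoly t ^+ M \is (N + K i + M).-homog.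
    by apply: dhomogM; apply: homogXn; [exact: homogX|exact: lpoly_homog].
  have hGh : G i * h i 0 \is (N + K i + M).-1.-homog.
    have [hom _] := hh i; case: (hom 0) => [->|[/= le hh0]]; first by rewrite mulr0 dhomog0.
    have -> : ((N + K i + M).-1 = M + N + (K i - 1))%N by lia.
    exact: dhomogM.
  apply: (section_quot hGh hD); first by lia.
  move=> x _ [xi tx]; rewrite mevalM XE rmorphXn /=.
  by rewrite mulf_neq0 ?expf_neq0.
pose D i j x := T i j x - (b j x - b i x).
have bE i x : E x -> x 0 i != 0 -> linform t x != 0 -> b' i x - b i x = linform s x * w i x.
  move=> Ex xi tx; have [_ e] := hh i.
  have es : (h i 0).@[x 0] * linform s x =
      x 0 i ^+ K i - (h i 1).@[x 0] * linform t x ^+ M by rewrite e //; ring.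
  rewrite /b' /b /w !mevalM !XE rmorphXn /= meval_lpoly exprD.
  have -> : linform s x * ((G i).@[x 0] * (h i 0).@[x 0] /
      (x 0 i ^+ N * x 0 i ^+ K i * linform t x ^+ M)) =
    (G i).@[x 0] * ((h i 0).@[x 0] * linform s x) /
      (x 0 i ^+ N * x 0 i ^+ K i * linform t x ^+ M) by ring.
  by rewrite es; field; rewrite !expf_neq0.
have Dw i j x : E x -> x 0 i != 0 -> x 0 j != 0 -> linform t x != 0 ->
    D i j x = linform s x * (w j x - w i x).
  move=> Ex xi xj tx; rewrite mulrBr -(bE i x) // -(bE j x) // /D -(b'E i j x) //.
  by move: (b i x) (b j x) (b' i x) (b' j x) => u v u' v'; ring.
(* The quotient of [D i j] by [s]. Where [s] vanishes, [t] does not, and the quotient is given there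
   by [w j - w i]. *)
pose e i j x := if linform s x != 0 then D i j x / linform s x else w j x - w i x.
have eE i j x : E x -> x 0 i != 0 -> x 0 j != 0 -> D i j x = linform s x * e i j x.
  move=> Ex xi xj; rewrite /e; case: ifPn => [sx|/negPn/eqP sx].
    by rewrite mulrC divfK.
  by rewrite Dw // st.
have ew i j x : E x -> x 0 i != 0 -> x 0 j != 0 -> linform t x != 0 ->
    e i j x = w j x - w i x.
  move=> Ex xi xj tx; rewrite /e; case: ifPn => // sx.
  by rewrite Dw // mulrC mulKf.
exists e, b; split=> //; split=> [i j|i j l x Ex xi xj xl].
  apply: section_local => x Ex [xi xj].
  have [sx|sx] := eqVneq (linform s x) 0.
    exists 1%N, (lpoly t); split; [exact: lpoly_homog|by rewrite meval_lpoly st|].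
    apply: (@section_ext _ _ _ _ _ (fun x => w j x - w i x)).
      by move=> y Ey [[yi yj]]; rewrite /nonzero_locus meval_lpoly => ty; rewrite ew.
    by apply: sectionB; apply: section_sub (wsec _) => y [[yi yj] ty].
  exists 1%N, (lpoly s); split; [exact: lpoly_homog|by rewrite meval_lpoly|].
  apply: (@section_ext _ _ _ _ _ (fun x => D i j x / (lpoly s).@[x 0])).
    by move=> y Ey [_]; rewrite /nonzero_locus /e meval_lpoly => ->.
  have -> : -1 = 0 - 1%N%:Z by [].
  apply: section_div; first exact: lpoly_homog.
    by move=> y _ [].
  apply: sectionB; first by apply: section_sub (Tsec i j) => y [].
  by apply: sectionB; apply: section_sub (bsec _) => y [[yi yj] _].
have DD : D i l x = D i j x + D j l x.
  by rewrite /D (Tco i j l x) //; move: (b i x) (b j x) (b l x) => u v z; ring.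
rewrite /e; case: ifP => _; first by rewrite -mulrDl; congr (_ / _).
by move: (w i x) (w j x) (w l x) => u v z; ring.
Qed.

End GlobalForms.

Section Coordinates4.
Definition o0 : 'I_4 := Ordinal (isT : (0 < 4)%N).
Definition o1 : 'I_4 := Ordinal (isT : (1 < 4)%N).
Definition o2 : 'I_4 := Ordinal (isT : (2 < 4)%N).
Definition o3 : 'I_4 := Ordinal (isT : (3 < 4)%N).

Lemma sum4 (V : nmodType) (F : 'I_4 -> V) : \sum_i F i = F o0 + F o1 + F o2 + F o3.
Proof.
rewrite !big_ord_recr big_ord0 /= add0r.
by congr (_ + _ + _ + _); congr F; apply: val_inj.
Qed.

(* The coefficient of the volume form in [P /\ x /\ v], for a bivector [P]. *)
Definition wedge (R : pzRingType) (P : 'I_4 -> 'I_4 -> R) (x v : 'I_4 -> R) : R :=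
  P o0 o1 * (x o2 * v o3 - x o3 * v o2) - P o0 o2 * (x o1 * v o3 - x o3 * v o1) +
  P o0 o3 * (x o1 * v o2 - x o2 * v o1) + P o1 o2 * (x o0 * v o3 - x o3 * v o0) -
  P o1 o3 * (x o0 * v o2 - x o2 * v o0) + P o2 o3 * (x o0 * v o1 - x o1 * v o0).

End Coordinates4.

Section Cochains.
Variables (k : closedFieldType) (n : nat) (E : set 'rV[k]_n.+1).
Hypothesis irr : irreducible_variety E.
Implicit Types (x y : 'rV[k]_n.+1) (c e : cochain k n).

Lemma section0 U : section E 0 U (fun _ => 0 : k).
Proof.
have := @section_form _ _ E U 0 0 (dhomog0 _ _ _).
by apply: section_ext => x _ _; rewrite meval0.
Qed.

Lemma cocycle_lin d : lin_closed (cocycle E d).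
Proof.
split.
  split=> [i j|i j l x _ _ _ _]; last by rewrite addr0.
  move=> x Ex [xi _].
  exists `|Num.max d 0|%N, `|Num.max (- d) 0|%N, 0, ('X_i ^+ `|Num.max (- d) 0|).
  split; first by split; [exact: dhomog0|exact/homogXn/homogX|lia
    |rewrite rmorphXn /= mevalXU expf_neq0].
  by move=> y _ _ _; rewrite meval0 mul0r.
move=> a u v [us uc] [vs vc]; split=> [i j|i j l x Ex xi xj xl].
  exact: sectionD (sectionZ a (us i j)) (vs i j).
have eu := uc i j l x Ex xi xj xl; have ev := vc i j l x Ex xi xj xl.
change (a * u i l x + v i l x = (a * u i j x + v i j x) + (a * u j l x + v j l x) :> k).
by rewrite eu ev; ring.
Qed.

Lemma cup_cocycle d d' u e : section E d setT u -> cocycle E d' e ->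
  cocycle E (d + d') (cup u e).
Proof.
move=> us [es ec]; split=> [i j|i j l x Ex xi xj xl].
  by apply: sectionM => //; apply: section_sub us.
by rewrite /cup (ec i j l) // mulrDr.
Qed.

Lemma coboundary_cocycle d b : (forall i, section E d (chart i) (b i)) ->
  cocycle E d (fun i j x => b j x - b i x).
Proof.
move=> bs; split=> [i j|i j l x _ _ _ _]; last by ring.
by apply: sectionB; apply: section_sub (bs _) => x [].
Qed.

Variable tr : cochain k n -> k.
Hypothesis trE : trivialization E tr.

Lemma trD a c c' : cocycle E 0 c -> cocycle E 0 c' -> tr (a *: c + c') = a * tr c + tr c'.
Proof. by case: trE => + _ _; apply. Qed.

Lemma tr_eq0 c : cocycle E 0 c -> (tr c = 0 <-> coboundary E 0 c).
Proof. by case: trE => _ + _; apply. Qed.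

Lemma tr_ext c c' : cocycle E 0 c -> cocycle E 0 c' ->
  (forall i j x, E x -> chart i x -> chart j x -> c i j x = c' i j x) -> tr c = tr c'.
Proof.
move=> hc hc' e.
have h : tr (-1 *: c + c') = 0.
  apply/tr_eq0; first exact: (proj2 (cocycle_lin 0)).
  exists (fun _ _ => 0); split=> [i|i j x Ex xi xj]; first exact: section0.
  change (-1 * c i j x + c' i j x = 0 - 0 :> k).
  by rewrite (e i j) //; ring.
move: h; rewrite trD // mulN1r addrC => /eqP; rewrite subr_eq0 => /eqP.
by move->.
Qed.

Lemma tr_sum N (a : 'I_N -> k) (c : 'I_N -> cochain k n) :
  (forall l, cocycle E 0 (c l)) -> tr (\sum_l a l *: c l) = \sum_l a l * tr (c l).
Proof.
have tr0 : tr 0 = 0.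
  have hc : cocycle E 0 (0 : cochain k n) by case: (cocycle_lin 0).
  by apply/(tr_eq0 hc); exists (fun _ _ => 0); split=> [i|i j x _ _ _];
    [exact: section0|rewrite subrr].
elim: N a c => [|N IH] a c hc; first by rewrite !big_ord0.
rewrite !big_ord_recl trD ?IH //.
by apply: (lin_closed_sum (cocycle_lin 0)) => l _; apply: (lin_closedZ (cocycle_lin 0)).
Qed.

Lemma coord_section U (b : 'I_n.+1) : section E 1 U (fun y => y 0 b).
Proof.
by apply: section_ext (@section_linform _ _ E U (delta_mx b 0)) => x _ _;
  exact: linform_delta.
Qed.

Lemma cup_linform_cocycle s e : cocycle E (-1) e -> cocycle E 0 (cup (linform s) e).
Proof. by move=> he; have := cup_cocycle (@section_linform _ _ E setT s) he; rewrite subrr. Qed.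

Lemma cup_coord_cocycle b e : cocycle E (-1) e -> cocycle E 0 (cup (fun y => y 0 b) e).
Proof. by move=> he; have := cup_cocycle (@coord_section setT b) he; rewrite subrr. Qed.

Lemma tr_cup_linform s e : cocycle E (-1) e ->
  tr (cup (linform s) e) = linform s (serre tr e).
Proof.
move=> he; rewrite linform_sum.
have -> : cup (linform s) e = \sum_b s b 0 *: cup (fun y => y 0 b) e.
  apply/funext => i; apply/funext => j; apply/funext => x.
  rewrite /cup linform_sum mulr_suml.
  rewrite (_ : (\sum_b _) i j x = \sum_b (s b 0 *: cup (fun y => y 0 b) e) i j x).
    by apply: eq_bigr => b _; rewrite -mulrA.
  by rewrite !fct_sumE.
rewrite tr_sum => [|b]; last exact: cup_coord_cocycle.
by apply: eq_bigr => b _; rewrite mxE.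
Qed.

Lemma serre_sum N (a : 'I_N -> k) (e : 'I_N -> cochain k n) :
  (forall l, cocycle E (-1) (e l)) ->
  serre tr (\sum_l a l *: e l) = \sum_l a l *: serre tr (e l).
Proof.
move=> he; apply/rowP => b; rewrite summxE mxE.
under [RHS]eq_bigr do rewrite !mxE.
rewrite -tr_sum => [|l]; last exact: cup_coord_cocycle.
congr tr; apply/funext => i; apply/funext => j; apply/funext => x.
rewrite /cup !fct_sumE mulr_sumr; apply: eq_bigr => l _.
change (x 0 b * (a l * e l i j x) = a l * (x 0 b * e l i j x)); ring.
Qed.

Lemma cocycle_sum d N (a : 'I_N -> k) (e : 'I_N -> cochain k n) :
  (forall l, cocycle E d (e l)) -> cocycle E d (\sum_l a l *: e l).
Proof.
by move=> he; apply: (lin_closed_sum (cocycle_lin d)) => l _;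
  apply: (lin_closedZ (cocycle_lin d)).
Qed.

Lemma annihilator_nontrivial (U : {vspace 'rV[k]_n.+1}) : U != fullv ->
  exists2 s : 'cV[k]_n.+1, s != 0 & forall v, v \in U -> linform s v = 0.
Proof.
move=> Up; pose B := \matrix_(b < n.+1, l < \dim U) (vbasis U)`_l 0 b.
have [|u u0 uB] := exists_left_kernel B.
  have : (\dim U < \dim {:'rV[k]_n.+1})%N by rewrite (ltn_leqif (dimv_leqif_eq (subvf U))).
  by rewrite dimvf /dim /= mul1n.
exists u^T; first by rewrite -(inj_eq trmx_inj) trmxK trmx0.
move=> v /coord_vbasis ->; rewrite /linform mulmx_suml summxE big1 // => l _.
rewrite -scalemxAl mxE; apply/eqP; rewrite mulf_eq0; apply/orP; right.
move/rowP/(_ l): uB; rewrite !mxE => e; apply/eqP; rewrite -[RHS]e.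
by apply: eq_bigr => b _; rewrite !mxE mulrC.
Qed.

Variable d : nat.
Hypotheses (degE : curve_of_degree E d) (lc : linearly_complete E).

(** If the image were a proper subspace, a nonzero linear form [s] would be zero on it. But a
    cocycle of trace 1 is [s] times some [e] up to a coboundary, so the value of [s] at the point of
    [e] is 1. *)
Lemma serre_surjective x : exists2 e, cocycle E (-1) e & serre tr e = x.
Proof.
have [|U UB] := @lin_closed_vspace _ _
    (fun v : 'rV[k]_n.+1 => exists2 e, cocycle E (-1) e & serre tr e = v).
  have lin2 a u v e e' : cocycle E (-1) e -> serre tr e = u -> cocycle E (-1) e' ->
      serre tr e' = v -> exists2 e'', cocycle E (-1) e'' & serre tr e'' = a *: u + v.
    move=> he <- he' <-.
    pose a2 (l : 'I_2) := if l == 0 then a else 1.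
    pose e2 (l : 'I_2) := if l == 0 then e else e'.
    have he2 l : cocycle E (-1) (e2 l) by rewrite /e2; case: ifP.
    exists (\sum_l a2 l *: e2 l); first exact: cocycle_sum.
    by rewrite serre_sum // !big_ord_recl big_ord0 /a2 /e2 /= scale1r addr0.
  split=> [|a u v [e he es] [e' he' es']]; last exact: lin2 he es he' es'.
  have h0 : cocycle E (-1) (0 : cochain k n) by case: (cocycle_lin (-1)).
  have [e he e0] := lin2 (-1) _ _ _ _ h0 erefl h0 erefl.
  by exists e => //; rewrite e0 scaleN1r addNr.
apply/UB; apply: contrapT => /negP xU.
have Up : U != fullv.
  by apply: contraNneq xU => ->; rewrite memvf.
have [s s0 sU] := annihilator_nontrivial Up.
have nIs : ~ vanishing E (lpoly s).
  move=> Is; case/eqP: s0; apply: (proj1 lc) => y Ey.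
  by rewrite -meval_lpoly; exact: Is.
have [T hT trT] : exists2 c, cocycle E 0 c & tr c = 1 by case: trE => _ _; apply.
have [e [b [he hb eb]]] := cocycle_divisible irr degE nIs hT.
have hdb := coboundary_cocycle hb.
have hse := cup_linform_cocycle s he.
have : tr T = 1 * tr (cup (linform s) e) + tr (fun i j x => b j x - b i x).
  rewrite -trD //; apply: tr_ext => //; first exact: (proj2 (cocycle_lin 0)).
  move=> i j y Ey yi yj.
  change (T i j y = 1 * (linform s y * e i j y) + (b j y - b i y)).
  by rewrite -(eb i j) //; ring.
have -> : tr (fun i j x => b j x - b i x) = 0 by apply/(tr_eq0 hdb); exists b.
rewrite tr_cup_linform // sU ?trT; last by apply/UB; exists e.
by move/eqP; rewrite mulr0 addr0 oner_eq0.
Qed.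

End Cochains.

Section FeiginOdesskii.
Variables (k : closedFieldType) (E : set 'rV[k]_4).
Hypothesis char0 : [pchar k] =i pred0.
Local Notation S := {mpoly k[4]}.
Local Notation I := (vanishing E).
Hypotheses (irr : irreducible_variety E) (degE : curve_of_degree E 4)
  (lc : linearly_complete E).
Implicit Types (x y v : 'rV[k]_4) (s t : 'cV[k]_4).

Lemma section_glue d (u : 'I_4 -> 'rV[k]_4 -> k) :
  (forall i, section E d (chart i) (u i)) ->
  (forall i j x, E x -> chart i x -> chart j x -> u i x = u j x) ->
  exists2 g, section E d setT g & forall i x, E x -> chart i x -> g x = u i x.
Proof.
move=> us uu; pose g x := if [pick i | x 0 i != 0] is Some i then u i x else 0.
have gE i x : E x -> chart i x -> g x = u i x.
  move=> Ex xi; rewrite /g; case: pickP => [j xj|/(_ i)]; first exact: uu.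
  by rewrite (xi : x 0 i != 0).
exists g => //; apply: section_local => x Ex _.
have /rV0Pn [i xi] := variety_neq0 irr Ex.
exists 1%N, 'X_i; split; [exact: homogX|by rewrite mevalXU|].
have Ui : setT `&` nonzero_locus ('X_i : S) `<=` chart i.
  by move=> y [_]; rewrite /nonzero_locus mevalXU.
by apply: section_ext (section_sub Ui (us i)) => y Ey /Ui yi; rewrite (gE i).
Qed.

Variable tr : cochain k 3 -> k.
Hypothesis trE : trivialization E tr.

(* With [T] a cocycle of trace 1, [X_b e_c = delta_bc T + d beta_bc] and
   [X_b T = d gamma_b]. *)
Lemma serre_basis_data : exists e T beta gamma,
  [/\ forall c : 'I_4, cocycle E (-1) (e c) /\ serre tr (e c) = delta_mx 0 c,
      forall b c i, section E 0 (chart i) (beta b c i),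
      forall b i, section E 1 (chart i) (gamma b i),
      forall (b c i j : 'I_4) y, E y -> chart i y -> chart j y ->
        y 0 b * e c i j y = (c == b)%:R * T i j y + (beta b c j y - beta b c i y)
    & forall (b i j : 'I_4) y, E y -> chart i y -> chart j y ->
        y 0 b * T i j y = gamma b j y - gamma b i y].
Proof.
have /choice [e he] : forall c : 'I_4, exists e, cocycle E (-1) e /\
    serre tr e = delta_mx 0 c.
  by move=> c; have [e he es] := serre_surjective irr trE degE lc (delta_mx 0 c); exists e.
pose T : cochain k 3 := cup (fun y => y 0 o0) (e o0).
have trXe b c : tr (cup (fun y => y 0 b) (e c)) = (c == b)%:R.
  have [_ /rowP/(_ b)] := he c; rewrite !mxE eqxx /= => ->.
  by rewrite eq_sym.
have hXe b c : cocycle E 0 (cup (fun y => y 0 b) (e c)).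
  by apply: cup_coord_cocycle; have [] := he c.
have hT : cocycle E 0 T by exact: hXe.
have /choice [beta hbeta] : forall bc : 'I_4 * 'I_4, exists beta,
    (forall i, section E 0 (chart i) (beta i)) /\
    forall (i j : 'I_4) y, E y -> chart i y -> chart j y ->
      y 0 bc.1 * e bc.2 i j y = (bc.2 == bc.1)%:R * T i j y + (beta j y - beta i y).
  move=> [b c] /=; pose D := (- (c == b)%:R) *: T + cup (fun y => y 0 b) (e c).
  have hD : cocycle E 0 D by apply: (proj2 (cocycle_lin E 0)).

  have /(tr_eq0 trE hD) [beta [bs bE]] : tr D = 0.
    by rewrite (trD trE) // !trXe eqxx mulr1 addNr.
  exists beta; split=> // i j y Ey yi yj; rewrite -(bE i j y) //.
  change (y 0 b * e c i j y = (c == b)%:R * T i j y +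
    (- (c == b)%:R * T i j y + y 0 b * e c i j y)); ring.
(* As [T = X_0 e_0], for [b] other than 0 one has [X_b T = X_0 (X_b e_0)], a coboundary. For [b = 0]
   the representative [X_1 e_1 - d beta_11] of [T] is used instead, which gives [X_1 (X_0 e_1)] up
   to a coboundary. *)
pose gamma b i y := if b == o0 then y 0 o1 * beta (o0, o1) i y - y 0 o0 * beta (o1, o1) i y
  else y 0 o0 * beta (b, o0) i y.
have coordM U (b : 'I_4) w : section E 0 U w -> section E 1 U (fun y => y 0 b * w y).
  by move=> hs; have := sectionM (@coord_section _ _ E U b) hs; rewrite addr0.
exists e, T, (fun b c => beta (b, c)), gamma; split=> //.
- by move=> b c i; have [] := hbeta (b, c).
- move=> b i; rewrite /gamma; case: (b == o0); last first.
    by apply: coordM; have [] := hbeta (b, o0).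
  apply: sectionB; apply: coordM; first by have [] := hbeta (o0, o1).
  by have [] := hbeta (o1, o1).
- by move=> b c i j y; have [_] := hbeta (b, c); apply.
- move=> b i j y Ey yi yj; have TE : T i j y = y 0 o0 * e o0 i j y by [].
  have bE c c' : y 0 c * e c' i j y = (c' == c)%:R * T i j y +
      (beta (c, c') j y - beta (c, c') i y).
    by have [_ h] := hbeta (c, c'); exact: h.
  rewrite /gamma; case: ifPn => [/eqP ->|b0].
    have e11 := bE o1 o1; rewrite eqxx mul1r in e11.
    have e01 := bE o0 o1; rewrite (_ : (o1 == o0) = false) // mul0r add0r in e01.
    have -> : T i j y = y 0 o1 * e o1 i j y - (beta (o1, o1) j y - beta (o1, o1) i y).
      by rewrite e11; ring.
    have -> : y 0 o0 * (y 0 o1 * e o1 i j y - (beta (o1, o1) j y - beta (o1, o1) i y)) =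
      y 0 o1 * (y 0 o0 * e o1 i j y) - y 0 o0 * (beta (o1, o1) j y - beta (o1, o1) i y).
      by ring.
    by rewrite e01; ring.
  have eb0 := bE b o0; rewrite eq_sym (negPf b0) mul0r add0r in eb0.
  by rewrite TE mulrCA eb0; ring.
Qed.

Lemma linform_suml (J : Type) (q : seq J) (P : pred J) (F : J -> 'cV[k]_4) y :
  linform (\sum_(j <- q | P j) F j) y = \sum_(j <- q | P j) linform (F j) y.
Proof.
by elim/big_rec2: _ => [|j a b _ <-]; rewrite ?linform0 ?linformD.
Qed.

Lemma sum_deltal (b : 'I_4) (x : 'I_4 -> k) : \sum_d x d * (d == b)%:R = x b.
Proof.
by rewrite (bigD1 b) //= eqxx mulr1 big1 ?addr0 // => d /negPf ->; rewrite mulr0.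
Qed.

Variable Pi : bivector_values k 3.
Hypothesis PiE : forall x s1 s2,
  x != 0 -> x *m s1 = 0 -> x *m s2 = 0 ->
  forall e, cocycle E (-1) e -> serre tr e = x ->
  forall a f u,
    extension_to_hom E e (linform s1) a ->
    lift_to_section E e (linform s2) f ->
    (forall i y, E y -> chart i y ->
       u y = linform s1 y * f i y + a i y * linform s2 y) ->
    Pi x s1 s2 = tr (cup u e).

Definition tensor_value (r : 'I_4 -> 'I_4 -> 'I_4 -> 'cV[k]_4) x y (b c : 'I_4) : k :=
  \sum_d x 0 d * linform (r d b c) y.

(* On [E] the bivector [tensor_value r x y] is [beta_x(y) /\ y + x /\ gamma(y)]. *)
Lemma FO_tensor : exists r,
  [/\ forall x y b c, tensor_value r x y b c = - tensor_value r x y c b,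
      forall x s t, x != 0 -> x *m s = 0 -> x *m t = 0 ->
        Pi x s t = \sum_b \sum_c s b 0 * t c 0 * tensor_value r x x b c,
      forall x y, E y -> wedge (tensor_value r x y) (x 0) (y 0) = 0
    & forall x, exists2 e, cocycle E (-1) e /\ serre tr e = x &
        exists B C : 'I_4 -> 'I_4 -> 'rV[k]_4 -> k,
        [/\ forall b i, section E 0 (chart i) (B b i),
            forall b c i y, E y -> chart i y -> tensor_value r x y b c =
              B b i y * y 0 c - B c i y * y 0 b + x 0 b * C c i y - x 0 c * C b i y
          & exists T, forall (b i j : 'I_4) y, E y -> chart i y -> chart j y ->
              B b j y - B b i y = y 0 b * e i j y - x 0 b * T i j y]].
Proof.
have [e [T [beta [gamma [he sbeta sgamma ebeta egamma]]]]] := serre_basis_data.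
(* The right hand side is defined chart by chart, but the terms in [e] and [T] cancel on overlaps.
   It is thus a global section of O(1), and linear completeness makes it a linear form. *)
have /choice [r0 hr0] : forall dbc : 'I_4 * 'I_4 * 'I_4, exists r, forall i y,
    E y -> chart i y -> linform r y =
      beta dbc.1.2 dbc.1.1 i y * y 0 dbc.2 - beta dbc.2 dbc.1.1 i y * y 0 dbc.1.2 +
      ((dbc.1.1 == dbc.1.2)%:R * gamma dbc.2 i y - (dbc.1.1 == dbc.2)%:R * gamma dbc.1.2 i y).
  move=> [[d b] c] /=.
  have coordM U (b' : 'I_4) w : section E 0 U w -> section E 1 U (fun y => w y * y 0 b').
    by move=> hs; have := sectionM hs (@coord_section _ _ E U b'); rewrite add0r.
  have [||g gs gE] := @section_glue 1 (fun i y =>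
      beta b d i y * y 0 c - beta c d i y * y 0 b +
      ((d == b)%:R * gamma c i y - (d == c)%:R * gamma b i y)).
  - move=> i; apply: sectionD; apply: sectionB; try exact: coordM; exact: sectionZ.
  - move=> i j y Ey yi yj; apply/eqP; rewrite eq_sym -subr_eq0; apply/eqP.
    have e1 : beta b d j y = beta b d i y + y 0 b * e d i j y - (d == b)%:R * T i j y.
      by rewrite (ebeta b d i j y) //; ring.
    have e2 : beta c d j y = beta c d i y + y 0 c * e d i j y - (d == c)%:R * T i j y.
      by rewrite (ebeta c d i j y) //; ring.
    have e3 : gamma b j y = gamma b i y + y 0 b * T i j y.
      by rewrite (egamma b i j y) //; ring.
    have e4 : gamma c j y = gamma c i y + y 0 c * T i j y.
      by rewrite (egamma c i j y) //; ring.
    by rewrite e1 e2 e3 e4; ring.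
  have [r gr] := proj2 lc g gs.
  by exists r => i y Ey yi; rewrite -gr // (gE i).
pose r d b c := r0 (d, b, c).
have rE d b c i y : E y -> chart i y -> linform (r d b c) y =
    beta b d i y * y 0 c - beta c d i y * y 0 b +
    ((d == b)%:R * gamma c i y - (d == c)%:R * gamma b i y).
  exact: (hr0 (d, b, c)).
have rC d b c : r d b c = - r d c b.
  apply/eqP; rewrite -addr_eq0; apply/eqP; apply: (proj1 lc) => y Ey.
  have /rV0Pn [i yi] := variety_neq0 irr Ey.
  by rewrite linformD !(rE _ _ _ i) //; ring.
pose B x b i y := \sum_d x 0 d * beta b d i y.
have tE x b c i y : E y -> chart i y -> tensor_value r x y b c =
    B x b i y * y 0 c - B x c i y * y 0 b + x 0 b * gamma c i y - x 0 c * gamma b i y.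
  move=> Ey yi; rewrite /tensor_value /B !mulr_suml.
  rewrite -(sum_deltal b (x 0)) -(sum_deltal c (x 0)) !mulr_suml -!sumrB -!big_split /=.
  rewrite -sumrB; apply: eq_bigr => d _; rewrite (rE _ _ _ i) //; ring.
have ex x : exists2 e', cocycle E (-1) e' /\ serre tr e' = x &
    forall i j y, e' i j y = \sum_d x 0 d * e d i j y.
  have hec l : cocycle E (-1) (e l) by have [] := he l.
  exists (\sum_d x 0 d *: e d); last by move=> i j y; rewrite !fct_sumE.
  split; first exact: cocycle_sum.
  rewrite (serre_sum trE) // [RHS]row_sum_delta.
  by apply: eq_bigr => d _; have [_ ->] := he d.
have Bdiff x b i j y : E y -> chart i y -> chart j y ->
    B x b j y - B x b i y = y 0 b * (\sum_d x 0 d * e d i j y) - x 0 b * T i j y.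
  move=> Ey yi yj; rewrite /B -(sum_deltal b (x 0)) mulr_sumr mulr_suml -!sumrB.
  apply: eq_bigr => d _.
  by rewrite mulrCA (ebeta b d i j y) //; ring.
have Bsec x b i : section E 0 (chart i) (B x b i).
  by apply: section_sum => d; apply: sectionZ.
exists r; split.
- move=> x y b c; rewrite /tensor_value -sumrN; apply: eq_bigr => d _.
  by rewrite rC -mulrN -[in LHS]scaleN1r linformZ mulN1r.
- move=> x s t x0 xs xt; have [e' [he' es'] e'E] := ex x.
  (* [B x] fails to glue by [y_b e' - x_b T]. Contraction with [s] or [t], which annihilate [x],
     removes [T], so these are the lifts required for the class [e']; the image section [u] is then
     the contraction of the tensor with [s] and [t]. *)
  pose a i y := \sum_b s b 0 * B x b i y.
  pose f i y := - \sum_b t b 0 * B x b i y.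
  pose R := \sum_b \sum_c (s b 0 * t c 0) *: \sum_d x 0 d *: r d b c.
  have sx0 : \sum_b s b 0 * x 0 b = 0.
    by rewrite -linform_sum /linform xs mxE.
  have tx0 : \sum_b t b 0 * x 0 b = 0.
    by rewrite -linform_sum /linform xt mxE.
  have RE y : linform R y = \sum_b \sum_c s b 0 * t c 0 * tensor_value r x y b c.
    rewrite linform_suml; apply: eq_bigr => b _; rewrite linform_suml.
    apply: eq_bigr => c _; rewrite linformZ linform_suml; congr (_ * _).
    by apply: eq_bigr => d _; rewrite linformZ.
  rewrite (PiE x0 xs xt he' es' (a := a) (f := f) (u := linform R)).
  + by rewrite (tr_cup_linform trE) // es' RE.
  + split=> [i|i j y Ey yi yj]; first by apply: section_sum => b; exact: sectionZ.
    have -> : linform s y * e' i j y =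
        \sum_b s b 0 * (B x b j y - B x b i y) + (\sum_b s b 0 * x 0 b) * T i j y.
      rewrite linform_sum !mulr_suml -big_split /=; apply: eq_bigr => b _.
      by rewrite Bdiff // e'E; ring.
    rewrite sx0 mul0r addr0 /a -big_split; apply: eq_bigr => b _ /=; ring.
  + split=> [i|i j y Ey yi yj].
      apply: section_ext (sectionZ (-1) (section_sum (fun b => sectionZ (t b 0) (Bsec x b i)))).
      by move=> y _ _; rewrite mulN1r.
    have -> : e' i j y * linform t y =
        \sum_b t b 0 * (B x b j y - B x b i y) + (\sum_b t b 0 * x 0 b) * T i j y.
      rewrite mulrC linform_sum !mulr_suml -big_split /=; apply: eq_bigr => b _.
      by rewrite Bdiff // e'E; ring.
    rewrite tx0 mul0r addr0 /f -!sumrN -big_split; apply: eq_bigr => b _ /=; ring.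
  + move=> i y Ey yi; rewrite RE !linform_sum.
    have -> : \sum_b \sum_c s b 0 * t c 0 * tensor_value r x y b c =
      (\sum_b s b 0 * B x b i y) * (\sum_c t c 0 * y 0 c) -
      (\sum_b s b 0 * y 0 b) * (\sum_c t c 0 * B x c i y) +
      ((\sum_b s b 0 * x 0 b) * (\sum_c t c 0 * gamma c i y) -
       (\sum_b s b 0 * gamma b i y) * (\sum_c t c 0 * x 0 c)).
      rewrite !big_distrlr -!sumrB -big_split /=; apply: eq_bigr => b _.
      rewrite -!sumrB -big_split /=; apply: eq_bigr => c _.
      by rewrite (tE _ _ _ i) //; ring.
    by rewrite sx0 tx0 /a /f; ring.
- move=> x y Ey; have /rV0Pn [i yi] := variety_neq0 irr Ey.
  by rewrite /wedge !(tE _ _ _ i) //; ring.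
- move=> x; have [e' he' e'E] := ex x; exists e' => //.
  exists (B x), gamma; split; [exact: Bsec|by move=> b c i y; exact: tE|].
  by exists T => b i j y Ey yi yj; rewrite Bdiff // e'E.
Qed.

End FeiginOdesskii.

Lemma ord4P (b : 'I_4) : [\/ b = o0, b = o1, b = o2 | b = o3].
Proof.
case: b => [[|[|[|[|//]]]] h]; [constructor 1|constructor 2|constructor 3|constructor 4];
  exact: val_inj.
Qed.

Section Wedge.
Variables (k : closedFieldType).
Local Notation S := {mpoly k[4]}.

Lemma meval_wedge (P : 'I_4 -> 'I_4 -> S) (x v : 'I_4 -> S) (y : 'rV[k]_4) :
  (wedge P x v).@[y 0] = wedge (fun b c => (P b c).@[y 0])
    (fun b => (x b).@[y 0]) (fun b => (v b).@[y 0]).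
Proof. by rewrite /wedge !(mevalD, mevalN, mevalM). Qed.

Lemma wedge_homog (P : 'I_4 -> 'I_4 -> S) (x v : 'I_4 -> S) p q r :
  (forall b c, P b c \is p.-homog) -> (forall b, x b \is q.-homog) ->
  (forall b, v b \is r.-homog) -> wedge P x v \is (p + (q + r)).-homog.
Proof.
move=> hP hx hv; rewrite /wedge.
have h b c d e : P b c * (x d * v e - x e * v d) \is (p + (q + r)).-homog.
  by apply: dhomogM => //; apply: rpredB; apply: dhomogM.
by do ![exact: h | apply: rpredB | apply: rpredD].
Qed.

Lemma wedge_eq (R : pzRingType) (P P' : 'I_4 -> 'I_4 -> R) (x x' v v' : 'I_4 -> R) :
  (forall b c, P b c = P' b c) -> x =1 x' -> v =1 v' -> wedge P x v = wedge P' x' v'.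
Proof. by move=> eP ex ev; rewrite /wedge !eP !ex !ev. Qed.

End Wedge.

Section TensorPencil.
Variables (k : closedFieldType) (E : set 'rV[k]_4) (Q1 Q2 : {mpoly k[4]}).
Hypothesis char0 : [pchar k] =i pred0.
Local Notation S := {mpoly k[4]}.
Local Notation I := (vanishing E).
Hypotheses (irr : irreducible_variety E) (degE : curve_of_degree E 4)
  (lc : linearly_complete E) (penc : is_pencil E Q1 Q2).
Implicit Types (x y v : 'rV[k]_4) (s t : 'cV[k]_4).
Variable r : 'I_4 -> 'I_4 -> 'I_4 -> 'cV[k]_4.
Hypothesis rE : forall x y, E y -> wedge (tensor_value r x y) (x 0) (y 0) = 0.

Lemma wedge_tensor : exists c, forall x y,
  wedge (tensor_value r x y) (x 0) (y 0) =
  c * (Q1.@[x 0] * Q2.@[y 0] - Q2.@[x 0] * Q1.@[y 0]).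
Proof.
have [[hQ1 hQ2] _ [IQ1 IQ2] _] := penc.
pose PX y : S := wedge (fun b c => \sum_d linform (r d b c) y *: 'X_d)
  (fun c => 'X_c) (fun c => (y 0 c)%:MP).
pose PY x : S := wedge (fun b c => lpoly (\sum_d x 0 d *: r d b c))
  (fun c => (x 0 c)%:MP) (fun c => 'X_c).
have PXE x y : (PX y).@[x 0] = wedge (tensor_value r x y) (x 0) (y 0).
  rewrite meval_wedge; apply: wedge_eq => [b c|b|b]; rewrite ?mevalXU ?mevalC //.
  by rewrite raddf_sum; apply: eq_bigr => d _; rewrite /= mevalZ mevalXU mulrC.
have PYE x y : (PY x).@[y 0] = wedge (tensor_value r x y) (x 0) (y 0).
  rewrite meval_wedge; apply: wedge_eq => [b c|b|b]; rewrite ?mevalXU ?mevalC //.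
  rewrite meval_lpoly linform_suml; apply: eq_bigr => d _; exact: linformZ.
have homogC (a : k) : (a%:MP : S) \is 0.-homog.
  by rewrite -[a%:MP]mulr1 mul_mpolyC; apply: rpredZ; exact: dhomog1.
have hPX y : PX y \is 2.-homog.
  apply: (@wedge_homog _ _ _ _ 1 1 0) => [b c|b|b] //; last exact: homogX.
  by apply: rpred_sum => d _; apply: rpredZ; exact: homogX.
have hPY x : PY x \is 2.-homog.
  by apply: (@wedge_homog _ _ _ _ 1 0 1) => [b c|b|b]; [exact: lpoly_homog| |exact: homogX].
have PYI x : I (PY x) by move=> y Ey; rewrite PYE rE.
have [p1 [p2 D0]] : exists p1 p2 : 'rV[k]_4,
    Q1.@[p1 0] * Q2.@[p2 0] - Q1.@[p2 0] * Q2.@[p1 0] != 0.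
  apply: contrapT => h.
  have Q20 : Q2 != 0.
    apply/eqP => Q20; have [_ Qfree _ _] := penc.
    have /Qfree [_ /eqP] : 0 *: Q1 + 1 *: Q2 = 0 by rewrite Q20 scaler0 scale0r addr0.
    by rewrite oner_eq0.
  have [q Qq] : exists q : 'rV[k]_4, Q2.@[q 0] != 0.
    apply: contrapT => h'; case/eqP: Q20; apply: mpoly_eq0P => q.
    by apply/eqP; apply: contraT => Qq; case: h'; exists q.
  apply: (pencil_neq penc (c := Q1.@[q 0] / Q2.@[q 0])).
  apply/eqP; rewrite -subr_eq0; apply/eqP/mpoly_eq0P => p.
  rewrite mevalB mevalZ; apply: (mulIf Qq); rewrite mul0r mulrBl mulrAC divfK //.
  by apply/eqP; apply: contraT => hp; case: h; exists p, q.
set D := _ - _ in D0.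
(* Cramer's rule: for each [x] the wedge is [a Q1(y) + b Q2(y)], and its values at [y = p1] and
   [y = p2], which are quadrics in [x], determine [a] and [b]. *)
pose A : S := D^-1 *: (Q2.@[p2 0] *: PX p1 - Q2.@[p1 0] *: PX p2).
pose B : S := D^-1 *: (Q1.@[p1 0] *: PX p2 - Q1.@[p2 0] *: PX p1).
have hA : A \is 2.-homog by rewrite rpredZ ?rpredB ?rpredZ.
have hB : B \is 2.-homog by rewrite rpredZ ?rpredB ?rpredZ.
have ABE x y : wedge (tensor_value r x y) (x 0) (y 0) =
    A.@[x 0] * Q1.@[y 0] + B.@[x 0] * Q2.@[y 0].
  have [a [b ePY]] := pencil_span penc (hPY x) (PYI x).
  have wE z : wedge (tensor_value r x z) (x 0) (z 0) = a * Q1.@[z 0] + b * Q2.@[z 0].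
    by rewrite -PYE ePY mevalD !mevalZ.
  rewrite wE /A /B !mevalZ !mevalB !mevalZ !PXE !wE /D.
  by field; rewrite -/D.
have AB0 : A * Q1 + B * Q2 = 0.
  apply: mpoly_eq0P => x; rewrite mevalD !mevalM -ABE /wedge; ring.
have [c [eA eB]] := pencil_syzygy char0 irr lc penc hA hB AB0.
by exists c => x y; rewrite ABE eA eB !mevalZ; ring.
Qed.

(** Put [y = x + v] and use linearity in [y]. The part with [r(x, v)] is given by the same formula
    at [y = v], and what remains of [Q(x + v)] is the polar term. *)
Lemma wedge_tensor_diag c :
  (forall x y, wedge (tensor_value r x y) (x 0) (y 0) =
     c * (Q1.@[x 0] * Q2.@[y 0] - Q2.@[x 0] * Q1.@[y 0])) ->
  forall x v, wedge (tensor_value r x x) (x 0) (v 0) =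
    c * (Q1.@[x 0] * polar Q2 x v - Q2.@[x 0] * polar Q1 x v).
Proof.
have [[hQ1 hQ2] _ _ _] := penc; move=> ec x v.
have tD b d : tensor_value r x (x + v) b d = tensor_value r x x b d + tensor_value r x v b d.
  by rewrite /tensor_value -big_split; apply: eq_bigr => l _ /=; rewrite linformDr mulrDr.
have := ec x (x + v); rewrite !meval_quadD //.
have -> : wedge (tensor_value r x (x + v)) (x 0) ((x + v) 0) =
    wedge (tensor_value r x x) (x 0) (v 0) + wedge (tensor_value r x v) (x 0) (v 0).
  by rewrite /wedge !tD !mxE; ring.
rewrite ec => /(canRL (addrK _)) ->; ring.
Qed.

End TensorPencil.

(** * The scalar is not zero *)

Section NonzeroScalar.
Variables (k : closedFieldType) (E : set 'rV[k]_4) (Q1 Q2 : {mpoly k[4]}).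
Local Notation S := {mpoly k[4]}.
Local Notation I := (vanishing E).
Hypotheses (char0 : [pchar k] =i pred0) (irr : irreducible_variety E) (penc : is_pencil E Q1 Q2).
Implicit Types (x y v : 'rV[k]_4) (s t : 'cV[k]_4).
Variable r : 'I_4 -> 'I_4 -> 'I_4 -> 'cV[k]_4.
Hypothesis rC : forall x y b c, tensor_value r x y b c = - tensor_value r x y c b.

Variable x : 'rV[k]_4.
Hypotheses (x0 : x 0 o0 != 0) (Qx : Q1.@[x 0] != 0)
  (w0 : forall y, wedge (tensor_value r x y) (x 0) (y 0) = 0).

(* Coordinates on V / <x>, and the image of the tensor in its exterior square. *)
Let red (y : 'rV[k]_4) b : k := y 0 b - x 0 b / x 0 o0 * y 0 o0.
Let th b c (y : 'rV[k]_4) : k := tensor_value r x y b c -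
  x 0 b / x 0 o0 * tensor_value r x y o0 c - x 0 c / x 0 o0 * tensor_value r x y b o0.

Lemma tensor_value_delta y d c : tensor_value r x y d c =
  \sum_l y 0 l * tensor_value r x (delta_mx 0 l) d c.
Proof.
rewrite /tensor_value; under [RHS]eq_bigr do rewrite mulr_sumr.
rewrite exchange_big; apply: eq_bigr => m _ /=; rewrite linform_sum mulr_sumr.
apply: eq_bigr => l _.
have -> : linform (r m d c) (delta_mx 0 l) = r m d c l 0 by rewrite /linform -rowE mxE.
ring.
Qed.

(** [th] is a linear map from V to the exterior square of the 3-dimensional V / x, with
    [th(y) /\ y = 0] for all [y]. Polarized, this forces [th(x) = 0], so [th] factors through V / x,
    where the only such maps are [y |-> a /\ y]. *)
Lemma reduced_tensor_decomposable : exists a : 'I_4 -> k, a o0 = 0 /\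
  forall b c y, th b c y = a b * red y c - a c * red y b.
Proof.
pose D j : 'rV[k]_4 := delta_mx 0 j.
have thC b c y : th c b y = - th b c y.
  by rewrite /th (rC _ _ c b) (rC _ _ o0 b) (rC _ _ c o0); ring.
have tdiag b y : tensor_value r x y b b = 0.
  have /eqP := rC x y b b; rewrite -addr_eq0 -mulr2n -mulr_natr mulf_eq0.
  by rewrite (negPf (two_neq0 char0)) orbF => /eqP.
have th0 c y : th o0 c y = 0 by rewrite /th tdiag divff //; ring.
have thd b y : th b b y = 0 by rewrite /th tdiag (rC _ _ b o0); ring.
have thsum b c y : th b c y = \sum_l y 0 l * th b c (D l).
  rewrite /th (tensor_value_delta y b c) (tensor_value_delta y o0 c)
    (tensor_value_delta y b o0) !mulr_sumr -!sumrB.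
  by apply: eq_bigr => l _; ring.
have z0 y : th o1 o2 y * red y o3 - th o1 o3 y * red y o2 + th o2 o3 y * red y o1 = 0.
  apply: (mulfI x0); rewrite mulr0 -(w0 y) /th /red /wedge.
  rewrite (rC _ _ o1 o0) (rC _ _ o2 o0); field.
  exact: x0.
have thD b c y z : th b c (y + z) = th b c y + th b c z.
  rewrite !(thsum b c) -big_split; apply: eq_bigr => l _ /=; rewrite mxE; ring.
have redD y z b : red (y + z) b = red y b + red z b by rewrite /red !mxE; ring.
have redx b : red x b = 0 by rewrite /red divfK // subrr.
have zz y z : th o1 o2 y * red z o3 - th o1 o3 y * red z o2 + th o2 o3 y * red z o1 +
    (th o1 o2 z * red y o3 - th o1 o3 z * red y o2 + th o2 o3 z * red y o1) = 0.
  pose zf u := th o1 o2 u * red u o3 - th o1 o3 u * red u o2 + th o2 o3 u * red u o1.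
  transitivity (zf (y + z) - zf y - zf z); first by rewrite /zf !thD !redD; ring.
  by rewrite /zf !z0 !subr0.
have r11 : red (D o1) o1 = 1 by rewrite /red !mxE /=; ring.
have r12 : red (D o1) o2 = 0 by rewrite /red !mxE /=; ring.
have r13 : red (D o1) o3 = 0 by rewrite /red !mxE /=; ring.
have r21 : red (D o2) o1 = 0 by rewrite /red !mxE /=; ring.
have r22 : red (D o2) o2 = 1 by rewrite /red !mxE /=; ring.
have r23 : red (D o2) o3 = 0 by rewrite /red !mxE /=; ring.
have r31 : red (D o3) o1 = 0 by rewrite /red !mxE /=; ring.
have r32 : red (D o3) o2 = 0 by rewrite /red !mxE /=; ring.
have r33 : red (D o3) o3 = 1 by rewrite /red !mxE /=; ring.
have redE := (r11, r12, r13, r21, r22, r23, r31, r32, r33).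
have [x12 x13 x23] : [/\ th o1 o2 x = 0, th o1 o3 x = 0 & th o2 o3 x = 0].
  have h1 := zz x (D o1); have h2 := zz x (D o2); have h3 := zz x (D o3).
  rewrite !redx !redE in h1 h2 h3; split.
  - by rewrite -[RHS]h3; ring.
  - by rewrite -[RHS]oppr0 -[X in - X]h2; ring.
  - by rewrite -[RHS]h1; ring.
have E0 b c : th b c x = 0 -> th b c (D o0) =
    - (x 0 o1 / x 0 o0 * th b c (D o1) + x 0 o2 / x 0 o0 * th b c (D o2) +
       x 0 o3 / x 0 o0 * th b c (D o3)).
  rewrite thsum sum4 => e; apply: (mulfI x0); apply/eqP; rewrite -subr_eq0; apply/eqP.
  by rewrite -[RHS]e; field.
have thE b c y : th b c x = 0 -> th b c y = red y o1 * th b c (D o1) +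
    red y o2 * th b c (D o2) + red y o3 * th b c (D o3).
  by move=> e; rewrite thsum sum4 E0 // /red; ring.
have d1 := z0 (D o1); have d2 := z0 (D o2); have d3 := z0 (D o3).
have e12 := zz (D o1) (D o2); have e13 := zz (D o1) (D o3); have e23 := zz (D o2) (D o3).
rewrite !redE in d1 d2 d3 e12 e13 e23.
pose p := th o1 o2 (D o1); pose q := th o1 o2 (D o2); pose s := th o1 o3 (D o1).
have t12_3 : th o1 o2 (D o3) = 0 by rewrite -[RHS]d3; ring.
have t13_2 : th o1 o3 (D o2) = 0 by rewrite -[RHS]oppr0 -[X in - X]d2; ring.
have t23_1 : th o2 o3 (D o1) = 0 by rewrite -[RHS]d1; ring.
have t23_2 : th o2 o3 (D o2) = s.
  by apply/eqP; rewrite -subr_eq0 -[X in _ == X]e12 /s; apply/eqP; ring.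
have t23_3 : th o2 o3 (D o3) = - p.
  by apply/eqP; rewrite -subr_eq0 -[X in _ == X]e13 /p; apply/eqP; ring.
have t13_3 : th o1 o3 (D o3) = q.
  by apply/esym/eqP; rewrite -subr_eq0 -[X in _ == X]e23 /q; apply/eqP; ring.
have t12 y : th o1 o2 y = red y o1 * p + red y o2 * q by rewrite thE // t12_3 /p /q; ring.
have t13 y : th o1 o3 y = red y o1 * s + red y o3 * q.
  by rewrite thE // t13_2 t13_3 /s /q; ring.
have t23 y : th o2 o3 y = red y o2 * s - red y o3 * p by rewrite thE // t23_1 t23_2 t23_3; ring.
have red0 y : red y o0 = 0 by rewrite /red divff // mul1r subrr.
(* The six polarized equations leave three of the nine coefficients free, [p], [q] and [s]; they are
   the coordinates of [a] up to sign. *)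
exists (fun b => nth 0 [:: 0; q; - p; - s] b); split=> // b c y.
have t0 b' : th b' o0 y = 0 by rewrite thC th0 oppr0.
have [->|->|->|->] := ord4P b; have [->|->|->|->] := ord4P c;
  rewrite ?thd ?th0 ?t0 ?(thC o1 o2) ?(thC o1 o3) ?(thC o2 o3) ?t12 ?t13 ?t23 ?red0 /=; ring.
Qed.

(** Modulo [x] and after subtracting [a], the vector [B] becomes [RB], which is parallel to [red y].
    As [Q1] vanishes on [E] but not at [x], [red y] is nonzero on [E], so [RB = g red y] with
    sections [g i] of O(-1). The differences of [RB] are [red y e], so [e] is the coboundary of [g]
    and its point is 0. *)
Lemma tensor_nonvanishing e (B C : 'I_4 -> 'I_4 -> 'rV[k]_4 -> k) T tr :
  trivialization E tr -> cocycle E (-1) e -> serre tr e = x ->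
  (forall b i, section E 0 (chart i) (B b i)) ->
  (forall b c i y, E y -> chart i y -> tensor_value r x y b c =
      B b i y * y 0 c - B c i y * y 0 b + x 0 b * C c i y - x 0 c * C b i y) ->
  (forall (b i j : 'I_4) y, E y -> chart i y -> chart j y ->
      B b j y - B b i y = y 0 b * e i j y - x 0 b * T i j y) -> False.
Proof.
move=> trE he es Bsec tE Bdiff.
have [[hQ1 _] _ [IQ1 _] _] := penc.
have [a [a0 tha]] := reduced_tensor_decomposable.
pose RB b i y := B b i y - x 0 b / x 0 o0 * B o0 i y - a b.
have RBdiff b i j y : E y -> chart i y -> chart j y ->
    RB b j y - RB b i y = red y b * e i j y.
  move=> Ey yi yj.
  have e1 : B b j y = B b i y + y 0 b * e i j y - x 0 b * T i j y.
    by rewrite -[B b j y](subrK (B b i y)) Bdiff //; ring.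
  have e2 : B o0 j y = B o0 i y + y 0 o0 * e i j y - x 0 o0 * T i j y.
    by rewrite -[B o0 j y](subrK (B o0 i y)) Bdiff //; ring.
  by rewrite /RB /red e1 e2; field.
have RBred b c i y : E y -> chart i y -> RB b i y * red y c = RB c i y * red y b.
  move=> Ey yi; apply/eqP; rewrite -subr_eq0.
  have -> : RB b i y * red y c - RB c i y * red y b =
      th b c y - (a b * red y c - a c * red y b).
    by rewrite /th !(tE _ _ i) // /RB /red; field.
  by rewrite tha subrr.
have red_neq0 y : E y -> exists b, red y b != 0.
  move=> Ey; apply: contrapT => h.
  have ey : y = (y 0 o0 / x 0 o0) *: x.
    apply/rowP => b; have : red y b = 0.
      by apply/eqP; apply: contraT => yb; case: h; exists b.
    by move/eqP; rewrite /red subr_eq0 => /eqP ->; rewrite mxE; field.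
  have /eqP := IQ1 y Ey; rewrite {1}ey (meval_scale _ _ hQ1) mulf_eq0 (negPf Qx) orbF.
  rewrite expf_eq0 /= => /eqP c0; have := variety_neq0 irr Ey.
  by rewrite ey c0 scale0r eqxx.
pose g i y := if [pick b | red y b != 0] is Some b then RB b i y / red y b else 0.
have gE b i y : E y -> chart i y -> g i y * red y b = RB b i y.
  move=> Ey yi; rewrite /g; case: pickP => [c yc|h].
    by rewrite mulrAC RBred // mulfK.
  by have [b' yb'] := red_neq0 y Ey; have := h b'; rewrite yb'.
have gsec i : section E (-1) (chart i) (g i).
  apply: section_local => y Ey yi; have [b yb] := red_neq0 y Ey.
  pose s : 'cV[k]_4 := delta_mx b 0 - (x 0 b / x 0 o0) *: delta_mx o0 0.
  have sE z : linform s z = red z b.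
    by rewrite /s -scaleNr linformD linformZ !linform_delta /red mulNr.
  exists 1%N, (lpoly s); split; [exact: lpoly_homog|by rewrite meval_lpoly sE|].
  apply: (@section_ext _ _ _ _ _ (fun z => RB b i z / (lpoly s).@[z 0])).
    move=> z Ez [zi]; rewrite /nonzero_locus meval_lpoly sE => zb.
    by rewrite -(gE b i z) // mulfK.
  have -> : -1 = 0 - 1%N%:Z by [].
  apply: section_div; [exact: lpoly_homog|by move=> z _ []|].
  apply: (@section_sub _ _ _ (chart i)); first by move=> z [].
  apply: sectionB; first by apply: sectionB => //; exact: sectionZ.
  have := sectionZ (a b) (section_form (E := E) (U := chart i) (dhomog1 _ _)).
  by apply: section_ext => z _ _; rewrite meval1 mulr1.
have eg i j y : E y -> chart i y -> chart j y -> e i j y = g j y - g i y.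
  move=> Ey yi yj; have [b yb] := red_neq0 y Ey; apply: (mulfI yb).
  by rewrite -(RBdiff b i j y) // -(gE b i y) // -(gE b j y) //; ring.
case/eqP: x0; rewrite -es mxE; apply/(tr_eq0 trE); first exact: cup_coord_cocycle.
exists (fun i y => y 0 o0 * g i y); split=> [i|i j y Ey yi yj].
  by have := sectionM (@coord_section _ _ E (chart i) o0) (gsec i); rewrite subrr.
by rewrite /cup (eg i j) // mulrBr.
Qed.

End NonzeroScalar.

Section FormulaTheorem.
Variables (k : closedFieldType) (E : set 'rV[k]_4) (Q1 Q2 : {mpoly k[4]}).
Local Notation S := {mpoly k[4]}.
Implicit Types (x y v : 'rV[k]_4) (s t : 'cV[k]_4).
Hypotheses (char0 : [pchar k] =i pred0) (irr : irreducible_variety E)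
  (degE : curve_of_degree E 4) (lc : linearly_complete E) (penc : is_pencil E Q1 Q2).

(* The bracket is [c / 2] times the bivector dual to [dQ1 /\ dQ2]. *)
Theorem FO_formula Pi : FO_bracket E Pi -> exists c (M : 'I_4 -> 'I_4 -> S),
  [/\ c != 0, forall b d, M b d \is 2.-homog /\ M b d = - M d b,
      forall x s t, x != 0 -> x *m s = 0 -> x *m t = 0 ->
        Pi x s t = \sum_b \sum_d s b 0 * t d 0 * (M b d).@[x 0]
    & forall x v, wedge (fun b d => (M b d).@[x 0]) (x 0) (v 0) =
        c * (Q1.@[x 0] * polar Q2 x v - Q2.@[x 0] * polar Q1 x v)].
Proof.
move=> [tr trE PiE].
have [r [rC rPi rE rdata]] := FO_tensor irr degE lc trE PiE.
have [c ec] := wedge_tensor char0 irr lc penc rE.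
pose M b d : S := \sum_l 'X_l * lpoly (r l b d).
have ME b d x : (M b d).@[x 0] = tensor_value r x x b d.
  rewrite /M raddf_sum; apply: eq_bigr => l _ /=.
  by rewrite mevalM mevalXU meval_lpoly.
exists c, M; split.
- apply/eqP => c0; have [[hQ1 _] Qfree _ _] := penc.
  have Q10 : Q1 != 0.
    apply/eqP => Q10; have /Qfree [/eqP] : 1 *: Q1 + 0 *: Q2 = 0.
      by rewrite Q10 scaler0 scale0r addr0.
    by rewrite oner_eq0.
  have X0 : ('X_o0 : S) != 0 by rewrite -msupp_eq0 msuppX.
  have [x] : exists x : 'rV[k]_4, (Q1 * 'X_o0).@[x 0] != 0.
    apply: contrapT => h; have /eqP : Q1 * 'X_o0 = 0.
      by apply: mpoly_eq0P => x; apply/eqP; apply: contraT => hx; case: h; exists x.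
    by rewrite mulf_eq0 (negPf Q10) (negPf X0).
  rewrite mevalM mevalXU mulf_eq0 negb_or => /andP [Qx x0].
  have w0 y : wedge (tensor_value r x y) (x 0) (y 0) = 0 by rewrite ec c0 mul0r.
  have [e [he es] [B [C [Bsec tE [T Bdiff]]]]] := rdata x.
  exact: (tensor_nonvanishing char0 irr penc rC x0 Qx w0 trE he es Bsec tE Bdiff).
- move=> b d; split.
    by apply: rpred_sum => l _; apply: (dhomogM (homogX _ _) (lpoly_homog _)).
  by apply/eqP; rewrite -addr_eq0; apply/eqP/mpoly_eq0P => x;
    rewrite mevalD !ME rC addNr.
- move=> x s t x0 xs xt; rewrite rPi //; apply: eq_bigr => b _; apply: eq_bigr => d _.
  by rewrite ME.
- move=> x v; rewrite -(wedge_tensor_diag penc ec).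
  by apply: wedge_eq => // b d; rewrite ME.
Qed.

End FormulaTheorem.

(** * The Jacobi identity in affine charts *)

Definition others (a : 'I_4) : 'I_4 * 'I_4 * 'I_4 :=
  match val a with
  | 0 => (o1, o2, o3) | 1 => (o0, o2, o3) | 2 => (o0, o1, o3) | _ => (o0, o1, o2)
  end.

Definition det3 (R : pzRingType) (a : 'I_4) (u v w : 'I_4 -> R) : R :=
  let: (b, c, d) := others a in
  u b * (v c * w d - v d * w c) - u c * (v b * w d - v d * w b) +
  u d * (v b * w c - v c * w b).

(* [u . curl v], where [dv e b] is the derivative of [v b] in direction [e]. *)
Definition curl (R : pzRingType) (a : 'I_4) (u : 'I_4 -> R) (dv : 'I_4 -> 'I_4 -> R) : R :=
  let: (b, c, d) := others a in
  u b * (dv c d - dv d c) - u c * (dv b d - dv d b) + u d * (dv b c - dv c b).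

Lemma det3_eq (R : pzRingType) a (u u' v v' w w' : 'I_4 -> R) :
  (forall b, b != a -> u b = u' b) -> (forall b, b != a -> v b = v' b) ->
  (forall b, b != a -> w b = w' b) -> det3 a u v w = det3 a u' v' w'.
Proof.
case: (ord4P a) => -> eu ev ew;
  by rewrite /det3 /= !eu ?ev ?ew.
Qed.

(** [K] is the differential of the bracket [al /\ dF /\ dG]. In the cyclic sum the second
    derivatives cancel by symmetry, leaving [al /\ d al] times the determinant of the three
    differentials. *)
Lemma det3_jacobi (R : comPzRingType) a (al F1 F2 F3 : 'I_4 -> R)
    (da h1 h2 h3 : 'I_4 -> 'I_4 -> R) :
  (forall b c, h1 b c = h1 c b) -> (forall b c, h2 b c = h2 c b) ->
  (forall b c, h3 b c = h3 c b) ->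
  let K F h G g e := det3 a (da e) F G + det3 a al (h e) G + det3 a al F (g e) in
  det3 a al (K F1 h1 F2 h2) F3 + det3 a al (K F2 h2 F3 h3) F1 +
  det3 a al (K F3 h3 F1 h1) F2 = curl a al da * det3 a F1 F2 F3.
Proof.
move=> s1 s2 s3; rewrite /det3 /curl; case: (others a) => -[b c] d /=.
rewrite (s1 c b) (s1 d b) (s1 d c) (s2 c b) (s2 d b) (s2 d c) (s3 c b) (s3 d b) (s3 d c).
ring.
Qed.

(** The general identity [e] has two correction terms, proportional to [s(x)] and [t(x)]. The sign
    comes from moving coordinate [a] to the front. *)
Lemma bivector_det3 (k : comPzRingType) (a : 'I_4) (P : 'I_4 -> 'I_4 -> k) (x s t : 'I_4 -> k) :
  (forall b d, P b d = - P d b) -> (forall b, P b b = 0) ->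
  \sum_b s b * x b = 0 -> \sum_b t b * x b = 0 ->
  x a * (\sum_b \sum_d s b * t d * P b d) =
  (-1) ^+ a * det3 a (fun b => wedge P x (fun c => (c == b)%:R)) s t.
Proof.
move=> PC P0 xs xt.
have e : x a * (\sum_b \sum_d s b * t d * P b d) =
  (-1) ^+ a * det3 a (fun b => wedge P x (fun c => (c == b)%:R)) s t +
  (\sum_b s b * x b) * (\sum_d t d * P a d) + (\sum_b t b * x b) * (\sum_d s d * P d a).
  rewrite !sum4 !P0 (PC o1 o0) (PC o2 o0) (PC o3 o0) (PC o2 o1) (PC o3 o1) (PC o3 o2).
  have [->|->|->|->] := ord4P a; rewrite /det3 /wedge /= ?P0
    ?(PC o1 o0) ?(PC o2 o0) ?(PC o3 o0) ?(PC o2 o1) ?(PC o3 o1) ?(PC o3 o2); ring.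
by rewrite e xs xt; ring.
Qed.

Section ChartRestriction.
Variables (k : closedFieldType) (n : nat) (a : 'I_n.+1).
Local Notation S := {mpoly k[n.+1]}.

Lemma vanish_on_chart_slice (F : S) :
  (forall y : 'rV[k]_n.+1, y 0 a = 1 -> F.@[y 0] = 0) -> exists G, F = ('X_a - 1) * G.
Proof.
move=> F0; pose sub (H : S) : S := H \mPo [tuple if i == a then 1 else 'X_i | i < n.+1].
pose T H := exists G, H = sub H + ('X_a - 1) * G.
have TD H K : T H -> T K -> T (H + K).
  move=> [G eH] [G' eK]; exists (G + G').
  by rewrite {1}eH {1}eK /sub rmorphD /=; ring.
have TM H K : T H -> T K -> T (H * K).
  move=> [G eH] [G' eK]; exists (sub H * G' + G * sub K + ('X_a - 1) * G * G').
  by rewrite {1}eH {1}eK /sub rmorphM /=; ring.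
have TC c : T c%:MP by exists 0; rewrite mulr0 addr0 /sub comp_mpolyC.
have T1 : T 1 by rewrite -mpolyC1; exact: TC.
have TX i : T 'X_i.
  have -> : T 'X_i = exists G, 'X_i = (if i == a then 1 else 'X_i) + ('X_a - 1) * G :> S.
    by rewrite /T /sub comp_mpolyXU -tnth_nth tnth_mktuple.
  by case: eqP => [->|_]; [exists 1|exists 0]; ring.
have [G eF] : T F.
  elim/mpolyind: F {F0} => [|c m p _ _ Tp].
    by rewrite -[0]/(mpolyC n.+1 0); exact: TC.
  apply: TD => //; rewrite -mul_mpolyC; apply: (TM); first exact: TC.
  rewrite mpolyXE_id; apply: (big_ind T T1 TM) => i _.
  by elim: (m i) => [|j IH]; rewrite ?expr0 // exprS; apply: (TM).
exists G; rewrite {1}eF (_ : sub F = 0) ?add0r //; apply: mpoly_eq0P => y.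
rewrite comp_mpoly_meval -(F0 (\row_i if i == a then 1 else y 0 i)); last first.
  by rewrite mxE eqxx.
apply: meval_eq => i; rewrite tnth_mktuple mxE.
by case: eqP => _; rewrite ?meval1 ?mevalXU.
Qed.

(** [chart_bracket] fixes its last polynomial only where [y_a = 1]. Two choices differ by a multiple
    of [X_a - 1], whose derivatives in the other directions are zero. *)
Lemma deriv_on_chart_slice (F G : S) (y : 'rV[k]_n.+1) b :
  (forall z : 'rV[k]_n.+1, z 0 a = 1 -> F.@[z 0] = G.@[z 0]) -> y 0 a = 1 -> b != a ->
  (F^`M(b)).@[y 0] = (G^`M(b)).@[y 0].
Proof.
move=> FG ya ba; have [|H eH] := @vanish_on_chart_slice (F - G).
  by move=> z za; rewrite mevalB FG // subrr.
have X0 : ('X_a - 1 : S)^`M(b) = 0.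
  rewrite mderivB -lpoly_delta mderiv_lpoly mxE (negPf ba) /= mpolyC0 sub0r.
  by rewrite -mpolyC1 mderivC oppr0.
apply/eqP; rewrite -subr_eq0 -mevalB -mderivB eH mderivM X0 mul0r add0r.
by rewrite mevalM mevalB mevalXU meval1 ya subrr mul0r.
Qed.

End ChartRestriction.

Section PoissonCriterion.
Variable k : closedFieldType.
Local Notation S := {mpoly k[4]}.
Implicit Types (x y v : 'rV[k]_4) (s t : 'cV[k]_4) (F G H : S) (a : 'I_4).

(* [Pi] is a quadratic bivector [M] on V, taken modulo the Euler field, whose
   contraction with the volume form and the Euler field is [al]. *)
Definition represents (Pi : bivector_values k 3) (M : 'I_4 -> 'I_4 -> S) (al : 'I_4 -> S) :=
  [/\ forall b d, [/\ M b d \is 2.-homog, M b d = - M d b & M b b = 0],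
      forall x s t, x != 0 -> x *m s = 0 -> x *m t = 0 ->
        Pi x s t = \sum_b \sum_d s b 0 * t d 0 * (M b d).@[x 0]
    & forall x b, wedge (fun b d => (M b d).@[x 0]) (x 0) (fun c => (c == b)%:R) =
        (al b).@[x 0]].

Lemma chart_neq0 a x : chart a x -> x != 0.
Proof. by apply: contraTneq => ->; rewrite /chart /= mxE eqxx. Qed.

Lemma dchart_annihilates a F x : chart a x -> x *m dchart a F x = 0.
Proof.
move=> xa; rewrite /dchart -scalemxAr mulmxBr (mulmxA x (delta_mx a 0)).
have -> : x *m delta_mx a 0 = (x 0 a)%:M :> 'M_1.
  by apply/matrixP => i j; rewrite !ord1 -/(linform _ _) linform_delta mxE eqxx mulr1n.
by rewrite mul_scalar_mx scalemxAl scalerA divff // scale1r subrr scaler0.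
Qed.

Lemma dehomog_chart a x : chart a x -> (dehomog a x) 0 a = 1.
Proof. by move=> xa; rewrite /dehomog mxE mulVf. Qed.

Lemma mderiv_det3 a (u v w : 'I_4 -> S) e : (det3 a u v w)^`M(e) =
  det3 a (fun b => (u b)^`M(e)) v w + det3 a u (fun b => (v b)^`M(e)) w +
  det3 a u v (fun b => (w b)^`M(e)).
Proof.
rewrite /det3; case: (others a) => -[b c] d.
rewrite !(mderivD, mderivN, mderivM); ring.
Qed.

Lemma meval_det3 a (u v w : 'I_4 -> S) y : (det3 a u v w).@[y 0] =
  det3 a (fun b => (u b).@[y 0]) (fun b => (v b).@[y 0]) (fun b => (w b).@[y 0]).
Proof.
by rewrite /det3; case: (others a) => -[b c] d; rewrite !(mevalD, mevalN, mevalM).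
Qed.

Definition chart_poly a (al : 'I_4 -> S) F G : S :=
  (-1) ^+ a *: det3 a al (fun b => F^`M(b)) (fun b => G^`M(b)).

Variables (Pi : bivector_values k 3) (M : 'I_4 -> 'I_4 -> S) (al : 'I_4 -> S).
Hypothesis rep : represents Pi M al.

Lemma chart_bracketP a F G : chart_bracket Pi a F G (chart_poly a al F G).
Proof.
have [hM PiE alE] := rep.
move=> x xa; have x0 := chart_neq0 xa; set y := dehomog a x.
have ya : y 0 a = 1 := dehomog_chart xa.
have yx : x = x 0 a *: y by rewrite /y /dehomog scalerA divff // scale1r.
pose dl F' b : k := (grad F' y - delta_mx a 0 *m (y *m grad F' y)) b 0.
have dlE F' b : b != a -> dl F' b = (F'^`M(b)).@[y 0].
  move=> /negPf ba; rewrite /dl !mxE big_ord1 !mxE ba mul0r subr0 //.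
have dly F' : \sum_b dl F' b * y 0 b = 0.
  have : y *m (grad F' y - delta_mx a 0 *m (y *m grad F' y)) = 0.
    by rewrite {1}/y /dehomog -scalemxAl scalemxAr; exact: dchart_annihilates.
  move/(congr1 (fun N : 'M_1 => N 0 0)); rewrite mxE [RHS]mxE => e.
  by rewrite -[RHS]e; apply: eq_bigr => b _; rewrite mulrC.
rewrite PiE ?dchart_annihilates //.
have -> : \sum_b \sum_d (dchart a F x) b 0 * (dchart a G x) d 0 * (M b d).@[x 0] =
    \sum_b \sum_d dl F b * dl G d * (M b d).@[y 0].
  apply: eq_bigr => b _; apply: eq_bigr => d _; rewrite /dchart -/y.
  have [hMbd _ _] := hM b d.
  have -> : (M b d).@[x 0] = x 0 a ^+ 2 * (M b d).@[y 0].
    by rewrite -(meval_scale _ _ hMbd) -yx.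
  by rewrite /dl !mxE; field; exact: xa.
rewrite -[LHS]mul1r -{1}ya (bivector_det3 a (x := y 0)) //.
- rewrite /chart_poly mevalZ meval_det3; congr (_ * _).
  by apply: det3_eq => b ba; rewrite ?alE ?dlE.
- by move=> b d; have [_ {1}-> _] := hM b d; rewrite mevalN.
- by move=> b; have [_ _ ->] := hM b b; rewrite meval0.
Qed.

Lemma represents_bivector : bivector Pi.
Proof.
have [hM PiE _] := rep; split.
- move=> x b s t u x0 xs xt xu; split.
    rewrite !PiE //; last by rewrite mulmxDr -scalemxAr xs xt scaler0 addr0.
    rewrite mulr_sumr -big_split; apply: eq_bigr => c _ /=.
    rewrite mulr_sumr -big_split; apply: eq_bigr => d _ /=.
    by rewrite !mxE; ring.
  rewrite !PiE // exchange_big -sumrN; apply: eq_bigr => d _ /=.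
  rewrite -sumrN; apply: eq_bigr => c _.
  by have [_ -> _] := hM c d; rewrite mevalN; ring.
- move=> x b s t x0 b0 xs xt; rewrite !PiE ?scaler_eq0 ?negb_or ?b0 //;
    try by rewrite -scalemxAl ?xs ?xt scaler0.
  rewrite mulr_sumr; apply: eq_bigr => c _; rewrite mulr_sumr; apply: eq_bigr => d _.
  by have [h _ _] := hM c d; rewrite (meval_scale _ _ h); ring.
- by move=> a F G; exists (chart_poly a al F G); exact: chart_bracketP.
Qed.

Lemma chart_value a F G x : chart a x -> Pi x (dchart a F x) (dchart a G x) =
  (chart_poly a al F G).@[(dehomog a x) 0].
Proof. exact: chart_bracketP. Qed.

Definition curl_value a (y : 'rV[k]_4) : k :=
  curl a (fun b => (al b).@[y 0]) (fun e b => ((al b)^`M(e)).@[y 0]).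

Lemma jacobiator a F1 F2 F3 H12 H23 H31 x :
  chart_bracket Pi a F1 F2 H12 -> chart_bracket Pi a F2 F3 H23 ->
  chart_bracket Pi a F3 F1 H31 -> chart a x ->
  Pi x (dchart a H12 x) (dchart a F3 x) + Pi x (dchart a H23 x) (dchart a F1 x) +
  Pi x (dchart a H31 x) (dchart a F2 x) = curl_value a (dehomog a x) *
    det3 a (fun b => (F1^`M(b)).@[(dehomog a x) 0]) (fun b => (F2^`M(b)).@[(dehomog a x) 0])
      (fun b => (F3^`M(b)).@[(dehomog a x) 0]).
Proof.
move=> h12 h23 h31 xa; rewrite !chart_value //; set y := dehomog a x.
have ya : y 0 a = 1 := dehomog_chart xa.
have sl F G H : chart_bracket Pi a F G H -> forall z : 'rV[k]_4, z 0 a = 1 ->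
    H.@[z 0] = (chart_poly a al F G).@[z 0].
  move=> hH z za; have zc : chart a z by rewrite /chart /= za oner_eq0.
  have zE : dehomog a z = z by rewrite /dehomog za invr1 scale1r.
  by have := hH z zc; rewrite chart_value // zE.
have dH F G H b : chart_bracket Pi a F G H -> b != a -> (H^`M(b)).@[y 0] =
    ((chart_poly a al F G)^`M(b)).@[y 0].
  by move=> /sl hH ba; apply: (deriv_on_chart_slice hH).
have sgn2 : (-1) ^+ a * (-1) ^+ a = 1 :> k by rewrite -exprD addnn -mul2n exprM sqrrN !expr1n.
pose K F G e := det3 a (fun b => ((al b)^`M(e)).@[y 0])
    (fun b => (F^`M(b)).@[y 0]) (fun b => (G^`M(b)).@[y 0]) +
  det3 a (fun b => (al b).@[y 0]) (fun b => (F^`M(b)^`M(e)).@[y 0])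
    (fun b => (G^`M(b)).@[y 0]) +
  det3 a (fun b => (al b).@[y 0]) (fun b => (F^`M(b)).@[y 0])
    (fun b => (G^`M(b)^`M(e)).@[y 0]).
have step F G H F' : chart_bracket Pi a F G H -> (chart_poly a al H F').@[y 0] =
    det3 a (fun b => (al b).@[y 0]) (K F G) (fun b => (F'^`M(b)).@[y 0]).
  move=> hH; rewrite mevalZ meval_det3.
  rewrite (@det3_eq _ a _ (fun b => (al b).@[y 0]) _ (fun b => (-1) ^+ a * K F G b)
     _ (fun b => (F'^`M(b)).@[y 0])) //; last first.
    move=> b ba; rewrite (dH _ _ _ _ hH ba) mderivZ mevalZ mderiv_det3 !mevalD !meval_det3.
    by [].
  rewrite -[RHS]mul1r; move: ((-1) ^+ a) sgn2 => sg <-.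
  by rewrite /det3; case: (others a) => -[b c] d; ring.
rewrite (step _ _ _ _ h12) (step _ _ _ _ h23) (step _ _ _ _ h31).
rewrite /curl_value -(@det3_jacobi _ a _ _ _ _ _
  (fun e b => (F1^`M(b)^`M(e)).@[y 0]) (fun e b => (F2^`M(b)^`M(e)).@[y 0])
  (fun e b => (F3^`M(b)^`M(e)).@[y 0])) // => b c; by rewrite mderiv_comm.
Qed.

Theorem poisson_iff_curl : Poisson_bivector Pi <->
  forall a y, y 0 a = 1 -> curl_value a y = 0.
Proof.
split=> [[_ jac] a y ya|c0]; last first.
  split; first exact: represents_bivector.
  move=> a F1 F2 F3 H12 H23 H31 h12 h23 h31 x xa.
  by rewrite (jacobiator h12 h23 h31 xa) c0 ?mul0r // dehomog_chart.
have yc : chart a y by rewrite /chart /= ya oner_eq0.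
have yE : dehomog a y = y by rewrite /dehomog ya invr1 scale1r.
(* For the three affine coordinates the determinant of differentials is 1, so the Jacobiator is the
   curl itself. *)
pose F b : S := 'X_b.
have := jac a (F (others a).1.1) (F (others a).1.2) (F (others a).2) _ _ _
  (@chart_bracketP a _ _) (@chart_bracketP a _ _) (@chart_bracketP a _ _) y yc.
rewrite (jacobiator (@chart_bracketP a _ _) (@chart_bracketP a _ _)
  (@chart_bracketP a _ _) yc) yE => /eqP.
have dX i j : (('X_i : S)^`M(j)).@[y 0] = (j == i)%:R.
  by rewrite -lpoly_delta mderiv_lpoly mevalC mxE eqxx andbT.
rewrite mulf_eq0 => /orP [/eqP //|].
rewrite /F /det3; have [->|->|->|->] := ord4P a; rewrite /= !dX /=;
  by rewrite !(mulr0, mulr1, subr0, addr0, mul0r, oner_eq0).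
Qed.

End PoissonCriterion.

(** * Pencils whose brackets commute *)

Lemma det3_minors (R : comPzRingType) a (u w : 'I_4 -> R) :
  (forall b, det3 a (fun c => (c == b)%:R) u w = 0) ->
  forall b c, b != a -> c != a -> u b * w c = u c * w b.
Proof.
move=> h; have := h o0; have := h o1; have := h o2; have := h o3; rewrite /det3.
case: (ord4P a) => -> /=;
  rewrite !(mul0r, mul1r, subr0, sub0r, add0r, addr0, oppr0) => e3 e2 e1 e0 b c;
  case: (ord4P b) => ->; case: (ord4P c) => -> // _ _;
  try (move: e0; move/eqP; rewrite ?oppr_eq0 subr_eq0 => /eqP e0);
  try (move: e1; move/eqP; rewrite ?oppr_eq0 subr_eq0 => /eqP e1);
  try (move: e2; move/eqP; rewrite ?oppr_eq0 subr_eq0 => /eqP e2);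
  try (move: e3; move/eqP; rewrite ?oppr_eq0 subr_eq0 => /eqP e3);
  first [exact: e0|exact: e1|exact: e2|exact: e3|exact: esym e0|exact: esym e1
    |exact: esym e2|exact: esym e3].
Qed.

Section MixedJacobian.
Variable k : closedFieldType.
Local Notation S := {mpoly k[4]}.
Implicit Types (Q R F G H : S) (x y v : 'rV[k]_4) (a b : 'I_4).

Definition jac a F Q1 Q2 : S :=
  det3 a (fun b => F^`M(b)) (fun b => Q1^`M(b)) (fun b => Q2^`M(b)).

(* [(Q1 dQ2 - Q2 dQ1) /\ dR1 /\ dR2] in the chart [a]. *)
Definition mixed a Q1 Q2 R1 R2 : S := Q1 * jac a Q2 R1 R2 - Q2 * jac a Q1 R1 R2.

Lemma meval_mixed a Q1 Q2 R1 R2 y : (mixed a Q1 Q2 R1 R2).@[y 0] =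
  Q1.@[y 0] * (jac a Q2 R1 R2).@[y 0] - Q2.@[y 0] * (jac a Q1 R1 R2).@[y 0].
Proof.
by rewrite /mixed; move: (jac _ _ _ _) (jac _ _ _ _) => F G; rewrite mevalB !mevalM.
Qed.

Lemma meval_mixed_eq0 a Q1 Q2 R1 R2 y : Q1.@[y 0] = 0 -> Q2.@[y 0] = 0 ->
  (mixed a Q1 Q2 R1 R2).@[y 0] = 0.
Proof.
rewrite /mixed; move: (jac _ _ _ _) (jac _ _ _ _) => F G q1 q2.
by rewrite mevalB !mevalM q1 q2 !mul0r subrr.
Qed.

(** Substituting for [Q1] reduces both summands to [(p R1 + q R2) dQ2 /\ dR1 /\ dR2], with opposite
    signs. *)
Lemma mixed_dependent1 a Q1 Q2 R1 R2 p q r : Q1 = p *: R1 + q *: R2 + r *: Q2 ->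
  mixed a Q1 Q2 R1 R2 + mixed a R1 R2 Q1 Q2 = 0.
Proof.
move=> ->; rewrite /mixed /jac /det3; case: (others a) => -[b c] d.
by rewrite !(mderivD, mderivZ) -!mul_mpolyC; ring.
Qed.

Lemma mixed_dependent a Q1 Q2 R1 R2 (u1 u2 v1 v2 : k) : u1 != 0 \/ u2 != 0 ->
  u1 *: Q1 + u2 *: Q2 = v1 *: R1 + v2 *: R2 ->
  mixed a Q1 Q2 R1 R2 + mixed a R1 R2 Q1 Q2 = 0.
Proof.
have solve (w1 w2 : k) (A B C : S) : w1 != 0 -> w1 *: A + w2 *: B = C ->
    A = w1^-1 *: C + (- (w1^-1 * w2)) *: B.
  by move=> w0 <-; rewrite scalerDr !scalerA mulVf // scale1r scaleNr addrK.
case=> u0 e.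
  have := solve _ _ _ _ _ u0 e; rewrite scalerDr !scalerA; exact: mixed_dependent1.
rewrite addrC in e; have := solve _ _ _ _ _ u0 e; rewrite scalerDr !scalerA.
move/(mixed_dependent1 a) => h; apply/eqP; rewrite -oppr_eq0 -[X in _ == X]h; apply/eqP.
rewrite /mixed /jac /det3; case: (others a) => -[b c] d; ring.
Qed.

Definition pencil_form (l : k) Q1 Q2 b : S := l *: (Q1 * Q2^`M(b) - Q2 * Q1^`M(b)).

(** The 2 comes from [d(R1 dR2 - R2 dR1) = 2 dR1 /\ dR2], where the second derivatives cancel. *)
Lemma curl_pencil_form a l m Q1 Q2 R1 R2 y :
  curl a (fun b => (pencil_form l Q1 Q2 b).@[y 0])
    (fun e b => ((pencil_form m R1 R2 b)^`M(e)).@[y 0]) =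
  2%:R * (l * m) * (mixed a Q1 Q2 R1 R2).@[y 0].
Proof.
have dv e f : ((pencil_form m R1 R2 f)^`M(e)).@[y 0] - ((pencil_form m R1 R2 e)^`M(f)).@[y 0] =
    2%:R * m * ((R1^`M(e)).@[y 0] * (R2^`M(f)).@[y 0] - (R1^`M(f)).@[y 0] * (R2^`M(e)).@[y 0]).
  rewrite -mevalB /pencil_form !mderivZ -scalerBr !mderivB !mderivM.
  rewrite (mderiv_comm f e R1) (mderiv_comm f e R2) mevalZ.
  set A := R1^`M(e); set B := R1^`M(f); set C := R2^`M(e); set D := R2^`M(f).
  set X := R2^`M(_)^`M(_); set Y := R1^`M(_)^`M(_).
  have -> : A * D + R1 * X - (C * B + R2 * Y) - (B * C + R1 * X - (D * A + R2 * Y)) =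
    2%:R * (A * D - B * C) by ring.
  rewrite mulr_natl mevalMn mevalB !mevalM; ring.
have ev (A B C D : S) : (A * B - C * D).@[y 0] = A.@[y 0] * B.@[y 0] - C.@[y 0] * D.@[y 0].
  by rewrite mevalB !mevalM.
have -> : (mixed a Q1 Q2 R1 R2).@[y 0] =
    Q1.@[y 0] * det3 a (fun b => (Q2^`M(b)).@[y 0]) (fun b => (R1^`M(b)).@[y 0])
      (fun b => (R2^`M(b)).@[y 0]) -
    Q2.@[y 0] * det3 a (fun b => (Q1^`M(b)).@[y 0]) (fun b => (R1^`M(b)).@[y 0])
      (fun b => (R2^`M(b)).@[y 0]).
  by rewrite meval_mixed; congr (_ * _ - _ * _); exact: meval_det3.
rewrite /curl /det3.
case: (others a) => -[b c] d; rewrite !dv /pencil_form !mevalZ !ev.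
set q1 := Q1.@[_]; set q2 := Q2.@[_].
ring.
Qed.

End MixedJacobian.

Lemma mderiv_homog (k : fieldType) n d (F : {mpoly k[n]}) i :
  F \is d.+1.-homog -> F^`M(i) \is d.-homog.
Proof.
move=> /dhomogP hF; apply/dhomogP => m; rewrite mcoeff_msupp mcoeff_deriv => Fm.
have : (m + U_(i))%MM \in msupp F.
  by rewrite mcoeff_msupp; apply: contraNneq Fm => ->; rewrite mul0rn.
move/hF => h; have : mdeg (m + U_(i))%MM = d.+1 := h.
by rewrite mdegD mdeg1 addn1 => -[].
Qed.

(** * The derivation along the curve defined by a pencil *)

Section JacobianDerivation.
Variables (k : closedFieldType) (a : 'I_4) (Q1 Q2 : {mpoly k[4]}).
Local Notation S := {mpoly k[4]}.
Implicit Types (F G H R : S).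
Local Notation D F := (jac a F Q1 Q2).

Lemma jac_is_linear c F G : D (c *: F + G) = c *: D F + D G.
Proof.
rewrite /jac /det3; case: (others a) => -[b d] e.
by rewrite !linearP /= -!mul_mpolyC; ring.
Qed.

Lemma jacM F G : D (F * G) = F * D G + G * D F.
Proof.
rewrite /jac /det3; case: (others a) => -[b d] e; rewrite !mderivM; ring.
Qed.

Lemma jac_homog d F : Q1 \is 2.-homog -> Q2 \is 2.-homog -> F \is d.-homog ->
  D F \is d.+1.-homog.
Proof.
move=> hQ1 hQ2; case: d => [|d] hF.
  have [c ->] := homog0_const hF; rewrite /jac /det3; case: (others a) => -[b e] f.
  by rewrite !mderivC !mul0r !subr0 addr0 dhomog0.
have h b e f : F^`M(b) * (Q1^`M(e) * Q2^`M(f) - Q1^`M(f) * Q2^`M(e)) \is d.+2.-homog.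
  have -> : d.+2 = (d + (1 + 1))%N by rewrite addnA !addn1.
  apply: dhomogM; first exact: mderiv_homog.
  by apply: rpredB; apply: dhomogM; exact: mderiv_homog.
rewrite /jac /det3; case: (others a) => -[b e] f.
by do ![exact: h | apply: rpredB | apply: rpredD].
Qed.

Lemma jac_pencil H1 H2 : D (H1 * Q1 + H2 * Q2) = Q1 * D H1 + Q2 * D H2.
Proof.
rewrite /jac /det3; case: (others a) => -[b d] e; rewrite !mderivD !mderivM; ring.
Qed.

Lemma jac_chart : D 'X_a = 0.
Proof.
have dX j : ('X_a : S)^`M(j) = ((j == a)%:R)%:MP.
  by rewrite -lpoly_delta mderiv_lpoly mxE eqxx andbT.
rewrite /jac (@det3_eq _ a _ (fun _ => 0) _ (fun b => Q1^`M(b)) _ (fun b => Q2^`M(b))) //.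
  by rewrite /det3; case: (others a) => -[b' e] f'; rewrite !mul0r subr0 addr0.
by move=> j /negPf ja; rewrite dX ja mpolyC0.
Qed.

End JacobianDerivation.

(** * Forms with all derivatives zero at a point of the curve *)

Section Jets.
Variables (k : closedFieldType) (E : set 'rV[k]_4).
Local Notation S := {mpoly k[4]}.
Local Notation I := (vanishing E).
Hypotheses (char0 : [pchar k] =i pred0) (irr : irreducible_variety E)
  (degE : curve_of_degree E 4).
Implicit Types (F G H R : S) (x y v : 'rV[k]_4) (a b : 'I_4).

Lemma variety_scale c x : c != 0 -> E x -> E (c *: x).
Proof.
move=> c0; case: irr => -[T Thom eE] _ _; rewrite eE => /zerosP [x0 Tx]; apply/zerosP.
split; first by rewrite scaler_eq0 negb_or c0.
by move=> F TF; have [q hF] := Thom F TF; rewrite (meval_scale _ _ hF) Tx // mulr0.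
Qed.

Variable D : S -> S.
Hypotheses (D_linear : forall c F G, D (c *: F + G) = c *: D F + D G)
  (DM : forall F G, D (F * G) = F * D G + G * D F)
  (D_homog : forall d F, F \is d.-homog -> D F \is d.+1.-homog)
  (D_vanishing : forall d F, F \is d.-homog -> I F -> I (D F)).

Let jet n F := iter n D F.

Lemma jet_linear n c F G : jet n (c *: F + G) = c *: jet n F + jet n G.
Proof. by elim: n => [//|n IH]; rewrite /jet !iterS -/(jet n _) IH D_linear. Qed.

Lemma jet_homog n d F : F \is d.-homog -> jet n F \is (d + n).-homog.
Proof.
by move=> hF; elim: n => [|n IH]; rewrite ?addn0 // addnS; exact: D_homog.
Qed.

Lemma jet_vanishing n d F : F \is d.-homog -> I F -> I (jet n F).
Proof.
move=> hF IF; elim: n => [//|n IH]; exact: D_vanishing (jet_homog n hF) IH.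
Qed.

Lemma derivation1 : D 1 = 0.
Proof.
by have := DM 1 1; rewrite !mul1r -[X in X = _]addr0 => /addrI.
Qed.

Lemma derivation_expS R n : D (R ^+ n.+1) = n.+1%:R * R ^+ n * D R.
Proof.
elim: n => [|n IH]; first by rewrite expr0 expr1; ring.
by rewrite exprS DM IH -[n.+2%:R]natr1 exprS; ring.
Qed.

Lemma derivation_exp R n : R * D (R ^+ n) = n%:R * R ^+ n * D R.
Proof.
case: n => [|n]; first by rewrite expr0 derivation1; ring.
by rewrite derivation_expS exprS; ring.
Qed.

(** By hypothesis the derivative of [f / R] is zero on [E]. Applying [D] repeatedly shows that, up
    to powers of [R], every derivative of [f] is a multiple of [f] on [E], hence vanishes where [f]
    does and [R] does not. *)
Lemma jet_quotient f R : f \is 2.-homog -> R \is 2.-homog -> I (D f * R - f * D R) ->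
  forall n, exists2 A, A \is (3 * n).-homog & I (R ^+ n * jet n f - A * f).
Proof.
move=> hf hR IW; elim=> [|n [A hA IA]].
  exists 1; first exact: dhomog1.
  by rewrite expr0 subrr; case: (vanishing_closed E).
exists (A * D R - n%:R * D R * A + R * D A).
  rewrite mulnS addnC; apply: rpredD.
    apply: rpredB; first by apply: dhomogM => //; exact: D_homog.
    rewrite -mulrA mulr_natl; apply: rpredMn; rewrite mulrC.
    by apply: dhomogM => //; exact: D_homog.
  by rewrite -addSnnS addnC; apply: dhomogM => //; exact: D_homog.
pose Z := R ^+ n * jet n f - A * f.
have hZ : Z \is (2 * n + (2 + n)).-homog.
  apply: rpredB; first by apply: dhomogM; [exact: dhomogMn|exact: jet_homog].
  have -> : (2 * n + (2 + n) = 3 * n + 2)%N by lia.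
  exact: dhomogM.
have DZ : D Z = R ^+ n * jet n.+1 f + jet n f * D (R ^+ n) - (A * D f + f * D A).
  rewrite /Z -[R ^+ n * _]scale1r -scaleN1r addrC D_linear scaleN1r scale1r !DM.
  by rewrite addrC.
have -> : R ^+ n.+1 * jet n.+1 f - (A * D R - n%:R * D R * A + R * D A) * f =
    R * D Z - n%:R * D R * Z + A * (D f * R - f * D R).
  have e : R * D Z = R ^+ n.+1 * jet n.+1 f + jet n f * (R * D (R ^+ n)) -
      R * (A * D f + f * D A) by rewrite DZ exprS; ring.
  by rewrite e derivation_exp /Z; ring.
apply: (lin_closedD (vanishing_closed E)); last exact: vanishingM.
apply: (lin_closedB (vanishing_closed E)); apply: vanishingM => //.
exact: D_vanishing hZ IA.
Qed.

Variables (a : 'I_4) (p : 'rV[k]_4).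
Hypotheses (DXa : D 'X_a = 0) (Ep : E p) (pa : p 0 a != 0).

Lemma jets_mul F H : (forall n, (jet n F).@[p 0] = 0) ->
  forall n, (jet n (F * H)).@[p 0] = 0.
Proof.
move=> F0 n; elim: n F H F0 => [|n IH] F H F0; first by rewrite /= mevalM (F0 0%N) mul0r.
rewrite /jet iterSr DM -[F * D H]scale1r -/(jet n _) jet_linear mevalD mevalZ.
rewrite IH // mulr0 add0r mulrC IH // => m.
by have := F0 m.+1; rewrite /jet iterSr.
Qed.

(** Each application of [D] lowers the order of vanishing along [l] by one, and the successive
    exponents multiply to [n!]. *)
Lemma jets_power l n m H : l.@[p 0] = 0 -> (jet n (l ^+ (n + m) * H)).@[p 0] =
  if m is 0 then n`!%:R * (D l).@[p 0] ^+ n * H.@[p 0] else 0.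
Proof.
move=> l0; elim: n H => [|n IH] H.
  rewrite /= add0n mevalM rmorphXn /= l0; case: m => [|m]; first by rewrite !expr0 !mul1r.
  by rewrite exprS !mul0r.
have e : D (l ^+ (n.+1 + m) * H) = l ^+ (n + m) * ((n + m).+1%:R * D l * H + l * D H).
  by rewrite addSn DM derivation_expS exprS; ring.
rewrite /jet iterSr e -/(jet n _) IH; clear IH e; case: m => [|//].
rewrite addn0 mevalD !mevalM l0 mul0r addr0 factS natrM exprS.
have -> : (n.+1%:R : S).@[p 0] = n.+1%:R by rewrite -mpolyC_nat mevalC.
ring.
Qed.

Hypothesis pcof : exists b, (D 'X_b).@[p 0] != 0.

(** Derivatives of order 0 to 8 at [p] are 9 functionals that kill the vanishing ideal and the
    multiples of [f]. If [f] were not zero on [E], at most [4 * 2] could be independent.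
    Characteristic 0 keeps the factorials nonzero. *)
Lemma jets_vanish f : f \is 2.-homog -> (forall n, (jet n f).@[p 0] = 0) -> I f.
Proof.
move=> hf f0; apply: contrapT => nIf.
have [b Xb] := pcof; pose c := p 0 b / p 0 a.
pose l : S := 'X_b - c *: 'X_a.
have hl : l \is 1.-homog by rewrite rpredB ?rpredZ ?homogX.
have l0 : l.@[p 0] = 0 by rewrite mevalB mevalZ !mevalXU divfK // subrr.
have Dl0 : (D l).@[p 0] != 0.
  by rewrite /l addrC -scaleNr D_linear DXa scaler0 add0r.
have [m1 bound] := functional_bound irr degE hf nIf.
pose m := (m1 + 9)%N.
(* [l] has a simple zero at [p] along [D], and ['X_a] is a constant of [D] that pads the degree.
   Exponents run downwards, so the derivative of order [8 - j] kills the higher powers [l ^ (8 - i)]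
   with [i < j]. *)
pose F (i : 'I_9) : S := l ^+ (8 - i) * 'X_a ^+ (m - (8 - i)).
have hF i : F i \is m.-homog.
  have -> : m = (8 - i + (m - (8 - i)))%N by rewrite /m; lia.
  by apply: dhomogM; apply: homogXn => //; exact: homogX.
suff : (9 <= 4 * 2)%N by [].
apply: (bound m 9 F (fun j u => (jet (8 - j) u).@[p 0])) => //.
- by rewrite /m; lia.
- by move=> j c' u v'; rewrite jet_linear mevalD mevalZ.
- by move=> j u Iu hu; exact: (jet_vanishing (8 - j) hu Iu).
- by move=> j H _; exact: jets_mul.
- move=> i j ij; rewrite /F (_ : 8 - i = (8 - j) + (j - i).-1.+1)%N ?jets_power //.
  by have := ltn_ord j; lia.
- move=> i; rewrite /F -{2}[(8 - i)%N]addn0 jets_power // rmorphXn /= mevalXU.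
  rewrite !mulf_neq0 ?expf_neq0 //.
  by rewrite (pcharf0P k).1 // -lt0n fact_gt0.
Qed.

End Jets.

Section TangentPencils.
Variables (k : closedFieldType) (E : set 'rV[k]_4) (Q1 Q2 R1 R2 : {mpoly k[4]}).
Local Notation S := {mpoly k[4]}.
Local Notation I := (vanishing E).
Hypotheses (char0 : [pchar k] =i pred0) (irr : irreducible_variety E)
  (degE : curve_of_degree E 4) (smE : smooth_curve E) (penc : is_pencil E Q1 Q2).
Implicit Types (F G H : S) (x y : 'rV[k]_4) (a b : 'I_4).
Hypotheses (hR1 : R1 \is 2.-homog) (hR2 : R2 \is 2.-homog).

(** If all these minors vanished, the gradients without their entry [a] would be dependent. Euler's
    relation at [p], where [p_a] is nonzero, extends the dependence to entry [a], against
    [pencil_grad_free]. *)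
Lemma exists_jac_neq0 a p : E p -> p 0 a != 0 -> exists b, (jac a 'X_b Q1 Q2).@[p 0] != 0.
Proof.
move=> Ep pa; apply: contrapT => h.
have j0 b : (jac a 'X_b Q1 Q2).@[p 0] = 0.
  by apply/eqP; apply: contraT => hb; case: h; exists b.
have [[hQ1 hQ2] _ [IQ1 IQ2] _] := penc.
pose u b := (Q1^`M(b)).@[p 0]; pose w b := (Q2^`M(b)).@[p 0].
have euler Q : Q \is 2.-homog -> I Q -> \sum_b (Q^`M(b)).@[p 0] * p 0 b = 0.
  move=> hQ IQ; have := polar_diag p hQ; rewrite IQ // mul0rn /polar linform_sum => e.
  by rewrite -[RHS]e; apply: eq_bigr => b _; rewrite mxE.
have eu := euler Q1 hQ1 IQ1; have ew := euler Q2 hQ2 IQ2.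
have dX i j : (('X_i : S)^`M(j)).@[p 0] = (j == i)%:R.
  by rewrite -lpoly_delta mderiv_lpoly mevalC mxE eqxx andbT.
have minor b c : b != a -> c != a -> u b * w c = u c * w b.
  apply: det3_minors => {}b; rewrite -(j0 b) /jac meval_det3.
  by apply: det3_eq => // d _; rewrite dX.
have dependent c1 c2 : (forall b, b != a -> c1 * u b + c2 * w b = 0) -> c1 = 0 /\ c2 = 0.
  move=> hc; apply: (pencil_grad_free smE penc Ep).
  apply/colP => b; rewrite !mxE; have [->|ba] := eqVneq b a; last exact: hc.
  apply: (mulIf pa); rewrite mul0r.
  have -> : (c1 * (Q1^`M(a)).@[p 0] + c2 * (Q2^`M(a)).@[p 0]) * p 0 a =
      \sum_b (c1 * u b + c2 * w b) * p 0 b.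
    by rewrite (bigD1 a) //= [X in _ = _ + X]big1 ?addr0 // => b' ba; rewrite hc // mul0r.
  under eq_bigr do rewrite mulrDl -!mulrA.
  by rewrite big_split /= -!mulr_sumr eu ew !mulr0 addr0.
have [[b [ba ub]]|nb] := pselect (exists b, b != a /\ u b != 0).
  have [|_ /eqP] := dependent (w b) (- u b); last by rewrite oppr_eq0 (negPf ub).
  by move=> c ca; rewrite mulNr (minor b c) // mulrC subrr.
have [|/eqP + _] := dependent 1 0; last by rewrite oner_eq0.
move=> b ba; rewrite mul0r addr0 mul1r; apply/eqP; apply: contraT => ub.
by case: nb; exists b.
Qed.

Theorem mixed_eq0_pencils_meet :
  (forall a y, y 0 a = 1 ->
     (mixed a Q1 Q2 R1 R2).@[y 0] + (mixed a R1 R2 Q1 Q2).@[y 0] = 0) ->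
  exists v1 v2, (v1 != 0 \/ v2 != 0) /\ I (v1 *: R1 + v2 *: R2).
Proof.
move=> m0; have [[hQ1 hQ2] _ [IQ1 IQ2] _] := penc.
have [IR2|nIR2] := pselect (I R2).
  by exists 0, 1; rewrite oner_eq0 scale0r scale1r add0r; split=> //; right.
have [p Ep R2p] := exists_nonzero_at nIR2.
have /rV0Pn [a pa] := variety_neq0 irr Ep.
pose c := R1.@[p 0] / R2.@[p 0].
pose f := R1 - c *: R2.
have hf : f \is 2.-homog by rewrite rpredB ?rpredZ.
exists 1, (- c); split; first by left; exact: oner_neq0.
rewrite scale1r scaleNr -/f.
pose D F := jac a F Q1 Q2.
have hW : R1 * D R2 - R2 * D R1 \is 5.-homog.
  apply: rpredB; [apply: (@dhomogM _ _ _ 2 _ 3)|apply: (@dhomogM _ _ _ 2 _ 3)] => //;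
    exact: jac_homog.
have IW : I (R1 * D R2 - R2 * D R1).
  (* The assumption concerns only [y_a = 1]. Homogeneity carries it to all of [E] with [y_a]
     nonzero; the factor ['X_a] covers the rest and is removed by primality. *)
  have : I ('X_a * (R1 * D R2 - R2 * D R1)).
    move=> y Ey; rewrite mevalM mevalXU; have [->|ya] := eqVneq (y 0 a) 0.
      by rewrite mul0r.
    have Ez := variety_scale irr (invr_neq0 ya) Ey.
    have za : ((y 0 a)^-1 *: y) 0 a = 1 by rewrite mxE mulVf.
    have q0 : (mixed a Q1 Q2 R1 R2).@[((y 0 a)^-1 *: y) 0] = 0.
      by apply: meval_mixed_eq0; [exact: IQ1|exact: IQ2].
    have := m0 a _ za; rewrite q0 add0r.
    rewrite [mixed _ _ _ _ _]/(R1 * D R2 - R2 * D R1) (meval_scale _ _ hW) => /eqP.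
    by rewrite mulf_eq0 expf_eq0 invr_eq0 (negPf ya) andbF /= => /eqP ->; rewrite mulr0.
  move/(vanishing_prime irr (homogX _ a) hW) => [/(_ p Ep)|//].
  by rewrite mevalXU => /eqP; rewrite (negPf pa).
have IWf : I (D f * R2 - f * D R2).
  have -> : D f * R2 - f * D R2 = - (R1 * D R2 - R2 * D R1).
    have -> : D f = D R1 - c *: D R2.
      by rewrite /f addrC -scaleNr /D (jac_is_linear a Q1 Q2 (- c) R2 R1) scaleNr addrC.
    by move: (D R1) (D R2) => G1 G2; rewrite /f -!mul_mpolyC; ring.
  exact: (lin_closedN (vanishing_closed E)).
have fp : f.@[p 0] = 0 by rewrite mevalB mevalZ divfK // subrr.
have Dlin c' F G : D (c' *: F + G) = c' *: D F + D G by exact: jac_is_linear.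
have DM F G : D (F * G) = F * D G + G * D F by exact: jacM.
have Dhom d F : F \is d.-homog -> D F \is d.+1.-homog by exact: jac_homog.
have Dvan d F : F \is d.-homog -> I F -> I (D F).
  have [_ _ _ Igen] := penc; move=> hF /(Igen d F hF) [H1 [H2 ->]].
  rewrite /D jac_pencil; move: (jac a H1 Q1 Q2) (jac a H2 Q1 Q2) => G1 G2 x Ex.
  by rewrite mevalD !mevalM IQ1 // IQ2 // !mul0r addr0.
apply: (jets_vanish char0 irr degE Dlin DM Dhom Dvan (jac_chart a Q1 Q2) Ep pa
  (exists_jac_neq0 Ep pa) hf) => n.
have [A _ IA] := jet_quotient Dlin DM Dhom Dvan hf hR2 IWf n.
have /eqP := IA p Ep; rewrite mevalB !mevalM fp mulr0 subr0 rmorphXn /= mulf_eq0.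
by rewrite expf_eq0 (negPf R2p) andbF => /eqP.
Qed.

End TangentPencils.

(** * Families of pencils *)

Section MeetingPlanes.
Variables (K : fieldType) (vT : vectType K).
Implicit Types (U V W : {vspace vT}) (u v w q : vT).

Lemma plane_spanned U u w : \dim U = 2%N -> u \in U -> w \in U -> u != 0 ->
  w \notin <[u]>%VS -> (U <= <[u]> + <[w]>)%VS.
Proof.
move=> dU uU wU u0 wu.
have w0 : w != 0 by apply: contraNneq wu => ->; exact: mem0v.
have dis : (<[u]> :&: <[w]>)%VS = 0%VS.
  apply/eqP; rewrite -subv0; apply/subvP => z /memv_capP [zu /vlineP [a za]].
  have [a0|a0] := eqVneq a 0; first by rewrite za a0 scale0r mem0v.
  have : a^-1 *: z \in <[u]>%VS by apply: memvZ.
  by rewrite za scalerA mulVf // scale1r (negPf wu).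
have sub : (<[u]> + <[w]> <= U)%VS.
  by rewrite subv_add -!memvE uU.
by rewrite -(geq_leqif (dimv_leqif_sup sub)) dimv_disjoint_sum // !dim_vline u0 w0 dU.
Qed.

(** Two distinct planes share a line [<q>] and span [W]. A plane without [q] meets both in
    independent vectors, so it lies in [W]. If such a plane exists, a plane through [q] meets it
    outside [<q>], so it also contains two independent vectors of [W]. The vector [v0] serves the
    empty family. *)
Lemma meeting_planes (J : Type) (P : J -> {vspace vT}) (v0 : vT) : v0 != 0 ->
  (forall i, \dim (P i) = 2%N) ->
  (forall i j, exists2 q, q != 0 & q \in P i /\ q \in P j) ->
  (exists2 q, q != 0 & forall i, q \in P i) \/
  (exists2 W, \dim W = 3%N & forall i, (P i <= W)%VS).
Proof.
move=> v00 dP meet.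
have [[i0]|nJ] := pselect (inhabited J); last first.
  by left; exists v0 => // i; case: nJ.
have [[i [j Pij]]|allE] := pselect (exists i j, P i <> P j); last first.
  have [q q0 [qi _]] := meet i0 i0; left; exists q => // j.
  suff <- : P i0 = P j by [].
  by apply: contrapT => h; apply: allE; exists i0, j.
have [q q0 [qi qj]] := meet i j.
have capq : (P i :&: P j <= <[q]>)%VS.
  apply/subvP => z /memv_capP [zi zj]; apply: contraT => zq; case: Pij.
  have sub_i := plane_spanned (dP i) qi zi q0 zq.
  have sub_j := plane_spanned (dP j) qj zj q0 zq.
  have le (l : J) : q \in P l -> z \in P l -> (<[q]> + <[z]> <= P l)%VS.
    by move=> ql zl; rewrite subv_add -!memvE ql.
  by apply/eqP; rewrite eqEsubv (subv_trans sub_i (le j qj zj)) (subv_trans sub_j (le i qi zi)).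
have dcap : \dim (P i :&: P j) = 1%N.
  apply/eqP; rewrite eqn_leq; apply/andP; split.
    by apply: leq_trans (dimvS capq) _; rewrite dim_vline q0.
  have : (<[q]> <= P i :&: P j)%VS by rewrite -memvE; apply/memv_capP.
  by move/dimvS; rewrite dim_vline q0.
pose W := (P i + P j)%VS.
have dW : \dim W = 3%N by have := dimv_sum_cap (P i) (P j); rewrite dcap !dP addn1 => -[].
have iW : (P i <= W)%VS := addvSl _ _.
have jW : (P j <= W)%VS := addvSr _ _.
have claim l : q \notin P l -> (P l <= W)%VS.
  move=> ql; have [u u0 [ul ui]] := meet l i; have [w w0 [wl wj]] := meet l j.
  have wu : w \notin <[u]>%VS.
    apply/negP => /vlineP [a wa].
    have a0 : a != 0 by apply: contraNneq w0 => a0; rewrite wa a0 scale0r.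
    have uj : u \in P j.
      by rewrite -[u]scale1r -(mulVf a0) -scalerA -wa memvZ.
    have /vlineP [b ub] : u \in <[q]>%VS by apply: (subvP capq); apply/memv_capP.
    have b0 : b != 0 by apply: contraNneq u0 => b0; rewrite ub b0 scale0r.
    by case/negP: ql; rewrite -[q]scale1r -(mulVf b0) -scalerA -ub memvZ.
  apply: subv_trans (plane_spanned (dP l) ul wl u0 wu) _.
  by rewrite subv_add -!memvE (subvP iW) // (subvP jW).
have [allq|nq] := pselect (forall l, q \in P l); first by left; exists q.
have [l0 ql0] : exists l, q \notin P l.
  apply: contrapT => h; apply: nq => l; apply: contraT => ql; case: h; by exists l.
right; exists W => // m; have [qm|qm] := boolP (q \in P m); last exact: claim.
have [v v1 [vm vl]] := meet m l0.
have vq : v \notin <[q]>%VS.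
  apply/negP => /vlineP [a va]; have a0 : a != 0.
    by apply: contraNneq v1 => a0; rewrite va a0 scale0r.
  by case/negP: ql0; rewrite -[q]scale1r -(mulVf a0) -scalerA -va memvZ.
apply: subv_trans (plane_spanned (dP m) qm vm q0 vq) _.
by rewrite subv_add -!memvE (subvP iW) // (subvP (claim _ ql0)).
Qed.

Lemma planes_in_3space_meet U V W : \dim U = 2%N -> \dim V = 2%N -> \dim W = 3%N ->
  (U <= W)%VS -> (V <= W)%VS -> exists2 q, q != 0 & q \in U /\ q \in V.
Proof.
move=> dU dV dW UW VW; exists (vpick (U :&: V)).
  rewrite vpick0 -dimv_eq0 -lt0n.
  have : (\dim (U + V) <= 3)%N by rewrite -dW dimvS // subv_add UW.
  by have := dimv_sum_cap U V; rewrite dU dV; lia.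
by apply/memv_capP; exact: memv_pick.
Qed.

End MeetingPlanes.

Section CurlSums.
Variable k : closedFieldType.
Local Notation S := {mpoly k[4]}.

Lemma curl_suml (N : nat) a (u : 'I_N -> 'I_4 -> k) dv :
  curl a (fun b => \sum_l u l b) dv = \sum_l curl a (u l) dv.
Proof.
rewrite /curl; case: (others a) => -[b c] d.
by rewrite !mulr_suml -sumrB -big_split.
Qed.

Lemma curl_sumr (N : nat) a u (dv : 'I_N -> 'I_4 -> 'I_4 -> k) :
  curl a u (fun e b => \sum_l dv l e b) = \sum_l curl a u (dv l).
Proof.
rewrite /curl; case: (others a) => -[b c] d.
by rewrite -!sumrB !mulr_sumr -sumrB -big_split.
Qed.

Lemma wedge_suml (N : nat) (P : 'I_N -> 'I_4 -> 'I_4 -> k) x v :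
  wedge (fun b d => \sum_l P l b d) x v = \sum_l wedge (P l) x v.
Proof.
by rewrite /wedge !mulr_suml -!(sumrB, big_split).
Qed.

Lemma represents_sum (N : nat) (c : 'I_N -> k) Pi M al :
  (forall l, represents (Pi l) (M l) (al l)) ->
  represents (fun x s t => \sum_l c l * Pi l x s t)
    (fun b d => \sum_l c l *: M l b d) (fun b => \sum_l c l *: al l b).
Proof.
move=> rep; split=> [b d|x s t x0 xs xt|x b].
- split.
  + by apply: rpred_sum => l _; apply: rpredZ; have [/(_ b d) []] := rep l.
  + rewrite -sumrN; apply: eq_bigr => l _; have [/(_ b d) [_ {1}-> _] _ _] := rep l.
    by rewrite scalerN.
  + by apply: big1 => l _; have [/(_ b b) [_ _ ->] _ _] := rep l; rewrite scaler0.
- under [RHS]eq_bigr do under eq_bigr do rewrite raddf_sum mulr_sumr.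
  under [RHS]eq_bigr do rewrite exchange_big.
  rewrite exchange_big; apply: eq_bigr => l _ /=; have [_ -> // _] := rep l.
  rewrite mulr_sumr; apply: eq_bigr => b _; rewrite mulr_sumr; apply: eq_bigr => d _.
  by rewrite mevalZ; ring.
- transitivity (wedge (fun b d => \sum_l c l * (M l b d).@[x 0]) (x 0)
    (fun d => (d == b)%:R)).
    apply: wedge_eq => // d e; rewrite raddf_sum /=; apply: eq_bigr => l _.
    by rewrite /= mevalZ.
  rewrite wedge_suml raddf_sum; apply: eq_bigr => l _ /=.
  by rewrite mevalZ; have [_ _ <-] := rep l; rewrite /wedge; ring.
Qed.

Lemma curl_value_pencil_forms (N : nat) (c : 'I_N -> k) (Q1 Q2 : 'I_N -> S) a y :
  curl_value (fun b => \sum_l pencil_form (c l) (Q1 l) (Q2 l) b) a y =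
  \sum_l \sum_m 2%:R * (c l * c m) * (mixed a (Q1 l) (Q2 l) (Q1 m) (Q2 m)).@[y 0].
Proof.
transitivity (curl a (fun b => \sum_l (pencil_form (c l) (Q1 l) (Q2 l) b).@[y 0])
  (fun e b => \sum_l ((pencil_form (c l) (Q1 l) (Q2 l) b)^`M(e)).@[y 0])).
  rewrite /curl_value; congr (curl a _ _); apply/funext => b; first by rewrite raddf_sum.
  apply/funext => e; by rewrite [X in X.@[_]](linear_sum (mderiv b)) raddf_sum.
rewrite curl_suml; apply: eq_bigr => l _; rewrite curl_sumr; apply: eq_bigr => m _.
exact: curl_pencil_form.
Qed.

Lemma sum_antisym_eq0 (N : nat) (t : 'I_N -> 'I_N -> k) : (2%:R : k) != 0 ->
  (forall l m, t l m + t m l = 0) -> \sum_l \sum_m t l m = 0.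
Proof.
move=> two0 h; set s := LHS.
have : s + s = 0.
  rewrite {2}/s exchange_big -big_split big1 // => l _.
  by rewrite -big_split big1 // => m _; exact: h.
by rewrite -mulr2n -mulr_natl => /eqP; rewrite mulf_eq0 (negPf two0) => /eqP.
Qed.

End CurlSums.

Section SingleCurve.
Variables (k : closedFieldType) (E : set 'rV[k]_4) (Q1 Q2 : {mpoly k[4]}).
Local Notation S := {mpoly k[4]}.
Local Notation I := (vanishing E).
Hypotheses (char0 : [pchar k] =i pred0) (nE : normal_elliptic_curve E)
  (penc : is_pencil E Q1 Q2).

Lemma FO_represents Pi : FO_bracket E Pi ->
  exists l M, l != 0 /\ represents Pi M (pencil_form l Q1 Q2).
Proof.
have [irr degE _ _ lc] := nE.
move=> /(FO_formula char0 irr degE lc penc) [c [M [c0 hM PiE wM]]].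
exists c, M; split=> //; split=> // [b d|x b].
  have [h1 h2] := hM b d; split=> //; have [_ /eqP] := hM b b.
  rewrite -subr_eq0 opprK -mulr2n -mulr_natl mulf_eq0 => /orP [/eqP two|/eqP //].
  have /eqP := two_neq0 char0; case.
  by have := congr1 (fun p : S => p.@[0 : 'I_4 -> k]) two; rewrite -mpolyC_nat mevalC meval0.
have := wM x (delta_mx 0 b).
have pE Q : polar Q x (delta_mx 0 b) = (Q^`M(b)).@[x 0].
  by rewrite /polar /linform -rowE !mxE.
rewrite !pE /pencil_form mevalZ mevalB !mevalM => <-.
by apply: wedge_eq => // d; rewrite !mxE eqxx.
Qed.

Variable K : {vspace dhomog 4 k 2}.
Hypothesis KI : forall q : dhomog 4 k 2, (q \in K) <-> I (mpoly_of_dhomog q).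

Lemma quadric_space_dim : \dim K = 2%N.
Proof.
have [irr degE _ _ lc] := nE; have [[hQ1 hQ2] _ _ _] := penc.
apply/eqP; rewrite eqn_leq (dim_quadric_space irr degE lc KI) andbT.
pose q1 := DHomog hQ1; pose q2 := DHomog hQ2.
have sub : (K <= <[q1]> + <[q2]>)%VS.
  apply/subvP => q /KI /(pencil_span penc (dhomog_is_dhomog q)) [a [b e]].
  have -> : q = a *: q1 + b *: q2 by apply: val_inj.
  by apply: memv_add; apply: memvZ; exact: memv_line.
apply: leq_trans (dimvS sub) (leq_trans (dimv_add_leqif _ _).1 _).
by rewrite !dim_vline; case: (_ != 0); case: (_ != 0).
Qed.

Lemma mem_quadric_space q : (q \in K) <-> E `<=` quadric_surface q.
Proof.
have [irr _ _ _ _] := nE; rewrite KI; split=> [Iq x Ex|Eq x /Eq /zerosP [_ ->] //].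
by apply/zerosP; split=> [|F ->]; [exact: (variety_neq0 irr Ex)|exact: Iq].
Qed.

Lemma pencil_intersection (q1 q2 : dhomog 4 k 2) :
  mpoly_of_dhomog q1 = Q1 -> mpoly_of_dhomog q2 = Q2 ->
  E = quadric_surface q1 `&` quadric_surface q2.
Proof.
have [irr _ _ _ _] := nE; have [_ _ [IQ1 IQ2] _] := penc.
move=> e1 e2; apply/seteqP; split=> [x Ex|x [/zerosP [x0 h1] /zerosP [_ h2]]].
  by split; apply: (proj1 (mem_quadric_space _)) Ex; apply/KI; rewrite ?e1 ?e2.
by apply: (pencil_zeros irr penc x0); [rewrite -e1; exact: h1|rewrite -e2; exact: h2].
Qed.

(** If the equations were proportional, [E] would be the whole quadric [q1 = 0], contrary to
    [curve_neq_quadric]. *)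
Lemma intersection_spans (q1 q2 : dhomog 4 k 2) : q1 != 0 ->
  E = quadric_surface q1 `&` quadric_surface q2 -> (K <= <[q1]> + <[q2]>)%VS.
Proof.
have [irr _ _ _ lc] := nE; move=> q10 eE.
have q1K : q1 \in K by apply/mem_quadric_space; rewrite eE => x [].
have q2K : q2 \in K by apply/mem_quadric_space; rewrite eE => x [].
apply: (plane_spanned quadric_space_dim) => //; apply/negP => /vlineP [a e2].
have q10' : mpoly_of_dhomog q1 != 0.
  by apply: contraNneq q10 => h; apply/eqP; apply: val_inj.
have [p [p0 q1p]] := curve_neq_quadric char0 irr lc penc (dhomog_is_dhomog q1) q10'
  (proj1 (KI q1) q1K).
case; rewrite eE; split; apply/zerosP; split=> // F ->; first exact: q1p.
by rewrite e2 mevalZ q1p mulr0.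
Qed.

End SingleCurve.

Section Families.
Variables (k : closedFieldType) (char0 : [pchar k] =i pred0) (I : Type)
  (E : I -> set 'rV[k]_4) (Pi : I -> bivector_values k 3).
Local Notation S := {mpoly k[4]}.
Hypotheses (nE : forall i, normal_elliptic_curve (E i))
  (FOPi : forall i, FO_bracket (E i) (Pi i)).

Variable K : I -> {vspace dhomog 4 k 2}.
Hypothesis KI : forall i (q : dhomog 4 k 2),
  (q \in K i) <-> vanishing (E i) (mpoly_of_dhomog q).

Lemma exists_pencils : exists Q1 Q2 : I -> S, forall i, is_pencil (E i) (Q1 i) (Q2 i).
Proof.
have ex i : exists Q : S * S, is_pencil (E i) Q.1 Q.2.
  have [irr degE _ _ lc] := nE i; have [Q1 [Q2 h]] := exists_pencil char0 irr degE lc.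
  by exists (Q1, Q2).
have [Q hQ] := choice ex; by exists (fun i => (Q i).1), (fun i => (Q i).2).
Qed.

Lemma compatible_iff_pencils_meet : compatible Pi <->
  forall i j, exists2 q, q != 0 & q \in K i /\ q \in K j.
Proof.
have [Q1 [Q2 penc]] := exists_pencils.
have ex i : exists lM : k * ('I_4 -> 'I_4 -> S),
    lM.1 != 0 /\ represents (Pi i) lM.2 (pencil_form lM.1 (Q1 i) (Q2 i)).
  by have [l [M h]] := FO_represents char0 (nE i) (penc i) (FOPi i); exists (l, M).
have [lM repM] := choice ex; pose l i := (lM i).1.
have l0 i : l i != 0 by have [] := repM i.
have poisson_iff m (c : 'I_m -> k) (i : 'I_m -> I) :
    Poisson_bivector (fun x s t => \sum_n c n * Pi (i n) x s t) <->
    forall a (y : 'rV[k]_4), y 0 a = 1 -> \sum_n \sum_p 2%:R * (c n * l (i n) * (c p * l (i p))) *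
      (mixed a (Q1 (i n)) (Q2 (i n)) (Q1 (i p)) (Q2 (i p))).@[y 0] = 0.
  have rep := represents_sum c (fun n => (repM (i n)).2).
  have e : (fun b => \sum_n c n *: pencil_form (l (i n)) (Q1 (i n)) (Q2 (i n)) b) =
      (fun b => \sum_n pencil_form (c n * l (i n)) (Q1 (i n)) (Q2 (i n)) b).
    by apply/funext => b; apply: eq_bigr => n _; rewrite /pencil_form scalerA.
  rewrite (poisson_iff_curl rep) e.
  by split=> h a y ya; have := h a y ya; rewrite curl_value_pencil_forms.
split=> [comp i j|meet m c i].
  (* The sum of the two brackets suffices: [mixed] of a pencil with itself is zero, so only the
     cross terms remain, with the nonzero factor [2 l_i l_j]. *)
  pose g (n : 'I_2) := if n == 0 then i else j; have := comp 2 (fun _ => 1) g.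
  move/poisson_iff => h.
  have [irr degE smE _ lc] := nE i; have [[hR1 hR2] indep _ _] := penc j.
  have [|v1 [v2 [v0 Iv]]] := mixed_eq0_pencils_meet char0 irr degE smE (penc i) hR1 hR2.
    move=> a y ya; have := h a y ya.
    pose f i j := (mixed a (Q1 i) (Q2 i) (Q1 j) (Q2 j)).@[y 0].
    have f0 n : f n n = 0.
      rewrite /f (_ : mixed _ _ _ _ _ = 0) ?meval0 //.
      by rewrite /mixed /jac /det3; case: (others a) => -[b d] e; ring.
    change (\sum_n \sum_p 2%:R * (1 * l (g n) * (1 * l (g p))) * f (g n) (g p) = 0 ->
      f i j + f j i = 0).
    clearbody f; rewrite !big_ord_recl !big_ord0 /g /= !f0.
    rewrite !mul1r !mulr0 !addr0 !add0r (mulrC (l j)) -mulrDr => /eqP.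
    by rewrite !mulf_eq0 (negPf (two_neq0 char0)) !(negPf (l0 _)) => /eqP.
  have hq : v1 *: Q1 j + v2 *: Q2 j \is 2.-homog by rewrite rpredD ?rpredZ.
  exists (DHomog hq); last first.
    split; apply/KI => //= x Ex; have [_ _ [I1 I2] _] := penc j.
    by rewrite mevalD !mevalZ I1 // I2 // !mulr0 addr0.
  apply/eqP => /(congr1 (@mpoly_of_dhomog _ _ _)) /= /indep [e1 e2].
  by case: v0; rewrite ?e1 ?e2 eqxx.
(* A common quadric makes the symmetrized [mixed] zero, so the terms [(n, p)] and [(p, n)] cancel
   whatever the coefficients are. *)
apply/poisson_iff => a y ya; apply: sum_antisym_eq0 => [|n p]; first exact: two_neq0.
rewrite (mulrC (c p * _)) -mulrDr -mevalD.
have [q q0 [/KI In /KI Ip]] := meet (i n) (i p).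
have [u1 [u2 eu]] := pencil_span (penc (i n)) (dhomog_is_dhomog q) In.
have [v1 [v2 ev]] := pencil_span (penc (i p)) (dhomog_is_dhomog q) Ip.
rewrite (@mixed_dependent _ a _ _ _ _ u1 u2 v1 v2) ?meval0 ?mulr0 -?eu //.
apply: contrapT => u0; case/eqP: q0; apply: val_inj; rewrite /= eu.
have [->|u1'] := eqVneq u1 0; last by case: u0; left.
have [->|u2'] := eqVneq u2 0; last by case: u0; right.
by rewrite !scale0r addr0.
Qed.

Lemma pencils_meet_iff : (forall i j, exists2 q, q != 0 & q \in K i /\ q \in K j) <->
  (exists q : dhomog 4 k 2, q != 0 /\ forall i, q \in K i) \/
  (exists W : {vspace dhomog 4 k 2}, \dim W = 3%N /\ forall i, (K i <= W)%VS).
Proof.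
have [Q1 [Q2 penc]] := exists_pencils.
have dK i : \dim (K i) = 2%N by exact: (quadric_space_dim (nE i) (penc i) (KI i)).
split=> [meet|[[q [q0 qK]] i j|[W [dW KW]] i j]].
- have hX : ('X_o0 : S) ^+ 2 \is 2.-homog by apply: homogXn; exact: homogX.
  have X0 : DHomog hX != 0.
    apply/eqP => /(congr1 (@mpoly_of_dhomog _ _ _)) /= /(congr1 (meval (fun _ => 1))).
    by rewrite rmorphXn /= mevalXU meval0 expr1n => /eqP; rewrite oner_eq0.
  have [[q q0 qK]|[W dW KW]] := meeting_planes X0 dK meet; first by left; exists q.
  by right; exists W.
- by exists q => //; split.
- exact: (planes_in_3space_meet (dK i) (dK j) dW (KW i) (KW j)).
Qed.

Lemma quadric_space_sub i (W : {vspace dhomog 4 k 2}) : (K i <= W)%VS <->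
  exists q1 q2 : dhomog 4 k 2, [/\ q1 \in W, q2 \in W, q1 != 0, q2 != 0 &
    E i = quadric_surface q1 `&` quadric_surface q2].
Proof.
have [Q1 [Q2 penc]] := exists_pencils; have [[hQ1 hQ2] indep [I1 I2] _] := penc i.
split=> [KW|[q1 [q2 [q1W q2W q10 q20 eE]]]]; last first.
  apply: subv_trans (intersection_spans char0 (nE i) (penc i) (KI i) q10 eE) _.
  by rewrite subv_add -!memvE q1W.
exists (DHomog hQ1), (DHomog hQ2).
have nz Q : Q != 0 -> forall hQ : Q \is 2.-homog, DHomog hQ != 0.
  by move=> Q0 hQ; apply: contraNneq Q0 => /(congr1 (@mpoly_of_dhomog _ _ _)) /= ->.
split.
- by apply: (subvP KW); apply/KI.
- by apply: (subvP KW); apply/KI.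
- apply: nz; apply/eqP => e; have [|/eqP + _] := indep 1 0; last by rewrite oner_eq0.
  by rewrite e scale0r scaler0 addr0.
- apply: nz; apply/eqP => e; have [|_ /eqP] := indep 0 1; last by rewrite oner_eq0.
  by rewrite e scale0r scaler0 addr0.
- exact: (pencil_intersection (nE i) (penc i) (KI i)).
Qed.

End Families.

Theorem theoremA (k : closedFieldType) (char0 : [pchar k] =i pred0)
    (I : Type) (E : I -> set 'rV[k]_4) (Pi : I -> bivector_values k 3)
    (hE : forall i, normal_elliptic_curve (E i))
    (hPi : forall i, FO_bracket (E i) (Pi i)) :
  compatible Pi <->
  ((exists q : dhomog 4 k 2, q != 0 /\ forall i, E i `<=` quadric_surface q) \/
   (exists W : {vspace dhomog 4 k 2}, \dim W = 3%N /\
      forall i, exists q1 q2 : dhomog 4 k 2,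
        [/\ q1 \in W, q2 \in W, q1 != 0, q2 != 0 &
            E i = quadric_surface q1 `&` quadric_surface q2])).
Proof.
have [K KI] := choice (fun i => exists_quadric_space (E i)).
rewrite (compatible_iff_pencils_meet char0 hE hPi KI) (pencils_meet_iff char0 hE KI).
split=> -[[q [q0 qK]]|[W [dW KW]]].
- by left; exists q; split=> // i; apply/(mem_quadric_space (hE i) (KI i)).
- by right; exists W; split=> // i; apply/(quadric_space_sub char0 hE KI).
- by left; exists q; split=> // i; apply/(mem_quadric_space (hE i) (KI i)).
- by right; exists W; split=> // i; apply/(quadric_space_sub char0 hE KI).
Qed.
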